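(* Let $Y$ be an infinite-dimensional block subspace of $X_{\mathcal D}$. Then there exists a normalized collection $(y_\lambda)_{\lambda\in\mathcal D}$ in $Y$ that is block with respect to the lexicographical order of $\mathcal D$ such that the following holds: for every $N\in\mathbb N$, every $(\mu_\lambda)_{\lambda\in\{0,1\}^N}$ in $\mathcal D$ with $\mu_\lambda\ge\lambda$ for all $\lambda\in\{0,1\}^N$, and any scalars $(a_\lambda)_{\lambda\in\{0,1\}^N}$, $$\max_{\lambda\in\{0,1\}^N}|a_\lambda|\ \le\ \Big\|\sum_{\lambda\in\{0,1\}^N}a_\lambda y_{\mu_\lambda}\Big\|\ \le\ 3\max_{\lambda\in\{0,1\}^N}|a_\lambda|.$$ In particular, the Lebesgue property fails in every infinite-dimensional closed subspace of $X_{\mathcal D}$.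
   Context: A Banach space $X$ has the Lebesgue property if every Riemann-integrable function $f:[0,1]\to X$ is continuous outside a set of Lebesgue measure zero. A block subspace of $X_{\mathcal D}$ is the closed linear span of an infinite block sequence of $(e_i)$. The ''lexicographical order of $\mathcal D$'' is the enumeration $\emptyset,(0),(1),(0,0),(0,1),\dots$ (by height, and lexicographically within each height); a collection $(y_\lambda)_{\lambda\in\mathcal D}$ is block with respect to it if, enumerated this way, it is a block sequence of $(e_i)$. Schreier families. $S_0=\{\{i\}: i\in\mathbb N\}$, $S_1=\{F\subset\mathbb N:\mathrm{card}(F)\le\min F\}$, and $S_{n+1}=\{F_1\cup\dots\cup F_d:\ d\le\min F_1,\ F_1<\dots<F_d,\ F_i\in S_n\}$, where $A<B$ means $\max A<\min B$. For finitely supported vectors, $x<y$ means $\mathrm{supp}(x)<\mathrm{supp}(y)$; a block sequence of $(e_i)$ is a sequence of successive vectors $x_1<x_2<\cdots$ in $c_{00}$. A finite block sequence $x_1<\dots<x_k$ is $S_n$-admissible if $\{\min\mathrm{supp}(x_i)\}_{i=1}^k\in S_n$. Parameters. Fix strictly increasing sequences $(m_j)_{j\ge1}$, $(n_j)_{j\ge1}$ of positive integers with $m_1=100$, $n_1=1$, $m_{j+1}\ge j^2m_j^2$ and $n_{j+1}>\frac{4}{\log(100)}n_j\log(m_{j+1})$ for all $j$. Tree. $\mathcal D=\bigcup_{n\ge0}\{0,1\}^n$ is the binary tree, ordered by initial segments ($\lambda\le\mu$ iff $\lambda$ is an initial segment of $\mu$), with minimum the empty sequence $\emptyset$. It carries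 the metric $d(\lambda,\lambda)=0$ and, for $\lambda\ne\mu$, $d(\lambda,\mu)=2^{-n}$, where $n$ is the maximal height of a common initial segment of $\lambda,\mu$. $\overline{\mathcal D}$ is its (compact) completion. $\phi:\{\infty\}\cup\{m_j:j\in\mathbb N\}\to\mathcal D$ is the bijection enumerating $\mathcal D$ by height and lexicographically within each height: $\phi(\infty)=\emptyset$, $\phi(m_1)=(0)$, $\phi(m_2)=(1)$, $\phi(m_3)=(0,0)$, etc. One writes $d(m_j,\cdot)$ for $d(\phi(m_j),\cdot)$, and likewise $d(\infty,\cdot)=d(\phi(\infty),\cdot)$. Norming set. $(e_i)$ is the unit vector basis of $c_{00}$, written $e_i^*$ when viewed as functionals; $c_{00}$ acts on itself by the standard pairing. $W_0=\{\pm e_i^*\}_{i\ge1}$, with $w(\pm e_i^* )=m(\pm e_i^* )=\infty$. $W_1$ is $W_0$ together with all $f=\frac1{m_{j_1}\cdots m_{j_l}}\sum_{k=1}^d e^*_{i_k}$ where $l\ge 1$ and $e^*_{i_1}<\dots<e^*_{i_d}$ are $S_{n_{j_1}+\dots+n_{j_l}}$-admissible. For such $f$, $\vec w(f)=(m_{j_1},\dots,m_{j_l})$, $w(f)=m_{j_1}\cdots m_{j_l}$, $m(f)=\max_z m_{j_z}$. (These need not be uniquely determined by $f$; the notation means that $f$ admits such a representation, which is fixed while working with $f$.) The same conventions apply to the representations below. Given $W_k$, $k\ge1$: (A) $f_1<\dots<f_d$ in $W_k$ are $(n,\lambda)$-packed, $\lambda\in\overline{\mathcal D}$, if they are $S_n$-admissible,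 and for $2\le i\le d$: $w(f_i)\ge2^{\max\mathrm{supp}(f_{i-1})}$ and $d(m(f_i),\lambda)\le2^{-\max\mathrm{supp}(f_{i-1})}$. If in addition $\max_{1\le i\le d}d(m(f_i),\lambda)\le\eta$, they are $(n,\lambda,\eta)$-packed. (B) Inductively for $l\ge2$, $f_1<\dots<f_d$ in $W_k$ are $(n_{j_1},\dots,n_{j_l},\lambda)$-packed if: (1) $w(f_i)\ge2^{\max\mathrm{supp}(f_{i-1})}$ for $2\le i\le d$; (2) there is a partition $F_1<\dots<F_M$ of $\{1,\dots,d\}$ with $\{f_{\min F_k}\}_{k=1}^M$ $S_{n_{j_l}}$-admissible; (3) there are $\lambda_1,\dots,\lambda_M\in\overline{\mathcal D}$ such that $(f_i)_{i\in F_1}$ is $(n_{j_1},\dots,n_{j_{l-1}},\lambda_1)$-packed, and for $2\le k\le M$, $(f_i)_{i\in F_k}$ is $(n_{j_1},\dots,n_{j_{l-1}},\lambda_k,2^{-\max\mathrm{supp}(f_{\max F_{k-1}})})$-packed and $d(\lambda_k,\lambda)\le2^{-\max\mathrm{supp}(f_{\max F_{k-1}})}$. If in addition $\max_i d(m(f_i),\lambda)\le\eta$, they are $(n_{j_1},\dots,n_{j_l},\lambda,\eta)$-packed. $W_{k+1}$ is $W_k$ together with all $f=\frac1{m_{j_1}\cdots m_{j_l}}\sum_{i=1}^df_i$ where $f_1<\dots<f_d$ in $W_k$ are $(n_{j_1},\dots,n_{j_l},\lambda)$-packed for some $\lambda\in\overline{\mathcal D}$; again $\vec w(f)=(m_{j_1},\dots,m_{j_l})$,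 $w(f)=m_{j_1}\cdots m_{j_l}$, $m(f)=\max_zm_{j_z}$. $W=\bigcup_{k\ge0}W_k$, and $X_{\mathcal D}$ is the completion of $c_{00}$ under $\|x\|=\sup\{f(x):f\in W\}$. *)

(* Defs.v *)
From HB Require Import structures.
From mathcomp Require Import all_boot all_order all_algebra.
From mathcomp Require Import finmap.
From mathcomp Require Import all_classical all_reals all_analysis.
Set Implicit Arguments.
Unset Strict Implicit.
Unset Printing Implicit Defensive.
Import Order.TTheory GRing.Theory Num.Theory.
Import numFieldNormedType.Exports.
Local Open Scope classical_set_scope.
Local Open Scope ring_scope.

(* Throughout, N = {1, 2, ...}: sequences indexed by N are functions on nat
   whose value at 0 is irrelevant. *)

(* Sequences over N: coordinate 0 is unused and required to vanish. *)
Definition finitely_supported (R : realType) : {pred nat -> R^o} :=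
  [pred x | (x 0%N == 0) && `[< finite_set [set i | x i != 0] >]].

Lemma finitely_supported_closed (R : realType) :
  GRing.submod_closed (@finitely_supported R).
Proof.
split.
  apply/andP; split; first exact/eqP.
  apply/asboolP.
  rewrite [X in finite_set X](_ : _ = set0); first exact: finite_set0.
  by apply/seteqP; split=> i //= /eqP.
move=> a x y /andP[/eqP x0 /asboolP fx] /andP[/eqP y0 /asboolP fy].
apply/andP; split.
  by apply/eqP; change (a *: x 0%N + y 0%N = 0); rewrite x0 y0 scaler0 addr0.
apply/asboolP; apply: (sub_finite_set _
  (_ : finite_set ([set i | x i != 0] `|` [set i | y i != 0]))).
  move=> i; change (a *: x i + y i != 0 -> x i != 0 \/ y i != 0).
  have [->|xi _] := eqVneq (x i) 0; last by left.
  by rewrite scaler0 add0r => ?; right.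
by rewrite finite_setU; split.
Qed.

HB.instance Definition _ (R : realType) :=
  GRing.isSubmodClosed.Build R (nat -> R^o) (@finitely_supported R)
    (finitely_supported_closed R).

Record c00 (R : realType) := C00 {
  c00_fun :> nat -> R^o;
  c00_subproof : c00_fun \in @finitely_supported R }.

HB.instance Definition _ (R : realType) := [isSub for @c00_fun R].
HB.instance Definition _ (R : realType) := [Choice of c00 R by <:].
HB.instance Definition _ (R : realType) :=
  [SubChoice_isSubLmodule of c00 R by <:].

Lemma unit_vec_subproof (R : realType) (i : nat) :
  (fun k : nat => ((0 < k)%N && (k == i))%:R : R^o) \in @finitely_supported R.
Proof.
apply/andP; split; first exact/eqP.
apply/asboolP; apply: (sub_finite_set _ (finite_set1 i)) => k /=.
by have [//|_] := eqVneq k i; rewrite andbF eqxx.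
Qed.

(* Meant for 1 <= i; unit_vec R 0 = 0. *)
Definition unit_vec (R : realType) (i : nat) : c00 R :=
  C00 (unit_vec_subproof R i).

Section Supports.
Variable R : realType.
Implicit Types x y f : c00 R.

Definition supp x : seq nat := sort leq (fset_set [set i | x i != 0]).
(* Both are 0 for x = 0. *)
Definition minsupp x : nat := head 0%N (supp x).
Definition maxsupp x : nat := last 0%N (supp x).

Definition pairing f x : R := \sum_(i <- supp f) f i * x i.

Definition successive x y : Prop :=
  [/\ x != 0, y != 0 & (maxsupp x < minsupp y)%N].

Definition block_seq (x : nat -> c00 R) : Prop :=
  forall k, successive (x k) (x k.+1).

Definition finite_block (s : seq (c00 R)) : Prop :=
  (forall x, x \in s -> x != 0) /\
  (forall i, (i.+1 < size s)%N -> successive (nth 0 s i) (nth 0 s i.+1)).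

End Supports.

(* A nonempty finite subset of N is represented by the strictly increasing
   list of its elements. *)
Fixpoint schreier (n : nat) (F : seq nat) : Prop :=
  match n with
  | 0 => exists2 i, (0 < i)%N & F = [:: i]
  | n'.+1 =>
    match n' with
    | 0 => [/\ F != [::], sorted ltn F & (size F <= head 0 F)%N]
    | _ => exists Fs : seq (seq nat),
        [/\ Fs != [::], F = flatten Fs, sorted ltn F,
            (size Fs <= head 0 (head [::] Fs))%N
          & forall G, G \in Fs -> schreier n' G]
    end
  end.

Definition schreier_admissible (R : realType) (n : nat) (s : seq (c00 R)) :=
  schreier n [seq minsupp x | x <- s].

Definition node := seq bool.

Fixpoint level (n : nat) : seq node :=
  if n is n'.+1 then [seq b :: s | b <- [:: false; true], s <- level n']
  else [:: [::]].

(* The k-th node (k >= 0) in the enumeration by height, and lexicographically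
   within each height; there are more than k nodes of height at most k. *)
Definition enum_node (k : nat) : node :=
  nth [::] (flatten [seq level n | n <- iota 0 k.+1]) k.

(* The completion of the tree is obtained by adding the infinite branches; see
   [dist_dense] and [dist_complete] below. *)
Inductive cnode := Node of node | Branch of (nat -> bool).

Definition initial (s : node) (x : cnode) : bool :=
  match x with
  | Node t => prefix s t
  | Branch b => s == mkseq b (size s)
  end.

(* For x <> y the infimum is attained at the common initial segment of maximal
   height. *)
Definition dist (R : realType) (x y : cnode) : R :=
  if `[< x = y >] then 0
  else inf [set 2^-1 ^+ size s | s in [set s | initial s x && initial s y]].

Section TreeMetric.
Variable R : realType.
Implicit Types (x y z : cnode) (s t : node).
Local Notation dist := (dist R).

Lemma initial_take s x k : (k <= size s)%N -> initial s x -> initial (take k s) x.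
Proof.
case: x => [t|b] /= ks.
  by apply: prefix_trans; exact: prefix_take.
move=> /eqP sb; rewrite size_takel//; apply/eqP.
by rewrite sb /mkseq -map_take take_iota (minn_idPl ks).
Qed.

Lemma initial_uniq s t x :
  size s = size t -> initial s x -> initial t x -> s = t.
Proof.
case: x => [r|b] /= st.
  by rewrite !prefixE => /eqP <- /eqP <-; rewrite st.
by move=> /eqP -> /eqP ->; rewrite st.
Qed.

Let heights x y : set R :=
  [set 2^-1 ^+ size s | s in [set s | initial s x && initial s y]].

Let initial0 x : initial [::] x. Proof. by case: x => [[]|]. Qed.

Let heights_neq0 x y : (heights x y !=set0)%classic.
Proof.
exists (2^-1 ^+ size ([::] : node)); exists [::] => //.
by apply/andP; split; exact: initial0.
Qed.

Let heights_ge0 x y : lbound (heights x y) 0.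
Proof. by move=> _ [s _ <-]; rewrite exprn_ge0. Qed.

Lemma dist_ge0 x y : 0 <= dist x y.
Proof.
rewrite /Defs.dist; case: ifP => // _.
exact: lb_le_inf (heights_neq0 x y) (@heights_ge0 x y).
Qed.

Lemma dist_sym x y : dist x y = dist y x.
Proof.
rewrite /Defs.dist (_ : `[< x = y >] = `[< y = x >]); last first.
  by apply/asbool_equiv_eq; split=> ->.
case: ifP => // _; congr inf.
by apply/seteqP; split=> _ [s /= h <-]; exists s => //=; rewrite andbC.
Qed.

Lemma dist_le x y s : initial s x -> initial s y -> dist x y <= 2^-1 ^+ size s.
Proof.
move=> sx sy; rewrite /Defs.dist; case: ifP => _; first by rewrite exprn_ge0.
apply: (@inf_lbound _ (heights x y)); last by exists s; rewrite //= sx sy.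
by exists 0; exact: heights_ge0.
Qed.

Lemma dist_lt x y (r : R) : x <> y -> dist x y < r ->
  exists s, [/\ 2^-1 ^+ size s < r, initial s x & initial s y].
Proof.
move=> xy; rewrite /Defs.dist asboolF// => /(inf_lt (heights_neq0 x y)).
by move=> [_ [s /= /andP[sx sy] <-] sr]; exists s.
Qed.

Lemma half_exp_lt (a b : nat) : ((2^-1 : R) ^+ a < 2^-1 ^+ b) = (b < a)%N.
Proof. by apply: ltr_iXn2l; rewrite ?invr_gt0 ?invf_lt1 ?ltr1n. Qed.

Lemma half_exp_small (eps : R) : 0 < eps -> exists k, 2^-1 ^+ k < eps.
Proof.
move=> e0; exists (Num.Def.archi_bound eps^-1).
rewrite exprVn invf_plt ?posrE ?exprn_gt0//.
exact: upper_nthrootP.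
Qed.

Lemma dist0_eq x y : dist x y = 0 -> x = y.
Proof.
move=> d0; apply: contrapT => xy.
have small k : exists s, [/\ (size s = k)%N, initial s x & initial s y].
  have [|s [sk sx sy]] := @dist_lt x y (2^-1 ^+ k) xy.
    by rewrite d0 exprn_gt0.
  move: sk; rewrite half_exp_lt => sk.
  by exists (take k s); rewrite size_takel ?(ltnW sk)//; split=> //;
    apply: initial_take => //; exact: ltnW.
case: x y xy small {d0} => [s|b] [t|c] xy small.
- have [r [rs /= rs' _]] := small (size s).+1.
  by have := size_prefix rs'; rewrite rs ltnn.
- have [r [rs /= rs' _]] := small (size s).+1.
  by have := size_prefix rs'; rewrite rs ltnn.
- have [r [rs /= _ rs']] := small (size t).+1.
  by have := size_prefix rs'; rewrite rs ltnn.
apply: xy; congr Branch; apply: funext => i.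
have [r [rs /= /eqP rb /eqP rc]] := small i.+1.
have : nth false r i = b i by rewrite rb nth_mkseq// rs.
by rewrite rc nth_mkseq// rs.
Qed.

Lemma dist_ultra x y z : dist x z <= Num.max (dist x y) (dist y z).
Proof.
have [->|xy] := pselect (x = y); first by rewrite le_max lexx orbT.
have [<-|yz] := pselect (y = z); first by rewrite le_max lexx.
rewrite leNgt gt_max; apply/negP => /andP[].
move=> /(dist_lt xy)[s [sd sx sy]] /(dist_lt yz)[t [td ty tz]].
wlog st : x z s t {xy yz} sd sx sy td ty tz / (size s <= size t)%N.
  move=> H; have [?|?] := leqP (size s) (size t); first exact: (H x z s t).
  by apply: (H z x t s) => //; rewrite ?(dist_sym z x)//; exact: ltnW.
have ts : take (size s) t = s.
  by apply: (@initial_uniq _ _ y); rewrite ?size_takel//; exact: initial_take.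
have := @dist_le x z s sx; rewrite leNgt sd => H; apply/negP: (isT).
by apply: H; rewrite -ts; exact: initial_take.
Qed.

Lemma dist_dense x (eps : R) : 0 < eps -> exists s, dist (Node s) x < eps.
Proof.
move=> e0; case: x => [s|b].
  by exists s; rewrite /Defs.dist asboolT.
have [k ke] := half_exp_small e0; exists (mkseq b k).
apply: le_lt_trans ke; rewrite -{2}(size_mkseq b k).
by apply: dist_le => /=; rewrite ?prefix_refl// size_mkseq.
Qed.

Lemma dist_complete (u : nat -> cnode) :
  (forall eps : R, 0 < eps -> exists N, forall p q, (N <= p)%N -> (N <= q)%N ->
     dist (u p) (u q) < eps) ->
  exists x, forall eps : R, 0 < eps -> exists N, forall p, (N <= p)%N ->
     dist (u p) x < eps.
Proof.
move=> cau; have [[N [x ux]]|nc] :=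
  pselect (exists N x, forall p, (N <= p)%N -> u p = x).
  exists x => eps e0; exists N => p Np.
  by rewrite ux// /Defs.dist asboolT.
have common k : exists s, (size s = k)%N /\
    exists N, forall p, (N <= p)%N -> initial s (u p).
  have e0 : 0 < (2^-1 : R) ^+ k by rewrite exprn_gt0.
  have [N cN] := cau _ e0.
  have [q Nq uq] : exists2 q, (N <= q)%N & u q <> u N.
    apply: contrapT => h; apply: nc; exists N, (u N) => p Np.
    by apply: contrapT => up; apply: h; exists p.
  have [s [sk sq sN]] := dist_lt uq (cN _ _ Nq (leqnn N)).
  move: sk; rewrite half_exp_lt => /ltnW sk.
  exists (take k s); rewrite size_takel//; split=> //; exists N => p Np.
  have [->|up] := pselect (u p = u N); first exact: initial_take.
  have [t [tk tp tN]] := dist_lt up (cN _ _ Np (leqnn N)).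
  move: tk; rewrite half_exp_lt => /ltnW tk.
  rewrite (_ : take k s = take k t); first exact: initial_take.
  by apply: (@initial_uniq _ _ (u N)); rewrite ?size_takel//; exact: initial_take.
have [S SP] := choice common.
have Stake k l : (k <= l)%N -> take k (S l) = S k.
  move=> kl; have [sk [N hN]] := SP k; have [sl [M hM]] := SP l.
  apply: (@initial_uniq _ _ (u (maxn N M))).
  - by rewrite size_takel ?sk ?sl.
  - by apply: initial_take; rewrite ?sl//; apply: hM; rewrite leq_maxr.
  - by apply: hN; rewrite leq_maxl.
pose b i := nth false (S i.+1) i.
have Sb k : S k = mkseq b k.
  apply: (@eq_from_nth _ false); rewrite ?size_mkseq (SP k).1// => i ik.
  by rewrite nth_mkseq// /b -(Stake _ _ ik) nth_take.
exists (Branch b) => eps e0; have [k ke] := half_exp_small e0.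
have [sk [N hN]] := SP k; exists N => p Np.
apply: le_lt_trans ke; rewrite -sk; apply: dist_le; first exact: hN.
by rewrite /= sk Sb.
Qed.

End TreeMetric.

Definition parameters (R : realType) (m n : nat -> nat) : Prop :=
  [/\ m 1%N = 100%N, n 1%N = 1%N,
      forall j, (1 <= j)%N -> (m j < m j.+1)%N /\ (n j < n j.+1)%N,
      forall j, (1 <= j)%N -> (j ^ 2 * m j ^ 2 <= m j.+1)%N
    & forall j, (1 <= j)%N ->
        4 / ln (100 : R) * (n j)%:R * ln (m j.+1)%:R < (n j.+1)%:R].

Section NormingSet.
Variables (R : realType) (m n : nat -> nat).

(* A functional f together with a chosen vector weight: the list [:: j_1; ...;
   j_l] stands for (m_{j_1}, ..., m_{j_l}), and the empty list for infinity. *)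
Definition wfun : Type := (c00 R * seq nat)%type.

Definition weight (F : wfun) : \bar R :=
  if F.2 is [::] then +oo%E else (\prod_(j <- F.2) m j)%N%:R%:E.

(* phi (m F). Since m is increasing, m(F) is m_j for j the largest entry of F.2
   and phi(m_j) is the j-th node; if F.2 is empty then m(F) is infinite, and
   phi(oo) is the node number 0. *)
Definition weight_node (F : wfun) : cnode :=
  Node (enum_node (\max_(j <- F.2) j)).

Let F0 : wfun := (0, [::]).

Definition very_fast_growing (fs : seq wfun) : Prop :=
  forall i, (i.+1 < size fs)%N ->
    (((2 ^ maxsupp (nth F0 fs i).1)%N)%:R%:E <= weight (nth F0 fs i.+1))%E.

(* The first argument is the list [:: n_{j_1}; ...; n_{j_l}]. The bounded
   version, with an extra parameter eta, is spelled out in [packed_more]. *)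
Inductive packed : seq nat -> cnode -> seq wfun -> Prop :=
| packed_one (k : nat) (lam : cnode) (fs : seq wfun) :
    finite_block [seq F.1 | F <- fs] ->
    schreier_admissible k [seq F.1 | F <- fs] ->
    very_fast_growing fs ->
    (forall i, (i.+1 < size fs)%N ->
       dist R (weight_node (nth F0 fs i.+1)) lam
         <= 2^-1 ^+ maxsupp (nth F0 fs i).1) ->
    packed [:: k] lam fs
| packed_more (ks : seq nat) (k : nat) (lam : cnode)
    (fss : seq (seq wfun)) (lams : nat -> cnode) :
    ks != [::] ->
    finite_block [seq F.1 | F <- flatten fss] ->
    very_fast_growing (flatten fss) ->
    (forall fs, fs \in fss -> fs != [::]) ->
    schreier_admissible k [seq (head F0 fs).1 | fs <- fss] ->
    (forall i, (i < size fss)%N -> packed ks (lams i) (nth [::] fss i)) ->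
    (forall i, (i.+1 < size fss)%N ->
       let eta := 2^-1 ^+ maxsupp (last F0 (nth [::] fss i)).1 in
       (forall F, F \in nth [::] fss i.+1 ->
          dist R (weight_node F) (lams i.+1) <= eta) /\
       dist R (lams i.+1) lam <= eta) ->
    packed (rcons ks k) lam (flatten fss).

Definition index_vector (js : seq nat) : Prop :=
  js != [::] /\ forall j, j \in js -> (1 <= j)%N.

Definition weighted_sum (js : seq nat) (fs : seq (c00 R)) : c00 R :=
  (\prod_(j <- js) m j)%N%:R^-1 *: \sum_(f <- fs) f.

Definition W0 : set wfun :=
  [set F | exists2 i, (1 <= i)%N &
     F = (unit_vec R i, [::]) \/ F = (- unit_vec R i, [::])].

Definition W1 : set wfun :=
  [set F | exists js is_, [/\ index_vector js,
     schreier (\sum_(j <- js) n j)%N is_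
   & F = (weighted_sum js [seq unit_vec R i | i <- is_], js)]].

Definition W_step (W : set wfun) : set wfun :=
  [set F | exists js fs lam, [/\ index_vector js,
     forall G, G \in fs -> W G,
     packed [seq n j | j <- js] lam fs
   & F = (weighted_sum js [seq G.1 | G <- fs], js)]].

Fixpoint W_ (k : nat) : set wfun :=
  match k with
  | 0 => W0
  | 1 => W0 `|` W1
  | k'.+1 => W_ k' `|` W_step (W_ k')
  end.

Definition norming_set : set (c00 R) :=
  [set f | exists k js, W_ k (f, js)].

(* X, with the linear map iota, is the completion of c_00 under the norm
   sup {f(x) : f in W}. *)
Definition is_XD (X : completeNormedModType R) (iota : {linear c00 R -> X}) :=
  (forall x, `|iota x|%:E = ereal_sup [set (pairing f x)%:E | f in norming_set])
  /\ dense (range iota).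

End NormingSet.

Section Subspaces.
Variables (R : realType) (X : completeNormedModType R).

Definition lin_span (A : set X) : set X :=
  [set x | exists N (a : 'I_N -> R) (v : 'I_N -> X),
     (forall i, A (v i)) /\ x = \sum_i a i *: v i].

Definition closed_span (A : set X) : set X := closure (lin_span A).

Definition closed_subspace (Y : set X) : Prop :=
  [/\ closed Y, Y 0 & forall (a : R) u v, Y u -> Y v -> Y (a *: u + v)].

Definition infinite_dimensional (Y : set X) : Prop :=
  forall N (v : 'I_N -> X), (forall i, Y (v i)) -> ~ Y `<=` lin_span (range v).

Definition block_subspace (iota : c00 R -> X) (Y : set X) : Prop :=
  exists2 z : nat -> c00 R, block_seq z & Y = closed_span (range (iota \o z)).

(* The division points are 0 < s_0 < ... < s_(N-1) = 1, with tags xi. *)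
Definition tagged_partition (s : seq R) (xi : nat -> R) : Prop :=
  itv_partition 0 1 s /\
  forall i, (i < size s)%N -> nth 0 (0 :: s) i <= xi i <= nth 0 s i.

Definition mesh_lt (s : seq R) (delta : R) : Prop :=
  forall i, (i < size s)%N -> nth 0 s i - nth 0 (0 :: s) i < delta.

Definition riemann_sum (f : R -> X) (s : seq R) (xi : nat -> R) : X :=
  \sum_(i < size s) (nth 0 s i - nth 0 (0 :: s) i) *: f (xi i).

(* Riemann integrability on [0,1] of a function with values in the Banach
   space Y; values of f outside [0,1] are irrelevant. *)
Definition riemann_integrable (Y : set X) (f : R -> X) : Prop :=
  exists2 I, Y I & forall eps : R, 0 < eps -> exists2 delta : R, 0 < delta &
    forall s xi, tagged_partition s xi -> mesh_lt s delta ->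
      `|riemann_sum f s xi - I| < eps.

(* The Lebesgue property of a closed subspace Y of X, as a Banach space. *)
Definition lebesgue_property (Y : set X) : Prop :=
  forall f : R -> X, (forall t : R, 0 <= t <= 1 -> Y (f t)) ->
    riemann_integrable Y f ->
    (@lebesgue_measure R).-negligible
      [set t : R | 0 <= t <= 1 /\ ~ (f @ within `[0, 1] (nbhs t) --> f t)].

End Subspaces.

(* Main.v *)
(* James' argument, applied to the parameters n_j and m_j, produces in every block
   subspace averages x with |f(x)| <= 30/w(f) for all f of small weight. Rapidly
   increasing sequences of such averages, combined with special convex
   coefficients, give normalized vectors y of weight m_j at which a functional f
   can be large only if m(f) = m_j or if one of its components has small weight.
   Choosing y_lambda of weight m_j with phi(m_j) >= lambda, a functional
   f = (f_1 + ... + f_d) / w has, after its first component acting on the vectors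
   y_(mu_lambda), components whose nodes cluster around l points, where w >= 100^l;
   hence at most l of the vectors are matched by components, and the c_0 upper
   estimate follows by induction on the norming set.
   For the Lebesgue property, a closed subspace almost contains such vectors. The
   function taking the value y_lambda at the dyadic midpoint coded by lambda, and 0
   elsewhere, has Riemann integral 0 by the upper estimate, and it oscillates at
   every point. *)
Require Import Defs.
From HB Require Import structures.
From mathcomp Require Import all_boot all_order all_algebra.
From mathcomp Require Import finmap lra ring.
From mathcomp Require Import all_classical all_reals all_analysis.
Set Implicit Arguments.
Unset Strict Implicit.
Unset Printing Implicit Defensive.
Import Order.TTheory GRing.Theory Num.Theory.
Import numFieldNormedType.Exports.
Local Open Scope classical_set_scope.
Local Open Scope ring_scope.

(** * Finitely supported vectors: supports, duality pairing, restriction to sets of coordinates *)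

Section Vectors.
Variable R : realType.
Implicit Types (x y f g : c00 R) (P Q : pred nat) (i M : nat) (a : R).

(** The obstacle to James' argument is that an admissible sum of functionals, divided by m_j, need
    not belong to W: packing asks for fast growing weights and converging nodes. Along an
    ultrafilter, the weights of functionals norming a block sequence either tend to infinity, and a
    subsequence is packed as it stands, or come from one fixed vector [js]. In the second case [j]
    is appended to [js], since families of type [js] with converging centres may be packed at one
    more level. The first group of each functional escapes the packing conditions, but contributes
    at most 1/100 and is dropped. The lower estimate so obtained loses a factor 2 m_{j+1} on
    S_{n_{j+1}}. Each improvement by 10 costs n_j levels, and the growth of (n_j) pays for enough of
    them to push the constant below 1, absurd for a single normalized vector. A functional with m(f)
    = m_j is only known to act by at most 1 on the vector of weight m_j. This is harmless because,
    in the tree metric, one centre can be close to only one of the relevant nodes. Most arguments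
    restrict functionals to sets of coordinates, so the packing conditions are first put into a form
    stable under restriction. *)

Lemma c00P x y : (forall i, x i = y i) -> x = y.
Proof. by move=> xy; apply/val_inj/funext. Qed.

Lemma c00_0 i : (0 : c00 R) i = 0. Proof. by []. Qed.

Lemma c00_D x y i : (x + y) i = x i + y i. Proof. by []. Qed.

Lemma c00_N x i : (- x) i = - x i. Proof. by []. Qed.

Lemma c00_Z a x i : (a *: x) i = a * x i. Proof. by []. Qed.

Lemma c00_sum I (r : seq I) (Q : pred I) (F : I -> c00 R) i :
  (\sum_(k <- r | Q k) F k) i = \sum_(k <- r | Q k) F k i.
Proof.
by elim/big_rec2: _ => [|k u v _ <-]; rewrite ?c00_0// c00_D.
Qed.

Lemma c00_index0 x : x 0%N = 0.
Proof. by case: x => x /= /andP[/eqP]. Qed.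

Lemma mem_supp x i : (i \in supp x) = (x i != 0).
Proof.
have [_ /asboolP fx] := andP (c00_subproof x).
rewrite /supp mem_sort in_fset_set//; apply/idP/idP; first by rewrite inE.
by move=> xi; rewrite inE.
Qed.

Lemma sorted_supp x : sorted ltn (supp x).
Proof.
by rewrite ltn_sorted_uniq_leq /supp sort_uniq fset_uniq sort_sorted//;
  exact: leq_total.
Qed.

Lemma minsupp_le x i : x i != 0 -> (minsupp x <= i)%N.
Proof.
rewrite -mem_supp /minsupp; have := sorted_supp x.
case: (supp x) => // k s /=; rewrite (path_sortedE ltn_trans) => /andP[/allP ks _].
by rewrite inE => /predU1P[->//|/ks /ltnW].
Qed.

Lemma maxsupp_ge x i : x i != 0 -> (i <= maxsupp x)%N.
Proof.
rewrite -mem_supp /maxsupp; have := sorted_supp x.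
case/lastP: (supp x) => // s k; rewrite last_rcons (sorted_pairwise ltn_trans).
rewrite pairwise_rcons => /andP[/allP ks _].
by rewrite mem_rcons inE => /predU1P[->//|/ks /ltnW].
Qed.

Lemma eq0_lt_minsupp x i : (i < minsupp x)%N -> x i = 0.
Proof. by apply: contraTeq => /minsupp_le; rewrite -leqNgt. Qed.

Lemma eq0_gt_maxsupp x i : (maxsupp x < i)%N -> x i = 0.
Proof. by apply: contraTeq => /maxsupp_ge; rewrite -leqNgt. Qed.

Lemma supp_eq0 x : (supp x == [::]) = (x == 0).
Proof.
apply/eqP/eqP => [sx|->].
  by apply: c00P => i; apply/eqP; have := mem_supp x i; rewrite sx => /esym/negbFE.
by case: (supp _) (mem_supp (0 : c00 R)) => // i s /(_ i); rewrite inE !eqxx.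
Qed.

Lemma minsupp_neq0 x : x != 0 -> x (minsupp x) != 0.
Proof.
rewrite -supp_eq0 -mem_supp /minsupp; case: (supp x) => // i s _.
exact: mem_head.
Qed.

Lemma maxsupp_neq0 x : x != 0 -> x (maxsupp x) != 0.
Proof.
rewrite -supp_eq0 -mem_supp /maxsupp; case/lastP: (supp x) => // s i _.
by rewrite last_rcons mem_rcons mem_head.
Qed.

Lemma minsupp_gt0 x : x != 0 -> (0 < minsupp x)%N.
Proof.
move=> /minsupp_neq0; case: (minsupp x) => //.
by rewrite c00_index0 eqxx.
Qed.

Lemma minsupp_maxsupp x : (minsupp x <= maxsupp x)%N.
Proof.
have [->|x0] := eqVneq x 0; last exact/minsupp_le/maxsupp_neq0.
have /eqP s0 : supp (0 : c00 R) == [::] by rewrite supp_eq0.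
by rewrite /minsupp /maxsupp s0.
Qed.

Lemma pairingE M f x : (maxsupp f < M)%N -> pairing f x = \sum_(i < M) f i * x i.
Proof.
move=> fM; rewrite /pairing -(big_mkord xpredT (fun i => f i * x i)).
rewrite [RHS](bigID (fun i => i \in supp f))/= [X in _ + X]big1 ?addr0; last first.
  by move=> i; rewrite mem_supp negbK => /eqP ->; rewrite mul0r.
rewrite (perm_big [seq i <- index_iota 0 M | i \in supp f]) ?big_filter//=.
apply: uniq_perm.
- exact: sorted_uniq ltn_trans ltnn _ (sorted_supp f).
- by rewrite filter_uniq// iota_uniq.
move=> i; rewrite mem_filter mem_index_iota leq0n/=.
by case: (boolP (i \in supp f)) => //; rewrite mem_supp => /maxsupp_ge /leq_ltn_trans ->.
Qed.

Lemma pairingEr M f x : (maxsupp x < M)%N -> pairing f x = \sum_(i < M) f i * x i.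
Proof.
move=> xM; have [fM|Mf] := ltnP (maxsupp f) M; first exact: pairingE.
rewrite (pairingE x (ltnSn _)) -!(big_mkord xpredT (fun i => f i * x i)).
rewrite (big_cat_nat _ (n := M))//= ?(leqW Mf)// [X in _ + X]big_nat [X in _ + X]big1 ?addr0//.
by move=> i /andP[Mi _]; rewrite (@eq0_gt_maxsupp x i) ?mulr0// (leq_trans xM).
Qed.

Lemma pairingDr f x y : pairing f (x + y) = pairing f x + pairing f y.
Proof.
by rewrite /pairing -big_split; apply: eq_bigr => i _; rewrite c00_D mulrDr.
Qed.

Lemma pairingZr f a x : pairing f (a *: x) = a * pairing f x.
Proof. by rewrite /pairing mulr_sumr; apply: eq_bigr => i _; rewrite c00_Z mulrCA. Qed.

Lemma pairing0r f : pairing f 0 = 0.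
Proof. by rewrite -(scale0r 0) pairingZr mul0r. Qed.

Lemma pairingNr f x : pairing f (- x) = - pairing f x.
Proof. by rewrite -scaleN1r pairingZr mulN1r. Qed.

Lemma pairing_sumr I (r : seq I) (Q : pred I) (F : I -> c00 R) f :
  pairing f (\sum_(k <- r | Q k) F k) = \sum_(k <- r | Q k) pairing f (F k).
Proof.
by elim/big_rec2: _ => [|k u v _ <-]; rewrite ?pairing0r// pairingDr.
Qed.

Lemma pairingC f x : pairing f x = pairing x f.
Proof.
have [fM xM] : (maxsupp f < (maxn (maxsupp f) (maxsupp x)).+1)%N /\
  (maxsupp x < (maxn (maxsupp f) (maxsupp x)).+1)%N by rewrite !ltnS leq_maxl leq_maxr.
by rewrite (pairingE _ fM) (pairingE _ xM); apply: eq_bigr => i _; rewrite mulrC.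
Qed.

Lemma pairingZl a f x : pairing (a *: f) x = a * pairing f x.
Proof. by rewrite !(pairingC _ x) pairingZr. Qed.

Lemma pairing_suml I (r : seq I) (Q : pred I) (F : I -> c00 R) x :
  pairing (\sum_(k <- r | Q k) F k) x = \sum_(k <- r | Q k) pairing (F k) x.
Proof. by rewrite pairingC pairing_sumr; apply: eq_bigr => k _; rewrite pairingC. Qed.

Lemma pairing0l x : pairing 0 x = 0.
Proof. by rewrite pairingC pairing0r. Qed.

Lemma pairingNl f x : pairing (- f) x = - pairing f x.
Proof. by rewrite -scaleN1r pairingZl mulN1r. Qed.

Lemma restr_subproof P x : (fun i => if P i then x i else 0) \in @finitely_supported R.
Proof.
have [/eqP x0 /asboolP fx] := andP (c00_subproof x).
apply/andP; split; first by case: ifP => //=; rewrite x0.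
apply/asboolP; apply: sub_finite_set fx => i /=.
by case: ifP => //; rewrite eqxx.
Qed.

Definition restr P x : c00 R := C00 (restr_subproof P x).

Lemma restrE P x i : restr P x i = if P i then x i else 0. Proof. by []. Qed.

Lemma restrZ P a x : restr P (a *: x) = a *: restr P x.
Proof. by apply: c00P => i; rewrite c00_Z !restrE; case: ifP; rewrite ?mulr0. Qed.

Lemma restrN P x : restr P (- x) = - restr P x.
Proof. by rewrite -scaleN1r restrZ scaleN1r. Qed.

Lemma restr_sum I (r : seq I) (Q : pred I) (F : I -> c00 R) P :
  restr P (\sum_(k <- r | Q k) F k) = \sum_(k <- r | Q k) restr P (F k).
Proof.
apply: c00P => i; rewrite restrE !c00_sum; case: ifP => Pi.
  by apply: eq_bigr => k _; rewrite restrE Pi.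
by rewrite big1// => k _; rewrite restrE Pi.
Qed.

Lemma restr_id P x : (forall i, x i != 0 -> P i) -> restr P x = x.
Proof.
move=> Px; apply: c00P => i; rewrite restrE; case: ifPn => // Pi.
by apply/esym/eqP; apply: contraNT Pi => /Px.
Qed.

Lemma restr_eq0 P x : (forall i, P i -> x i = 0) -> restr P x = 0.
Proof. by move=> Px; apply: c00P => i; rewrite restrE; case: ifP => // /Px. Qed.

Lemma pairing_restr P f x : pairing (restr P f) x = pairing f (restr P x).
Proof.
have [fM pM] : (maxsupp f < (maxn (maxsupp f) (maxsupp (restr P f))).+1)%N /\
  (maxsupp (restr P f) < (maxn (maxsupp f) (maxsupp (restr P f))).+1)%N.
  by rewrite !ltnS leq_maxl leq_maxr.
rewrite (pairingE _ fM) (pairingE _ pM); apply: eq_bigr => i _; rewrite !restrE.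
by case: ifP; rewrite ?mul0r ?mulr0.
Qed.

Lemma minsupp_restr P x : restr P x != 0 -> (minsupp x <= minsupp (restr P x))%N.
Proof.
move=> /minsupp_neq0; rewrite restrE; case: ifP => [_ /minsupp_le//|].
by rewrite eqxx.
Qed.

Lemma maxsupp_restr P x : (maxsupp (restr P x) <= maxsupp x)%N.
Proof.
have [->|] := eqVneq (restr P x) 0.
  have /eqP s0 : supp (0 : c00 R) == [::] by rewrite supp_eq0.
  by rewrite /maxsupp s0.
by move=> /maxsupp_neq0; rewrite restrE; case: ifP => [_ /maxsupp_ge//|]; rewrite eqxx.
Qed.

Lemma minsupp_eq x i : x i != 0 -> (forall k, (k < i)%N -> x k = 0) -> minsupp x = i.
Proof.
move=> xi xk; apply/eqP; rewrite eqn_leq minsupp_le//= leqNgt; apply/negP => /xk.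
by apply/eqP/minsupp_neq0; apply: contra_neq xi => ->.
Qed.

Lemma maxsupp_eq x i : x i != 0 -> (forall k, (i < k)%N -> x k = 0) -> maxsupp x = i.
Proof.
move=> xi xk; apply/eqP; rewrite eqn_leq maxsupp_ge// andbT leqNgt; apply/negP => /xk.
by apply/eqP/maxsupp_neq0; apply: contra_neq xi => ->.
Qed.

Lemma minsuppZ a x : a != 0 -> minsupp (a *: x) = minsupp x.
Proof.
move=> a0; have [->|x0] := eqVneq x 0; first by rewrite scaler0.
apply: minsupp_eq; first by rewrite c00_Z mulf_neq0// minsupp_neq0.
by move=> k /eq0_lt_minsupp xk; rewrite c00_Z xk mulr0.
Qed.

Lemma maxsuppZ a x : a != 0 -> maxsupp (a *: x) = maxsupp x.
Proof.
move=> a0; have [->|x0] := eqVneq x 0; first by rewrite scaler0.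
apply: maxsupp_eq; first by rewrite c00_Z mulf_neq0// maxsupp_neq0.
by move=> k /eq0_gt_maxsupp xk; rewrite c00_Z xk mulr0.
Qed.

Lemma pairing_disjoint f x : (forall i, f i != 0 -> x i = 0) -> pairing f x = 0.
Proof.
move=> fx; rewrite /pairing big_seq big1// => i; rewrite mem_supp => /fx ->.
by rewrite mulr0.
Qed.

Definition precedes x y := (maxsupp x < minsupp y)%N.

Lemma precedes_trans : transitive precedes.
Proof.
move=> y x z xy yz; apply: leq_trans yz; apply: leq_trans xy _.
exact: leq_trans (minsupp_maxsupp y) (leqnSn _).
Qed.

Lemma precedes_eq0 x y i : precedes x y -> x i != 0 -> y i = 0.
Proof. by move=> xy /maxsupp_ge xi; apply/eq0_lt_minsupp/(leq_ltn_trans xi). Qed.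

Lemma precedes_eq0r x y i : precedes x y -> y i != 0 -> x i = 0.
Proof. by move=> xy /minsupp_le xi; apply/eq0_gt_maxsupp/(leq_trans xy). Qed.

Lemma unit_vecE i k : (0 < i)%N -> unit_vec R i k = (k == i)%:R.
Proof. by move=> i0; rewrite /=; case: eqVneq => [->|_]; rewrite ?i0 ?andbF. Qed.

Lemma minsupp_unit_vec i : (0 < i)%N -> minsupp (unit_vec R i) = i.
Proof.
move=> i0; apply: minsupp_eq; first by rewrite unit_vecE// eqxx oner_eq0.
by move=> k ki; rewrite unit_vecE// ltn_eqF.
Qed.

Lemma maxsupp_unit_vec i : (0 < i)%N -> maxsupp (unit_vec R i) = i.
Proof.
move=> i0; apply: maxsupp_eq; first by rewrite unit_vecE// eqxx oner_eq0.
by move=> k ki; rewrite unit_vecE// gtn_eqF.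
Qed.

Lemma unit_vec_neq0 i : (0 < i)%N -> unit_vec R i != 0.
Proof.
move=> i0; apply/negP => /eqP /(congr1 (fun x : c00 R => x i)).
by rewrite unit_vecE// eqxx c00_0 => /eqP; rewrite oner_eq0.
Qed.

Lemma pairing_unit_vec i x : (0 < i)%N -> pairing (unit_vec R i) x = x i.
Proof.
move=> i0; rewrite (@pairingE i.+1) ?maxsupp_unit_vec// big_ord_recr/=.
rewrite i0 eqxx mul1r big1 ?add0r// => k _.
by rewrite (ltn_eqF (ltn_ord k)) andbF mul0r.
Qed.

Lemma restr_unit_vec P i : (0 < i)%N ->
  restr P (unit_vec R i) = if P i then unit_vec R i else 0.
Proof.
move=> i0; apply: c00P => k; rewrite restrE unit_vecE//.
by have [->|ki] := eqVneq k i; case: ifP => // _;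
  rewrite ?unit_vecE ?eqxx ?(negbTE ki)//; case: ifP => // _; rewrite unit_vecE ?(negbTE ki).
Qed.

End Vectors.

(** * Schreier families: heredity, spreading, convolution *)

Section Schreier.
Implicit Types (F G : seq nat) (n : nat).

Lemma flatten_singletons T (s : seq T) : flatten [seq [:: i] | i <- s] = s.
Proof. by elim: s => //= i s ->. Qed.

Lemma head_flatten T (x0 : T) (ss : seq (seq T)) :
  head [::] ss <> [::] -> head x0 (flatten ss) = head x0 (head [::] ss).
Proof. by case: ss => [|[|i s] ss]. Qed.

Lemma flatten_filter_nonempty (T : eqType) (ss : seq (seq T)) :
  flatten [seq s <- ss | s != [::]] = flatten ss.
Proof. by elim: ss => //= -[|i s] ss IH //=; rewrite IH. Qed.

Lemma subseq_flatten_mem (T : eqType) (s : seq T) ss : s \in ss -> subseq s (flatten ss).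
Proof.
move=> /(nthP [::])[k ks <-]; elim: ss k ks => //= u us IH [|k] ku; first exact: prefix_subseq.
by apply: subseq_trans (suffix_subseq u _); exact: IH.
Qed.

Lemma schreier_sorted n F : schreier n F -> sorted ltn F.
Proof. by case: n => [[i _ ->]//|[|n]] => [[]|[Fs []]]. Qed.

Lemma schreier_neq0 n F : schreier n F -> F != [::].
Proof.
elim: n F => [F [i _ ->]//|[|n] IH F]; first by case.
move=> [[|G Fs] [//= _ -> _ _ /(_ G)]]; rewrite mem_head => /(_ isT)/IH.
by case: G.
Qed.

Lemma schreier_gt0 n F : schreier n F -> forall i, i \in F -> (0 < i)%N.
Proof.
elim: n F => [F [i i0 ->] k|[|n] IH F]; first by rewrite inE => /eqP ->.
  move=> [F0 sF FF] i; case: F F0 sF FF => //= k F _.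
  rewrite (path_sortedE ltn_trans) => /andP[/allP kF _] Fk.
  rewrite inE => /predU1P[->|/kF]; first exact: leq_trans Fk.
  exact: leq_ltn_trans.
move=> [Fs [_ -> _ _ FsP]] i /flattenP[G /FsP/IH GP]; exact: GP.
Qed.

(* The definition of S_1 is an instance of the recursion from S_0. *)
Lemma schreierS n F : schreier n.+1 F <-> exists Fs : seq (seq nat),
  [/\ Fs != [::], F = flatten Fs, sorted ltn F,
      (size Fs <= head 0 (head [::] Fs))%N & forall G, G \in Fs -> schreier n G].
Proof.
case: n => // ; split=> [[F0 sF FF]|[Fs [Fs0 -> sF sFs FsP]]].
  exists [seq [:: i] | i <- F]; rewrite flatten_singletons size_map; split=> //.
  - by case: F F0 {sF FF}.
  - by case: F F0 FF {sF}.
  move=> G /mapP[i iF ->]; exists i => //.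
  case: F F0 sF FF iF => //= k F _; rewrite (path_sortedE ltn_trans).
  move=> /andP[/allP kF _] Fk; rewrite inE => /predU1P[->|/kF]; first exact: leq_trans Fk.
  exact: leq_ltn_trans.
have -> : flatten Fs = [seq head 0%N G | G <- Fs].
  elim: Fs FsP {Fs0 sF sFs} => //= G Fs IH FsP.
  rewrite IH; first by have [i _ ->] := FsP G (mem_head _ _).
  by move=> H HFs; apply: FsP; rewrite inE HFs orbT.
split; first by case: Fs Fs0 {sF sFs FsP}.
- suff -> : [seq head 0%N G | G <- Fs] = flatten Fs by [].
  elim: Fs FsP {Fs0 sF sFs} => //= G Fs IH FsP.
  rewrite IH; first by have [i _ ->] := FsP G (mem_head _ _).
  by move=> H HFs; apply: FsP; rewrite inE HFs orbT.
by case: Fs Fs0 sFs {sF FsP} => //= G Fs _; rewrite size_map.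
Qed.

(** Empty pieces are kept, so that the k-th piece stays inside the k-th block; [schreier_spread]
    discards them afterwards. *)
Lemma subseq_flatten (T : eqType) (s : seq T) (ss : seq (seq T)) :
  subseq s (flatten ss) -> exists2 ts : seq (seq T), s = flatten ts &
    [/\ size ts = size ss & forall k, subseq (nth [::] ts k) (nth [::] ss k)].
Proof.
elim: ss s => [|u ss IH] s /=.
  by move=> /eqP ->; exists [::] => //; split=> // k; rewrite !nth_nil.
move=> /subseqP[b]; rewrite size_cat => sb ->.
have [ts ets [sts tsP]] : exists2 ts, mask (drop (size u) b) (flatten ss) = flatten ts
    & size ts = size ss /\ forall k, subseq (nth [::] ts k) (nth [::] ss k).
  by apply: IH; exact: mask_subseq.
exists (mask (take (size u) b) u :: ts).
  rewrite /= -ets -mask_cat ?cat_take_drop//.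
  by rewrite size_takel// sb leq_addr.
split=> /=; first by rewrite sts.
by case=> [|k] /=; [exact: mask_subseq | exact: tsP].
Qed.

(** Heredity and spreading in one statement. Induction on [n]: the pieces of [s] cut [t] into at
    most as many nonempty pieces, and the first element of [t] has only moved to the right, so the
    bound on their number persists. *)
Lemma schreier_spread (T : eqType) (a b : T -> nat) n (s t : seq T) :
  schreier n [seq a x | x <- s] -> subseq t s -> t != [::] ->
  sorted ltn [seq b x | x <- t] -> (forall x, x \in t -> (a x <= b x)%N) ->
  schreier n [seq b x | x <- t].
Proof.
elim: n s t => [|n IH] s t.
  move=> [i i0]; case: s => [//|x [|//]] [ei]; case: t => [//|y [|z t]].
    rewrite sub1seq inE => /eqP -> _ _ /(_ x (mem_head _ _)) xx.
    by exists (b x) => //; rewrite (leq_trans _ xx)// ei.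
  by move=> /size_subseq.
move=> /schreierS[Fs [Fs0 eF sF szF FsP]] ts t0 st ab; apply/schreierS.
have [ss es eFs] : exists2 ss : seq (seq T), s = flatten ss & Fs = [seq map a u | u <- ss].
  exists (reshape (shape Fs) s).
    by rewrite reshapeKr// -size_flatten -eF size_map.
  by rewrite map_reshape eF flattenK.
rewrite es in ts; have [tt ett [stt ttP]] := subseq_flatten ts.
exists [seq map b u | u <- tt & u != [::]].
have ht : exists u us, [seq u <- tt | u != [::]] = u :: us.
  case E: [seq u <- tt | u != [::]] => [|u us]; last by exists u, us.
  by move: t0; rewrite ett -flatten_filter_nonempty E.
have [u [us eus]] := ht.
have fl : t = flatten [seq u <- tt | u != [::]].
  by rewrite flatten_filter_nonempty.
split.
- by rewrite eus.
- by rewrite {1}fl map_flatten.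
- exact: st.
- rewrite size_map (leq_trans (_ : _ <= size Fs)%N)//.
    by rewrite size_filter (leq_trans (count_size _ _))// stt eFs size_map.
  apply: leq_trans szF _; rewrite eus /=.
  have : u \in [seq u <- tt | u != [::]] by rewrite eus mem_head.
  rewrite mem_filter; case: u {eus} => // y u /= yutt.
  have yt : y \in t by rewrite ett; apply/flattenP; exists (y :: u); rewrite ?mem_head.
  apply: leq_trans (ab _ yt).
  have yF : a y \in map a s by rewrite map_f// es (mem_subseq ts).
  have hF : head [::] Fs <> [::].
    case: (Fs) Fs0 FsP => //= G Fs' _ /(_ G (mem_head _ _)) /schreier_neq0.
    by move=> /eqP.
  rewrite -head_flatten// -eF.
  case: (map a s) sF yF => //= k F; rewrite (path_sortedE ltn_trans) => /andP[/allP kF _].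
  by rewrite inE => /predU1P[->//|/kF/ltnW].
move=> G /mapP[v]; rewrite mem_filter => /andP[v0 vtt] ->.
have [k ktt ev] := nthP [::] vtt.
have vt z : z \in v -> z \in t by move=> zv; rewrite ett; apply/flattenP; exists v.
apply: (IH (nth [::] ss k)) => //.
- by apply: FsP; rewrite eFs map_f// mem_nth// -stt.
- by rewrite -ev.
- apply: (subseq_sorted ltn_trans) st; by apply: map_subseq; rewrite ett; exact: subseq_flatten_mem.
- by move=> z /vt; exact: ab.
Qed.

Lemma schreier_subseq n F G : schreier n F -> subseq G F -> G != [::] -> schreier n G.
Proof.
move=> SF GF G0; rewrite -[G]map_id; apply: (schreier_spread (a := id) (s := F)) => //.
  by rewrite map_id.
by rewrite map_id; apply: (subseq_sorted ltn_trans GF (schreier_sorted SF)).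
Qed.

(** The convolution of S_a with S_b lies in S_{a+b}. Induction on [b]: the splitting of the set of
    heads is copied to a splitting of the list of blocks. *)
Lemma schreier_flatten a b (Fs : seq (seq nat)) :
  (forall F, F \in Fs -> schreier a F) -> sorted ltn (flatten Fs) ->
  schreier b [seq head 0%N F | F <- Fs] -> schreier (a + b) (flatten Fs).
Proof.
elim: b Fs => [|b IH] Fs FsP sF.
  by move=> [i _]; case: Fs FsP sF => [//|F [|//]] /= FsP _ _; rewrite cats0 addn0; apply: FsP; rewrite mem_head.
move=> /schreierS[Hs [Hs0 eH sH szH HsP]]; rewrite addnS; apply/schreierS.
pose Gs := reshape (shape Hs) Fs.
have eG : Hs = [seq [seq head 0%N F | F <- G] | G : seq (seq nat) <- Gs] by rewrite map_reshape eH flattenK.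
have eF : Fs = flatten Gs.
  by rewrite reshapeKr// -size_flatten -eH size_map.
have hF (G : seq (seq nat)) : G \in Gs -> G != [::].
  move=> GG; have /HsP/schreier_neq0 : [seq head 0%N F | F <- G] \in Hs by rewrite eG map_f.
  by case: (G).
exists [seq flatten G | G : seq (seq nat) <- Gs]; split.
- by move: Hs0; rewrite eG; case: (Gs).
- by rewrite {1}eF; elim: (Gs) => //= G Gs' IHG; rewrite flatten_cat IHG.
- by [].
- move: szH; rewrite eG !size_map => /leq_trans; apply.
  move: eF hF; case: (Gs) => //= -[|F G] Gs' eF hF; first by have := hF _ (mem_head _ _).
  rewrite /=; by case: F eF hF.
move=> F /mapP[G GG ->]; apply: IH.
- by move=> F' F'G; apply: FsP; rewrite eF; apply/flattenP; exists G.
- apply: (subseq_sorted ltn_trans) sF; rewrite eF.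
  have [k kG <-] := nthP [::] GG.
  elim: (Gs) k kG => //= u us IHu [|k] ku; rewrite /= flatten_cat; first exact: prefix_subseq.
  by apply: subseq_trans (suffix_subseq _ _); exact: IHu.
by apply: HsP; rewrite eG; apply/mapP; exists G.
Qed.

End Schreier.

HB.instance Definition _ := gen_eqMixin cnode.
HB.instance Definition _ := gen_choiceMixin cnode.

(** * Packed families in pairwise form *)

Section Packed.
Variables (R : realType) (m : nat -> nat).
Local Notation wfun := (wfun R).
Local Notation F0 := ((0, [::]) : wfun).
Implicit Types (F G H : wfun) (fs : seq wfun) (lam : cnode).

Definition fast F G : bool :=
  precedes F.1 G.1 && (((2 ^ maxsupp F.1)%N)%:R%:E <= weight m G)%E.

Definition close_node lam F G : bool :=
  dist R (weight_node G) lam <= 2^-1 ^+ maxsupp F.1.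

Definition fast_block fs : Prop :=
  (forall F, F \in fs -> F.1 != 0) /\ pairwise fast fs.

(* The conditions on consecutive members in [packed] are equivalent to the
   same conditions on all pairs, which restrict to subfamilies. *)
Inductive pw_packed : seq nat -> cnode -> seq wfun -> Prop :=
| pw_packed_one k lam fs :
    fast_block fs -> schreier k [seq minsupp F.1 | F <- fs] ->
    pairwise (close_node lam) fs -> pw_packed [:: k] lam fs
| pw_packed_more ks k lam (gss : seq (seq wfun * cnode)) :
    ks != [::] -> fast_block (flatten (unzip1 gss)) ->
    (forall g, g \in gss -> g.1 != [::]) ->
    schreier k [seq minsupp (head F0 g.1).1 | g <- gss] ->
    (forall g, g \in gss -> pw_packed ks g.2 g.1) ->
    pairwise (fun g h : seq wfun * cnode =>
      all (fun F => all (close_node h.2 F) h.1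
        && (dist R h.2 lam <= 2^-1 ^+ maxsupp F.1)) g.1) gss ->
    pw_packed (rcons ks k) lam (flatten (unzip1 gss)).

Lemma leq_pow2 (a b : nat) : (a <= b)%N ->
  ((2 ^ a)%N%:R%:E <= (2 ^ b)%N%:R%:E :> \bar R)%E.
Proof. by move=> ab; rewrite lee_fin ler_nat leq_exp2l. Qed.

Lemma half_expW (a b : nat) : (a <= b)%N -> (2^-1 : R) ^+ b <= 2^-1 ^+ a.
Proof. by move=> ab; apply: ler_wiXn2l; rewrite ?invr_ge0// invf_le1// ler1n. Qed.

Lemma fast_trans : transitive fast.
Proof.
move=> G F H /andP[FG wG] /andP[GH wH]; rewrite /fast (precedes_trans FG GH)/=.
apply: le_trans wH; apply: leq_pow2.
exact: leq_trans (ltnW FG) (minsupp_maxsupp _).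
Qed.

Lemma close_le lam F F' G : (maxsupp F'.1 <= maxsupp F.1)%N ->
  close_node lam F G -> close_node lam F' G.
Proof. by move=> FF /le_trans; apply; exact: half_expW. Qed.

Lemma fast_blockP fs :
  fast_block fs <-> finite_block [seq F.1 | F <- fs] /\ very_fast_growing m fs.
Proof.
split=> [[fs0 fsP]|[[fs0 fsb] fsv]].
  have fsS : sorted fast fs by exact: pairwise_sorted.
  split; [split|].
  - by move=> _ /mapP[F /fs0 F0 ->].
  - move=> i; rewrite size_map => iS.
    rewrite !(nth_map F0)//; last exact: ltnW.
    have /andP[FG _] := sortedP F0 fsS i iS.
    by split=> //; apply: fs0; rewrite mem_nth// ltnW.
  by move=> i iS; have /andP[_] := sortedP F0 fsS i iS.
split; first by move=> F Ffs; apply: fs0; exact: map_f.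
rewrite -(sorted_pairwise fast_trans); apply/(sortedP F0) => i iS.
rewrite /fast fsv// andbT; have := fsb i; rewrite size_map => /(_ iS)[_ _].
by rewrite !(nth_map F0)//; exact: ltnW.
Qed.

Lemma fast_block_last fs F : fast_block fs -> F \in fs ->
  (maxsupp F.1 <= maxsupp (last F0 fs).1)%N.
Proof.
move=> [_]; case/lastP: fs => // fs G; rewrite last_rcons pairwise_rcons.
move=> /andP[/allP fsG _]; rewrite mem_rcons inE => /predU1P[->//|/fsG/andP[FG _]].
exact: leq_trans (ltnW FG) (minsupp_maxsupp _).
Qed.

Lemma fast_block_head fs F : fast_block fs -> F \in fs ->
  (minsupp (head F0 fs).1 <= minsupp F.1)%N.
Proof.
move=> [_]; case: fs => //= G fs /andP[/allP fsG _].
rewrite inE => /predU1P[->//|/fsG/andP[FG _]].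
exact: leq_trans (minsupp_maxsupp _) (ltnW FG).
Qed.

Lemma fast_block_subseq fs gs : subseq gs fs -> fast_block fs -> fast_block gs.
Proof.
move=> gf [fs0 fsP]; split; first by move=> F /(mem_subseq gf)/fs0.
exact: subseq_pairwise gf fsP.
Qed.

Lemma pw_packed_fast ks lam fs : pw_packed ks lam fs -> fast_block fs.
Proof. by case. Qed.

Lemma pw_packed_neq0 ks lam fs : pw_packed ks lam fs -> fs != [::].
Proof.
case=> [k l gs _ /schreier_neq0|ks' k l gss _ _ gss0 /schreier_neq0 S _ _].
  by case: gs.
case: gss S gss0 => //= g gss _ /(_ g (mem_head _ _)).
by case: g.1.
Qed.

(** Each level of packing convolves with one more Schreier family. *)
Lemma pw_packed_schreier ks lam fs :
  pw_packed ks lam fs -> schreier (sumn ks) [seq minsupp F.1 | F <- fs].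
Proof.
elim=> [k l gs _ S _|ks' k l gss _ gsf gss0 S _ IH _]; first by rewrite /= addn0.
rewrite sumn_rcons map_flatten; apply: schreier_flatten.
- by move=> _ /mapP[_ /mapP[g gg ->] ->]; exact: IH.
- rewrite -map_flatten sorted_map; apply: pairwise_sorted.
  apply: sub_pairwise gsf.2 => F G /andP[FG _] /=.
  exact: leq_ltn_trans (minsupp_maxsupp _) FG.
rewrite (_ : [seq _ | _ <- _] = [seq minsupp (head F0 g.1).1 | g <- gss])//.
rewrite -!map_comp; apply/eq_in_map => g /gss0.
by rewrite /=; case: g.1.
Qed.

(** The bound imposed by the immediate predecessor is the strongest one, because supports increase;
    it implies those for all earlier members. *)
Lemma pw_packedP ks lam fs : pw_packed ks lam fs <-> packed m ks lam fs.
Proof.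
split.
  elim=> [k l gs gsf S gsc|ks' k l gss ks0 gsf gss0 S _ IH gssc].
    have [b v] := (fast_blockP _).1 gsf.
    apply: packed_one => //; first by rewrite /schreier_admissible -map_comp.
    by move=> i iS; have := sortedP F0 (pairwise_sorted gsc) i iS.
  have [b v] := (fast_blockP _).1 gsf.
  pose d0 : seq wfun * cnode := ([::], Node [::]).
  have n1 i : nth [::] (unzip1 gss) i = (nth d0 gss i).1.
    have [iS|Si] := ltnP i (size gss); first by rewrite (nth_map d0).
    by rewrite !nth_default// size_map.
  apply: (@packed_more _ _ ks' k l _ (fun i => (nth d0 gss i).2)) => //.
  - by move=> _ /mapP[g gg ->]; exact: gss0.
  - by rewrite /schreier_admissible -!map_comp.
  - by move=> i; rewrite size_map n1 => iS; apply: IH; exact: mem_nth.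
  move=> i; rewrite size_map !n1 => iS /=.
  have := sortedP d0 (pairwise_sorted gssc) i iS.
  have : (nth d0 gss i).1 != [::] by apply/gss0/mem_nth/ltnW.
  case/lastP: (nth d0 gss i).1 => // u F _; rewrite last_rcons => /allP/(_ F).
  rewrite mem_rcons mem_head => /(_ isT)/andP[/allP h1 ->]; split=> // G /h1.
elim=> [k l gs b S v gsc|ks' k l gss lams ks0 b v gss0 S _ IH gssc].
  have gsf : fast_block gs by apply/fast_blockP.
  apply: pw_packed_one => //; first by move: S; rewrite /schreier_admissible -map_comp.
  have tr : transitive (fun F G => fast F G && close_node l F G).
    move=> G F H /andP[FG _] /andP[GH cH]; rewrite (fast_trans FG GH)/=.
    apply: close_le cH; case/andP: FG => FG _.
    exact: leq_trans (ltnW FG) (minsupp_maxsupp _).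
  have : sorted (fun F G => fast F G && close_node l F G) gs.
    apply/(sortedP F0) => i iS; apply/andP; split; last exact: gsc.
    exact: sortedP (pairwise_sorted gsf.2) i iS.
  rewrite (sorted_pairwise tr); apply: sub_pairwise => F G /andP[].
  by [].
have gsf : fast_block (flatten gss) by apply/fast_blockP.
pose hs := [seq (nth [::] gss i, lams i) | i <- iota 0 (size gss)].
have e1 : unzip1 hs = gss.
  by rewrite /hs /unzip1 -map_comp; apply: mkseq_nth.
have hsP h : h \in hs -> exists2 i, (i < size gss)%N & h = (nth [::] gss i, lams i).
  by move=> /mapP[i]; rewrite mem_iota => /andP[_ iS] ->; exists i.
have hs0 h : h \in hs -> h.1 != [::].
  by move=> /hsP[i iS ->]; apply: gss0; exact: mem_nth.
have hsf h : h \in hs -> fast_block h.1.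
  move=> hh; apply: fast_block_subseq gsf; apply: subseq_flatten_mem.
  by rewrite -e1; apply: map_f.
rewrite -[flatten gss](congr1 flatten e1); apply: pw_packed_more => //.
- by rewrite e1.
- move: S; rewrite /schreier_admissible -map_comp -{1}e1 /unzip1 -map_comp.
  by [].
- by move=> h /hsP[i iS ->]; exact: IH.
(* Including [fast] makes the relation transitive: closeness passes from the middle group to the
   first through a member of the middle group, which must therefore exist. *)
pose r (g h : seq wfun * cnode) :=
  all (fun F => all (fun G => fast F G && close_node h.2 F G) h.1
     && (dist R h.2 l <= 2^-1 ^+ maxsupp F.1)) g.1.
have rtr : {in (fun g : seq wfun * cnode => g.1 != [::]) & &, transitive r}.
  move=> h g k' h0 _ _ /allP gh /allP hk; apply/allP => F /gh/andP[/allP Fh _].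
  move: h0; rewrite unfold_in; case E: h.1 => [//|H u] _.
  have Hh : H \in h.1 by rewrite E mem_head.
  have /andP[/allP Hk Hd] := hk _ Hh; have /andP[FH _] := Fh _ Hh.
  have mFH : (maxsupp F.1 <= maxsupp H.1)%N.
    by case/andP: FH => FH _; exact: leq_trans (ltnW FH) (minsupp_maxsupp _).
  apply/andP; split; last by apply: le_trans Hd _; exact: half_expW.
  apply/allP => K /Hk/andP[HK cK]; rewrite (fast_trans FH HK)/=.
  exact: close_le cK.
have : sorted r hs.
  pose d0 : seq wfun * cnode := ([::], Node [::]).
  apply/(sortedP d0) => i; rewrite size_map size_iota => iS.
  have iS' := ltnW iS.
  rewrite !(nth_map 0%N) ?size_iota// !nth_iota// !add0n /r /=.
  have [cG cl] := gssc i iS.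
  have fi : fast_block (nth [::] gss i) by apply: (hsf (_, lams i)); apply: map_f; rewrite mem_iota.
  apply/allP => F Fi; have mF := fast_block_last fi Fi.
  apply/andP; split; last by apply: le_trans cl _; exact: half_expW.
  apply/allP => G Gi; apply/andP; split; last first.
    by rewrite /close_node (le_trans (cG _ Gi))//; exact: half_expW.
  have : pairwise fast (flatten gss) by case: gsf.
  rewrite -(cat_take_drop i.+1 gss) flatten_cat pairwise_cat => /andP[/allrelP + _].
  apply; apply/flattenP.
    by exists (nth [::] gss i) => //; rewrite -(nth_take _ (ltnSn i)) mem_nth// size_takel.
  exists (nth [::] gss i.+1) => //.
  by rewrite -{1}[i.+1]addn0 -nth_drop mem_nth// size_drop subn_gt0.
rewrite (sorted_pairwise_in rtr); last exact/allP.
apply: sub_pairwise => g h /allP gh; apply/allP => F /gh/andP[/allP Fh ->].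
by rewrite andbT; apply/allP => G /Fh/andP[].
Qed.

Definition wrestr (P : pred nat) F : wfun := (restr P F.1, F.2).

Definition frestr P fs : seq wfun := [seq wrestr P F | F <- fs & restr P F.1 != 0].

Lemma fast_wrestr P F G : restr P G.1 != 0 -> fast F G -> fast (wrestr P F) (wrestr P G).
Proof.
move=> G0 /andP[FG wG]; rewrite /fast /= (_ : precedes _ _); last first.
  apply: leq_trans (minsupp_restr G0); apply: leq_ltn_trans FG.
  exact: maxsupp_restr.
by apply: le_trans wG; apply/leq_pow2/maxsupp_restr.
Qed.

Lemma mem_frestr P fs F : F \in frestr P fs ->
  exists2 G, G \in fs & F = wrestr P G /\ restr P G.1 != 0.
Proof. by move=> /mapP[G]; rewrite mem_filter => /andP[G0 Gfs] ->; exists G. Qed.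

Lemma frestr_fast P fs : fast_block fs -> fast_block (frestr P fs).
Proof.
move=> [fs0 fsP]; split; first by move=> F /mem_frestr[G _ [->]].
rewrite pairwise_map.
apply: (@sub_in_pairwise _ (fun F => restr P F.1 != 0) fast).
- by move=> F G _ G0; exact: fast_wrestr.
- exact: filter_all.
- exact: subseq_pairwise (filter_subseq _ _) fsP.
Qed.

Lemma frestr_flatten P (fss : seq (seq wfun)) :
  frestr P (flatten fss) = flatten [seq frestr P fs | fs <- fss].
Proof. by elim: fss => //= fs fss IH; rewrite /frestr filter_cat map_cat -IH. Qed.

Lemma sorted_minsupp fs : fast_block fs -> sorted ltn [seq minsupp F.1 | F <- fs].
Proof.
move=> [_ fsP]; rewrite sorted_map; apply: pairwise_sorted.
apply: sub_pairwise fsP => F G /andP[FG _] /=.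
exact: leq_ltn_trans (minsupp_maxsupp _) FG.
Qed.

Lemma sorted_heads (hs : seq (seq wfun * cnode)) :
  (forall h, h \in hs -> h.1 != [::]) -> fast_block (flatten (unzip1 hs)) ->
  sorted ltn [seq minsupp (head F0 h.1).1 | h <- hs].
Proof.
move=> hs0 [_ hf]; rewrite sorted_map; apply: pairwise_sorted.
elim: hs hs0 hf => //= h hs IHh hs0; rewrite pairwise_cat => /and3P[/allrelP hhs _ fs].
have hs0' g : g \in hs -> g.1 != [::] by move=> gh; apply: hs0; rewrite inE gh orbT.
rewrite IHh// andbT; apply/allP => g gh /=.
have := hs0 h (mem_head _ _); have := hs0' g gh.
case Eg: g.1 => [//|G u] _; case Eh: h.1 => [//|H v] _ /=.
have /andP[+ _] : fast H G.
  apply: hhs; first by rewrite Eh mem_head.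
  by apply/flattenP; exists g.1; [exact: map_f | rewrite Eg mem_head].
exact: leq_ltn_trans (minsupp_maxsupp _).
Qed.

(** Restriction lowers the ends of supports, which weakens the growth and closeness conditions, and
    moves their beginnings to the right, which Schreier families tolerate. Members and groups that
    become zero are removed. *)
Lemma pw_packed_restr P ks lam fs : pw_packed ks lam fs ->
  frestr P fs != [::] -> pw_packed ks lam (frestr P fs).
Proof.
elim=> [k l gs gsf S gsc|ks' k l gss ks0 gsf gss0 S _ IH gssc] r0.
  apply: pw_packed_one; first exact: frestr_fast.
    have := sorted_minsupp (frestr_fast P gsf); rewrite /frestr -!map_comp => st.
    apply: (schreier_spread S (filter_subseq _ _)) => //.
      by apply: contra_neq r0; rewrite /frestr => ->.
    by move=> F; rewrite mem_filter => /andP[F0 _]; exact: minsupp_restr.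
  rewrite pairwise_map; apply: sub_pairwise (subseq_pairwise (filter_subseq _ _) gsc).
  by move=> F G; apply: close_le; exact: maxsupp_restr.
pose hss := [seq (frestr P g.1, g.2) | g <- gss & frestr P g.1 != [::]].
have e : frestr P (flatten (unzip1 gss)) = flatten (unzip1 hss).
  rewrite frestr_flatten /hss; elim: (gss) => //= g gs -> /=.
  by case: eqVneq => [->|].
have hf : fast_block (frestr P (flatten (unzip1 gss))) by exact: frestr_fast.
rewrite e in hf r0 *.
have gf g : g \in gss -> fast_block g.1.
  by move=> gg; apply: fast_block_subseq gsf; apply/subseq_flatten_mem/map_f.
have hss0 g : g \in hss -> g.1 != [::].
  by move=> /mapP[g']; rewrite mem_filter => /andP[? _] ->.
apply: pw_packed_more => //.
- rewrite -map_comp; apply: (schreier_spread S (filter_subseq _ _)).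
  + by apply: contra_neq r0; rewrite /hss => ->.
  + by have := sorted_heads hss0 hf; rewrite /hss -map_comp.
  move=> g; rewrite mem_filter => /andP[]; case E: (frestr P g.1) => [//|F u] _ gg /=.
  have /mem_frestr[G Gg [-> G0]] : F \in frestr P g.1 by rewrite E mem_head.
  exact: leq_trans (fast_block_head (gf _ gg) Gg) (minsupp_restr G0).
- by move=> g /mapP[g']; rewrite mem_filter => /andP[h0 gg] ->; exact: (IH g' gg h0).
rewrite pairwise_map; apply: sub_pairwise (subseq_pairwise (filter_subseq _ _) gssc).
move=> g h /allP gh; apply/allP => _ /mem_frestr[F /gh/andP[/allP Fh d] [-> _]].
have mF := maxsupp_restr P F.1.
apply/andP; split; last by apply: le_trans d _; exact: half_expW.
apply/allP => _ /mem_frestr[G /Fh cG [-> _]].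
by apply: close_le cG.
Qed.

(** One centre per level is enough: a later [G] outside the group of [F] is close to the centre of
    its own group, which is close to the common centre of the level, and the metric is an
    ultrametric. *)
Lemma pw_packed_cluster ks lam fs F : pw_packed ks lam fs -> F \in fs ->
  exists cs : seq cnode, (size cs <= size ks)%N /\
    forall G, G \in fs -> precedes F.1 G.1 -> exists2 c, c \in cs & close_node c F G.
Proof.
(* Positions in a [fast] list follow the order of the supports. *)
have nprec fs' A B : pairwise fast fs' -> A \in fs' -> B \in fs' -> precedes A.1 B.1 ->
    (index A fs' < index B fs')%N.
  move=> fsP Af Bf AB; rewrite ltnNge; apply/negP; rewrite leq_eqVlt => /orP[/eqP e|lt].
    have eAB : B = A by rewrite -[B](nth_index F0 Bf) e nth_index.
    by move: AB; rewrite eAB /precedes ltnNge minsupp_maxsupp.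
  have /andP[BA _] : fast B A.
    have := pairwiseP F0 fsP _ _ _ _ lt; rewrite !nth_index//; apply; rewrite inE index_mem//.
  have := precedes_trans AB BA; rewrite /precedes ltnNge minsupp_maxsupp//.
elim=> [k l gs gsf S gsc|ks' k l gss ks0 gsf gss0 S _ IH gssc] Ff.
  exists [:: l]; split=> // G Gf FG; exists l; rewrite ?mem_head//.
  have lt := nprec _ _ _ gsf.2 Ff Gf FG.
  have := pairwiseP F0 gsc _ _ _ _ lt; rewrite !nth_index//; apply; rewrite inE index_mem//.
have /flattenP[_ /mapP[g gg ->] Fg] := Ff.
have [cs [szcs csP]] := IH _ gg Fg.
(* [l] serves the members outside the group of [F], and [cs] those inside it. *)
exists (l :: cs); rewrite size_rcons; split=> // G /flattenP[_ /mapP[h hh ->] Gh] FG.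
have [gh|gh] := eqVneq g h.
  by rewrite -gh in Gh; have [c cc Gc] := csP _ Gh FG; exists c => //; rewrite inE cc orbT.
exists l; first exact: mem_head.
have [lt|] := ltnP (index g gss) (index h gss).
  have := pairwiseP ([::], l) gssc _ _ _ _ lt; rewrite !nth_index// !inE !index_mem.
  move=> /(_ gg hh)/allP/(_ _ Fg)/andP[/allP/(_ _ Gh) cG d].
  rewrite /close_node; apply: le_trans (dist_ultra _ _ h.2 _) _.
  by rewrite ge_max d andbT.
rewrite leq_eqVlt => /orP[/eqP e|lt].
  by move: gh; rewrite -[g](nth_index ([::], l) gg) -e nth_index// eqxx.
have : pairwise fast (flatten (unzip1 gss)) by case: gsf.
have {}lt : (index h gss < index g gss)%N by [].
have eh : h = nth ([::], l) gss (index h gss) by rewrite nth_index.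
have eg : g = nth ([::], l) gss (index g gss) by rewrite nth_index.
rewrite -(cat_take_drop (index g gss) gss) /unzip1 map_cat flatten_cat pairwise_cat.
move=> /andP[/allrelP + _] => /(_ G F).
have -> : G \in flatten [seq i.1 | i <- take (index g gss) gss].
  apply/flattenP; exists h.1 => //; apply: map_f.
  by rewrite eh -(nth_take _ lt) mem_nth// size_takel// index_size.
have -> : F \in flatten [seq i.1 | i <- drop (index g gss) gss].
  apply/flattenP; exists g.1 => //; apply: map_f.
  suff : nth ([::], l) gss (index g gss) \in drop (index g gss) gss by rewrite -eg.
  by rewrite -{1}[index g gss]addn0 -nth_drop mem_nth// size_drop subn_gt0 index_mem.
move=> /(_ isT isT)/andP[GF _].
by have := precedes_trans FG GF; rewrite /precedes ltnNge minsupp_maxsupp.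
Qed.

(** Isolates the first group of the top level, the only one on which packing puts no condition
    relative to [lam]. With a single level this group is one functional. *)
Lemma pw_packed_split ks k lam fs : pw_packed (rcons ks k) lam fs ->
  exists fs1 fs2, [/\ fs = fs1 ++ fs2, fs1 != [::],
    if ks is [::] then size fs1 = 1%N else exists lam1, pw_packed ks lam1 fs1
  & forall F G, F \in fs1 -> G \in fs2 -> fast F G && close_node lam F G].
Proof.
move Eks: (rcons ks k) => ks1 p; case: p Eks => [k1 l gs gsf S gsc|ks' k1 l gss ks0 gsf gss0 S gssp gssc].
  rewrite -[[:: k1]]/(rcons [::] k1) => /rcons_inj[-> _].
  case: gs gsf S gsc => [_ /schreier_neq0//|F gs [_ gsf] _ /= /andP[/allP gsc _]].
  exists [:: F], gs; split=> // A G; rewrite inE => /eqP -> Gg; rewrite gsc// andbT.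
  by move: gsf => /= /andP[/allP->].
move=> /rcons_inj[-> _].
case: gss S gss0 gsf gssp gssc => [/schreier_neq0//|g gss] _ gss0 [_ gsf] gssp /= /andP[/allP gc _].
exists g.1, (flatten (unzip1 gss)); split=> //.
- by apply: gss0; rewrite mem_head.
- by case: (ks') ks0 gssp => // ? ? _ gssp; exists g.2; apply: gssp; rewrite mem_head.
move=> F G Fg Gg; move: gsf; rewrite /= pairwise_cat => /andP[/allrelP -> //= _].
move: Gg => /flattenP[_ /mapP[h hh ->] Gh].
have /allP/(_ _ Fg)/andP[/allP/(_ _ Gh) cG d] := gc _ hh.
rewrite /close_node; apply: le_trans (dist_ultra _ _ h.2 _) _.
by rewrite ge_max d andbT.
Qed.

End Packed.

(** * The norming set: induction principles and stability under restriction *)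

Section NormingFunctionals.
Variables (R : realType) (m n : nat -> nat).
Local Notation wfun := (wfun R).
Implicit Types (F G : wfun) (fs : seq wfun) (js : seq nat).

Definition inW F : Prop := exists k, W_ m n k F.

Lemma W_mono k l F : (k <= l)%N -> W_ m n k F -> W_ m n l F.
Proof.
move=> kl WF; rewrite -(subnK kl); elim: (l - k)%N => // d; rewrite addSn /=.
by case: (d + k)%N => [|e] WF'; left.
Qed.

Lemma inW_common fs : (forall F, F \in fs -> inW F) ->
  exists k, forall F, F \in fs -> W_ m n k F.
Proof.
elim: fs => [|F fs IH] fsW; first by exists 0%N.
have [k kP] := IH (fun G Gf => fsW G (mem_behead (s := F :: fs) Gf)).
have [l lP] := fsW F (mem_head _ _).
exists (maxn k l) => G; rewrite inE => /predU1P[->|/kP].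
  by apply: W_mono lP; exact: leq_maxr.
by apply: W_mono; exact: leq_maxl.
Qed.

Lemma inW_step js fs lam : index_vector js -> (forall F, F \in fs -> inW F) ->
  pw_packed m [seq n j | j <- js] lam fs ->
  inW (weighted_sum m js [seq F.1 | F <- fs], js).
Proof.
move=> jsP /inW_common[k kP] /pw_packedP fsp; exists k.+2; right.
by exists js, fs, lam; split=> // F /kP; apply: W_mono.
Qed.

Lemma inW_W1 js is_ : index_vector js -> schreier (\sum_(j <- js) n j) is_ ->
  inW (weighted_sum m js [seq unit_vec R i | i <- is_], js).
Proof. by move=> jsP S; exists 1%N; right; exists js, is_. Qed.

Lemma inW_unit i : (0 < i)%N -> inW (unit_vec R i, [::]).
Proof. by move=> i0; exists 0%N, i => //; left. Qed.

Lemma inW_unitN i : (0 < i)%N -> inW (- unit_vec R i, [::]).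
Proof. by move=> i0; exists 0%N, i => //; right. Qed.

Lemma inW_ind3 (P : wfun -> Prop) :
  (forall i, (0 < i)%N -> P (unit_vec R i, [::])) ->
  (forall i, (0 < i)%N -> P (- unit_vec R i, [::])) ->
  (forall js is_, index_vector js -> schreier (\sum_(j <- js) n j) is_ ->
    P (weighted_sum m js [seq unit_vec R i | i <- is_], js)) ->
  (forall js fs lam, index_vector js -> (forall F, F \in fs -> inW F /\ P F) ->
    pw_packed m [seq n j | j <- js] lam fs ->
    P (weighted_sum m js [seq F.1 | F <- fs], js)) ->
  forall F, inW F -> P F.
Proof.
move=> P0 PN P1 PS F [k]; elim: k F => [|k IH] F.
  by case=> i i0 [->|->]; [exact: P0 | exact: PN].
case: k IH => [|k] IH [|]; first exact: IH.
- by move=> [js [is_ [jsP S ->]]]; exact: P1.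
- exact: IH.
move=> [js [fs [lam [jsP fsW /pw_packedP fsp ->]]]]; apply: PS fsp => // G Gf.
by split; [exists k.+1; exact: fsW | apply/IH/fsW].
Qed.

Lemma weighted_sum_restr (P : pred nat) js fs :
  restr P (weighted_sum m js [seq F.1 | F <- fs]) =
  weighted_sum m js [seq F.1 | F <- frestr P fs].
Proof.
rewrite /weighted_sum restrZ restr_sum !big_map big_filter; congr (_ *: _).
rewrite [RHS]big_mkcond; apply: eq_bigr => F _ /=.
by case: eqP.
Qed.

(** The set of coordinates is arbitrary, not just an interval; hence the coordinate projections onto
    all sets are contractions in [norm_restr]. *)
Lemma inW_restr (P : pred nat) F : inW F -> restr P F.1 != 0 -> inW (wrestr P F).
Proof.
move=> FW; move: F FW; apply: inW_ind3 => /= [i i0|i i0|js is_ jsP S|js fs lam jsP fsP fsp].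
- rewrite /wrestr /= restr_unit_vec//; case: ifP => _; last by rewrite eqxx.
  by move=> _; exact: inW_unit.
- rewrite /wrestr /= restrN restr_unit_vec//; case: ifP => _; last by rewrite oppr0 eqxx.
  by move=> _; exact: inW_unitN.
- have e : restr P (weighted_sum m js [seq unit_vec R i | i <- is_]) =
      weighted_sum m js [seq unit_vec R i | i <- is_ & P i].
    rewrite /weighted_sum restrZ restr_sum !big_map big_filter; congr (_ *: _).
    rewrite [RHS]big_mkcond big_seq [RHS]big_seq; apply: eq_bigr => i ii.
    by rewrite restr_unit_vec// (schreier_gt0 S).
  rewrite /wrestr /= e => r0; apply: inW_W1 => //.
  apply: (schreier_subseq S); first exact: filter_subseq.
  by apply: contra_neq r0 => ->; rewrite /weighted_sum /= big_nil scaler0.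
rewrite /wrestr /= weighted_sum_restr => r0.
apply: (@inW_step _ _ lam) => //.
  by move=> _ /mem_frestr[F Ff [-> F0]]; apply: (fsP F Ff).2.
apply: pw_packed_restr => //.
by apply: contra_neq r0 => ->; rewrite /weighted_sum /= big_nil scaler0.
Qed.

(** The part of packing that upper estimates use: growth, total admissibility, and at most [size js]
    points around which the nodes of the members after a given one gather. *)
Definition decomposition js fs : Prop :=
  [/\ index_vector js, fast_block m fs,
      schreier (\sum_(j <- js) n j) [seq minsupp F.1 | F <- fs]
    & forall F, F \in fs -> exists cs : seq cnode, (size cs <= size js)%N /\
        forall G, G \in fs -> precedes F.1 G.1 ->
          exists2 c, c \in cs & close_node c F G].

Lemma packed_decomposition js fs lam : index_vector js ->
  pw_packed m [seq n j | j <- js] lam fs -> decomposition js fs.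
Proof.
move=> jsP fsp; split=> //; first exact: pw_packed_fast fsp.
  by have := pw_packed_schreier fsp; rewrite sumnE big_map.
by move=> F /(pw_packed_cluster fsp); rewrite size_map.
Qed.

(** Functionals of W_1 join the packed case, with unit vectors as members: these have infinite
    weight, so growth is automatic. *)
Lemma inW_ind (P : wfun -> Prop) :
  (forall i, (0 < i)%N -> P (unit_vec R i, [::])) ->
  (forall i, (0 < i)%N -> P (- unit_vec R i, [::])) ->
  (forall js fs, decomposition js fs -> (forall F, F \in fs -> inW F /\ P F) ->
    P (weighted_sum m js [seq F.1 | F <- fs], js)) ->
  forall F, inW F -> P F.
Proof.
move=> P0 PN PS; apply: inW_ind3 => // [js is_ jsP S|js fs lam jsP fsP /packed_decomposition fsd]; last first.
  exact: PS (fsd jsP) fsP.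
have i0 := schreier_gt0 S.
pose fs : seq wfun := [seq (unit_vec R i, [::]) | i <- is_].
have -> : [seq unit_vec R i | i <- is_] = [seq F.1 | F <- fs] by rewrite -map_comp.
apply: PS => [|F /mapP[i /i0 ii ->]]; last by split; [exact: inW_unit | exact: P0].
split=> //.
- split; first by move=> F /mapP[i /i0 ii ->]; exact: unit_vec_neq0.
  rewrite pairwise_map; have := schreier_sorted S; rewrite (sorted_pairwise ltn_trans).
  apply: (@sub_in_pairwise _ (fun i => 0 < i)%N); last exact/allP.
  move=> i j; rewrite /in_mem /= => ii jj ij.
  by rewrite /fast /precedes /= maxsupp_unit_vec// minsupp_unit_vec// ij leey.
- rewrite -map_comp (_ : map _ _ = is_)//.
  rewrite -[RHS]map_id; apply/eq_in_map => i /i0 ii /=; exact: minsupp_unit_vec.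
move=> F /mapP[i /i0 ii ->].
(* All members sit at the root, so one centre suffices; it is within the bound because [js] is
   nonempty. *)
exists [:: Node (enum_node 0)]; split; first by case: jsP; case: (js).
move=> G /mapP[k _ ->] _; exists (Node (enum_node 0)); first exact: mem_head.
by rewrite /close_node /weight_node /= big_nil /dist asboolT.
Qed.

End NormingFunctionals.

(** * The norm and its elementary bounds *)

Section Norm.
Variables (R : realType) (m n : nat -> nat).
Variables (X : completeNormedModType R) (iota : {linear c00 R -> X}).
Hypothesis hX : is_XD m n iota.
Local Notation wfun := (wfun R).
Local Notation inW := (@inW R m n).
Local Notation N x := (`|iota x|).
Implicit Types (x y : c00 R) (F : wfun) (c r : R).

Lemma pairing_le F x : inW F -> pairing F.1 x <= N x.
Proof.
move=> [k Fk]; rewrite -lee_fin (hX.1 x); apply: ereal_sup_ubound.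
by exists F.1 => //; exists k, F.2; rewrite -surjective_pairing.
Qed.

Lemma normr_pairing_le F x : inW F -> `|pairing F.1 x| <= N x.
Proof.
move=> FW; rewrite ler_norml (pairing_le x FW) andbT lerNl -pairingNr.
by rewrite (le_trans (pairing_le _ FW))// linearN normrN.
Qed.

Lemma lt_norm_pairing x r : r < N x -> exists2 F, inW F & r < pairing F.1 x.
Proof.
rewrite -lte_fin (hX.1 x) => /ereal_sup_gt[_ [f [k [js Wf]] <-]].
by rewrite lte_fin => rf; exists (f, js) => //; exists k.
Qed.

Lemma norm_le x r : (forall F, inW F -> pairing F.1 x <= r) -> N x <= r.
Proof.
move=> xr; rewrite leNgt; apply/negP => /lt_norm_pairing[F FW].
by rewrite ltNge xr.
Qed.

Lemma norm_coef x i : `|x i| <= N x.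
Proof.
have [->|i0] := posnP i; first by rewrite c00_index0 normr0.
have h := normr_pairing_le x (inW_unit R m n i0).
by rewrite pairing_unit_vec in h.
Qed.

Lemma norm_gt0 x : x != 0 -> 0 < N x.
Proof.
by move=> /minsupp_neq0 xi; apply: lt_le_trans (norm_coef x (minsupp x)); rewrite normr_gt0.
Qed.

Lemma norm_restr (P : pred nat) x : N (restr P x) <= N x.
Proof.
apply: norm_le => F FW; rewrite -pairing_restr.
have [->|F0] := eqVneq (restr P F.1) 0; first by rewrite pairing0l.
exact: (pairing_le x (inW_restr FW F0)).
Qed.

Lemma weighted_sum_coef js (fs : seq wfun) F i : fast_block m fs -> F \in fs ->
  F.1 i != 0 -> weighted_sum m js [seq G.1 | G <- fs] i =
    (\prod_(j <- js) m j)%N%:R^-1 * F.1 i.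
Proof.
move=> [_ fsP] Ff Fi; rewrite c00_Z c00_sum big_map; congr (_ * _).
elim: fs fsP Ff => //= G fs IH.
move=> /andP[/allP Gfs fsP]; rewrite inE big_cons => /predU1P[FG|Ff].
  rewrite big_seq big1 ?addr0 ?FG// => H /Gfs/andP[+ _].
  by rewrite -FG => /precedes_eq0; apply.
rewrite IH// (_ : G.1 i = 0) ?add0r//.
by have /andP[GF _] := Gfs _ Ff; exact: precedes_eq0r GF Fi.
Qed.

(** At most one member of the sum is nonzero at [i]. For infinite weight the empty product gives the
    bound 1. *)
Lemma inW_coef F i : inW F -> `|F.1 i| <= (\prod_(j <- F.2) m j)%N%:R^-1.
Proof.
(* The second inequality is carried along so that members have coefficients at most 1 in the
   induction. *)
have aux : forall F, inW F -> `|F.1 i| <= (\prod_(j <- F.2) m j)%N%:R^-1 /\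
    (\prod_(j <- F.2) m j)%N%:R^-1 <= 1 :> R.
  apply: inW_ind => [k k0|k k0|js fs [jsP fsf _ _] fsP].
  - by rewrite /= big_nil invr1; case: (_ && _); rewrite ?normr1 ?normr0.
  - by rewrite /= big_nil invr1 normrN; case: (_ && _); rewrite ?normr1 ?normr0.
  have w1 : (\prod_(j <- js) m j)%N%:R^-1 <= 1 :> R.
    have [->|w0] := posnP (\prod_(j <- js) m j)%N; first by rewrite invr0.
    by rewrite invf_le1// ?ltr0n// ler1n.
  split=> //; have [[G Ff Fi]|no] := pselect (exists2 F, F \in fs & F.1 i != 0).
    change (`|weighted_sum m js [seq G.1 | G <- fs] i| <= (\prod_(j <- js) m j)%N%:R^-1).
    rewrite (weighted_sum_coef _ fsf Ff Fi) normrM ger0_norm ?invr_ge0//.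
    rewrite ler_piMr ?invr_ge0//; have [_ [h1 h2]] := fsP G Ff.
    exact: le_trans h1 h2.
  rewrite /weighted_sum c00_Z c00_sum big_map [X in _ * X]big_seq [X in _ * X]big1.
    by rewrite mulr0 normr0 invr_ge0.
  by move=> G Gf; apply/eqP/negPn/negP => Gi; apply: no; exists G.
by move=> /aux[].
Qed.

(** Each of the at most [(maxsupp x).+1] coordinates contributes at most N x / w. Crude, but
    decisive when the weight is huge compared with the support of [x]. *)
Lemma pairing_le_weight F x : inW F ->
  `|pairing F.1 x| <= (maxsupp x).+1%:R * N x / (\prod_(j <- F.2) m j)%N%:R.
Proof.
move=> FW; rewrite (pairingEr _ (ltnSn _)); apply: le_trans (ler_norm_sum _ _ _) _.
rewrite -mulrA mulr_natl -[X in _ *+ X]card_ord -sumr_const; apply: ler_sum => i _.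
by rewrite normrM mulrC; apply: ler_pM => //; [exact: norm_coef | exact: inW_coef].
Qed.

End Norm.

(** * Growth of the parameters and of the weights *)

Section WeightBounds.
Variables (R : realType) (m n : nat -> nat).
Hypothesis hmn : parameters R m n.
Implicit Types (i j : nat) (js : seq nat).

Lemma m_le i j : (0 < i)%N -> (i <= j)%N -> (m i <= m j)%N.
Proof.
have [_ _ h _ _] := hmn; move=> i0 /subnK <-; elim: (j - i)%N => // d IH.
by rewrite addSn; apply: leq_trans IH (ltnW (h _ _).1); rewrite ltn_addl.
Qed.

Lemma n_le i j : (0 < i)%N -> (i <= j)%N -> (n i <= n j)%N.
Proof.
have [_ _ h _ _] := hmn; move=> i0 /subnK <-; elim: (j - i)%N => // d IH.
by rewrite addSn; apply: leq_trans IH (ltnW (h _ _).2); rewrite ltn_addl.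
Qed.

Lemma m_ge100 j : (0 < j)%N -> (100 <= m j)%N.
Proof. by move=> j0; have [<- _ _ _ _] := hmn; exact: m_le. Qed.

Lemma n_gt0 j : (0 < j)%N -> (0 < n j)%N.
Proof. by move=> j0; have [_ h _ _ _] := hmn; have := n_le (ltnSn 0) j0; rewrite h. Qed.

Lemma m_gt0 j : (0 < j)%N -> (0 < m j)%N.
Proof. by move=> /m_ge100; apply: leq_trans. Qed.

Lemma m_ge_id j : (0 < j)%N -> (j <= m j)%N.
Proof.
have [_ _ h _ _] := hmn; elim: j => // -[|j] IH _; first exact: m_gt0.
exact: leq_ltn_trans (IH isT) (h j.+1 isT).1.
Qed.

Lemma weight_gt0 js : index_vector js -> (0 < \prod_(j <- js) m j)%N.
Proof.
by move=> [_ jsP]; rewrite big_seq prodn_cond_gt0// => j /jsP; exact: m_gt0.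
Qed.

Lemma weight_ge_exp js : index_vector js -> (100 ^ size js <= \prod_(j <- js) m j)%N.
Proof.
move=> [_]; elim: js => [|j js IH] jsP; first by rewrite big_nil.
rewrite big_cons expnS leq_mul ?IH ?m_ge100 ?jsP ?mem_head// => k kjs.
by apply: jsP; rewrite inE kjs orbT.
Qed.

Lemma weight_ge_m js j : index_vector js -> j \in js -> (m j <= \prod_(j <- js) m j)%N.
Proof.
move=> [_ jsP] jjs; rewrite (big_rem j)//= leq_pmulr// big_seq prodn_cond_gt0// => k.
by move=> /mem_rem/jsP; exact: m_gt0.
Qed.

Lemma weight_ge100 js : index_vector js -> (100 <= \prod_(j <- js) m j)%N.
Proof.
move=> jsP; apply: leq_trans (weight_ge_exp jsP); rewrite -{1}(expn1 100) leq_exp2l//.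
by case: jsP; case: (js).
Qed.

End WeightBounds.

(** * Limits along a free ultrafilter *)

Section Ultrafilters.
Variable U : set_system nat.
Hypotheses (ultraU : UltraFilter U) (freeU : forall k, U [set i | (k <= i)%N]).

Lemma ultra_or (A B : set nat) : U (A `|` B) -> U A \/ U B.
Proof.
move=> AB; have [?|nA] := in_ultra_setVsetC A ultraU; first by left.
right; apply: (@filterS2 _ U _ _ _ _ _ AB nA).
by move=> i [Ai /(_ Ai)//|].
Qed.

Lemma ultra_pigeonhole (T : eqType) (f : nat -> T) (s : seq T) :
  U [set i | f i \in s] -> exists2 a, a \in s & U [set i | f i = a].
Proof.
elim: s => [|a s IH] Us.
  have [i] := @filter_ex _ U _ _ Us; by [].
have [|Ua|/IH[b bs Ub]] := @ultra_or [set i | f i = a] [set i | f i \in s].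
- by apply: filterS Us => i /=; rewrite inE => /predU1P[]; [left|right].
- by exists a => //; exact: mem_head.
by exists b => //; rewrite inE bs orbT.
Qed.

Lemma ultra_unbounded (A : set nat) k : U A -> exists2 i, (k <= i)%N & A i.
Proof. by move=> UA; have [i []] := @filter_ex _ U _ _ (filterI (freeU k) UA); exists i. Qed.

(** Compactness of the completed tree: at every height the ultrafilter selects one child, and the
    selected initial segments form a branch. *)
Lemma ultra_cluster (R : realType) (u : nat -> cnode) :
  exists lam, forall k, U [set i | dist R (u i) lam <= 2^-1 ^+ k].
Proof.
(* If [u] is not almost constantly a node, almost every term extends the segment reached so far
   properly, so a child can be selected. *)
have [[s Us]|nos] := pselect (exists s, U [set i | u i = Node s]).
  exists (Node s) => k; apply: filterS Us => i /= ->.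
  by rewrite /dist asboolT// exprn_ge0.
have ex k : exists s, size s = k /\ U [set i | initial s (u i)].
  elim: k => [|k [s [sk Us]]].
    by exists [::]; split=> //; apply: filterS (@filterT _ U _) => i _ /=; case: (u i) => [[]|].
  have [|?|] := @ultra_or [set i | u i = Node s]
    [set i | initial (rcons s true) (u i) \/ initial (rcons s false) (u i)].
  - apply: filterS Us => i /=; case: (u i) => [t|b] /=.
      move=> /prefixP[[|a t'] ->]; first by left; rewrite cats0.
      right; rewrite -cat_rcons; case: a; [left|right]; exact: prefix_prefix.
    move=> /eqP sb; right; rewrite !size_rcons !mkseqS -sb.
    by case: (b (size s)); rewrite eqxx; [left|right].
  - by case: nos; exists s.
  - case/ultra_or => Us'; [exists (rcons s true) | exists (rcons s false)];
      by rewrite size_rcons sk.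
have [S SP] := choice ex.
have Stake k l : (k <= l)%N -> take k (S l) = S k.
  move=> kl; have [sk Uk] := SP k; have [sl Ul] := SP l.
  have [i [ik il]] := @filter_ex _ U _ _ (filterI Uk Ul).
  apply: (@initial_uniq _ _ (u i)) => //; first by rewrite size_takel ?sk ?sl.
  by apply: initial_take; rewrite ?sl.
pose b i := nth false (S i.+1) i.
have Sb k : S k = mkseq b k.
  apply: (@eq_from_nth _ false); rewrite ?size_mkseq (SP k).1// => i ik.
  by rewrite nth_mkseq// /b -(Stake _ _ ik) nth_take.
exists (Branch b) => k; have [sk Uk] := SP k.
apply: filterS Uk => i /= ik; rewrite -sk; apply: dist_le => //.
by rewrite /= sk Sb.
Qed.

End Ultrafilters.

Lemma exists_free_ultrafilter :
  exists U : set_system nat, UltraFilter U /\ forall k, U [set i | (k <= i)%N].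
Proof.
have [U [ultraU oU]] := @ultraFilterLemma nat \oo _.
by exists U; split=> // k; apply: oU; exact: nbhs_infty_ge.
Qed.

Lemma exists_subsequence (P : nat -> nat -> Prop) :
  (forall a, exists2 i, (a < i)%N & P a i) ->
  exists s : nat -> nat, forall k, (s k < s k.+1)%N /\ P (s k) (s k.+1).
Proof.
move=> H; have [|g gP] := @choice _ _ (fun a i => (a < i)%N /\ P a i).
  by move=> a; have [i] := H a; exists i.
(* Each term is tested against its predecessor and the initial term 0 is not tested at all; this is
   why [s \o succn] appears later. *)
by exists (fun k => iter k g 0%N) => k; rewrite iterS; exact: gP.
Qed.

Lemma lt_subsequence (s : nat -> nat) : (forall k, (s k < s k.+1)%N) ->
  forall k l, (k < l)%N -> (s k < s l)%N.
Proof. by move=> sS k l; apply: (homo_ltn ltn_trans). Qed.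

(** * Lower estimates for block sequences on Schreier sets *)

Section LowerFunctionals.
Variables (R : realType) (m n : nat -> nat).
Hypothesis hmn : parameters R m n.
Variables (X : completeNormedModType R) (iota : {linear c00 R -> X}).
Hypothesis hX : is_XD m n iota.
Local Notation wfun := (wfun R).
Local Notation inW := (@inW R m n).
Local Notation N x := (`|iota x|).
Local Notation F0 := ((0, [::]) : wfun).
Implicit Types (F G : wfun).

Lemma inW_cases F : inW F ->
  [\/ F.2 = [::],
      exists is_, [/\ index_vector F.2, schreier (\sum_(j <- F.2) n j) is_ &
        F.1 = weighted_sum m F.2 [seq unit_vec R i | i <- is_]]
    | exists fs lam, [/\ index_vector F.2, forall G, G \in fs -> inW G,
        pw_packed m [seq n j | j <- F.2] lam fs &
        F.1 = weighted_sum m F.2 [seq G.1 | G <- fs]]].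
Proof.
move: F; apply: inW_ind3 => [i _|i _|js is_ jsP S|js fs lam jsP fsP fsp].
- by constructor 1.
- by constructor 1.
- by constructor 2; exists is_.
by constructor 3; exists fs, lam; split=> // G /fsP[].
Qed.

Definition within_range (x f : c00 R) : Prop :=
  forall i, f i != 0 -> (minsupp x <= i <= maxsupp x)%N.

Lemma within_range_supp x f : f != 0 -> within_range x f ->
  (minsupp x <= minsupp f)%N /\ (maxsupp f <= maxsupp x)%N.
Proof.
move=> f0 xf; have /andP[-> _] := xf _ (minsupp_neq0 f0).
by have /andP[_ ->] := xf _ (maxsupp_neq0 f0).
Qed.

Lemma block_seq_precedes (x : nat -> c00 R) k l : block_seq x -> (k < l)%N ->
  precedes (x k) (x l).
Proof.
move=> xb; apply: (homo_ltn (@precedes_trans R)) => i.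
by have [] := xb i.
Qed.

Lemma block_seq_neq0 (x : nat -> c00 R) k : block_seq x -> x k != 0.
Proof. by move=> /(_ k)[]. Qed.

Lemma block_seq_subseq (x : nat -> c00 R) (s : nat -> nat) : block_seq x ->
  (forall k, (s k < s k.+1)%N) -> block_seq (x \o s).
Proof.
move=> xb sS k; split; [exact: (block_seq_neq0 _ xb)|exact: (block_seq_neq0 _ xb)|].
exact: (block_seq_precedes xb).
Qed.

(** A nearly optimal functional keeps its value when restricted to the range of [x]. The value
    99/100 leaves room for the loss in [drop_first_group]. *)
Lemma norming_functional x : N x = 1 -> exists F, [/\ inW F, within_range x F.1 &
  99 / 100 < pairing F.1 x].
Proof.
move=> x1; have [|F FW Fx] := @lt_norm_pairing _ _ _ _ _ hX x (99 / 100).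
  by rewrite x1; lra.
pose P : pred nat := fun i => (minsupp x <= i <= maxsupp x)%N.
have e : pairing (restr P F.1) x = pairing F.1 x.
  rewrite pairing_restr restr_id// => i xi.
  by rewrite /P minsupp_le// maxsupp_ge.
exists (wrestr P F); rewrite /= e; split=> //.
  apply: inW_restr => //; apply: contraTneq Fx => P0.
  by rewrite -e P0 pairing0l -leNgt; lra.
by move=> i; rewrite restrE; case: ifP => //; rewrite eqxx.
Qed.

(** Restriction to the coordinates beyond the last support of [fs1] removes exactly [fs1]. *)
Lemma pw_packed_suffix ks lam fs1 fs2 : pw_packed m ks lam (fs1 ++ fs2) ->
  fs1 != [::] :> seq wfun -> fs2 != [::] -> pw_packed m ks lam fs2.
Proof.
move=> fsp f1 f2; have [fs0 fsP] := pw_packed_fast fsp.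
pose P : pred nat := fun i => (maxsupp (last F0 fs1).1 < i)%N.
have l1 : last F0 fs1 \in fs1 by case: (fs1) f1 => //= ? ? _; exact: mem_last.
have fsf1 : fast_block m fs1.
  by apply: fast_block_subseq (conj fs0 fsP); exact: prefix_subseq.
have [/allrelP f12 _ _] : [/\ allrel (fast m) fs1 fs2, pairwise (fast m) fs1
    & pairwise (fast m) fs2] by apply/and3P; rewrite -pairwise_cat.
have e2 : frestr P (fs1 ++ fs2) = fs2.
  rewrite /frestr filter_cat map_cat (_ : [seq F <- fs1 | _] = [::]) /=; last first.
    apply/eqP; rewrite -[_ == _]negbK -has_filter; apply/hasPn => F Ff.
    rewrite negbK; apply/eqP/restr_eq0 => i Pi; apply: eq0_gt_maxsupp.
    exact: leq_ltn_trans (fast_block_last fsf1 Ff) Pi.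
  have id2 F : F \in fs2 -> restr P F.1 = F.1.
    move=> Ff; apply: restr_id => i /minsupp_le; apply: leq_trans.
    by have /andP[] := f12 _ _ l1 Ff.
  rewrite (_ : [seq F <- fs2 | _] = fs2); last first.
    by apply/all_filterP/allP => F Ff; rewrite id2// fs0// mem_cat Ff orbT.
  rewrite -[RHS]map_id; apply/eq_in_map => F Ff.
  by rewrite /wrestr id2//; case: (F).
by have := pw_packed_restr (P := P) fsp; rewrite e2; apply.
Qed.

Lemma prod_rcons_m js j : (\prod_(i <- rcons js j) m i = (\prod_(i <- js) m i) * m j)%N.
Proof. by rewrite -cats1 big_cat big_seq1. Qed.

Lemma index_vector_rcons js j : index_vector js -> (0 < j)%N -> index_vector (rcons js j).
Proof.
move=> [_ jsP] j0; split; first by case: (js).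
by move=> k; rewrite mem_rcons inE => /predU1P[->//|/jsP].
Qed.

(* The part of a functional of type [W_step] below its first top-level group
   has norm at most 1/100, so the group can be dropped. *)
Lemma drop_first_group x F fs lam : inW F -> N x = 1 -> index_vector F.2 ->
  (forall G, G \in fs -> inW G) -> pw_packed m [seq n j | j <- F.2] lam fs ->
  F.1 = weighted_sum m F.2 [seq G.1 | G <- fs] ->
  within_range x F.1 -> 99 / 100 < pairing F.1 x ->
  exists gs, [/\ forall G, G \in gs -> inW G /\ within_range x G.1,
    pw_packed m [seq n j | j <- F.2] lam gs,
    forall G, G \in gs -> ((2 ^ minsupp x)%N%:R%:E <= weight m G)%E /\
      dist R (weight_node G) lam <= 2^-1 ^+ minsupp x
  & 9 / 10 <= pairing (weighted_sum m F.2 [seq G.1 | G <- gs]) x].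
Proof.
case: F => [f js] /= FW x1 jsP fsW fsp fE fx lf.
have wr G : G \in fs -> within_range x G.1.
  move=> Gf i Gi; apply: fx; rewrite fE (weighted_sum_coef _ (pw_packed_fast fsp) Gf Gi).
  by rewrite mulf_neq0// invr_neq0// pnatr_eq0 -lt0n (weight_gt0 hmn).
have [js0 [j ejs]] : exists js0 j, js = rcons js0 j.
  by case/lastP: js jsP {FW fsp fE} => [[]//|js0 j] _; exists js0, j.
have j0 : (0 < j)%N by apply: jsP.2; rewrite ejs mem_rcons mem_head.
rewrite ejs map_rcons in fsp.
have [fs1 [fs2 [efs f10 f1P f12]]] := pw_packed_split fsp.
have wE gs : weighted_sum m js [seq G.1 | G <- gs] =
    (m j)%:R^-1 *: weighted_sum m js0 [seq G.1 | G <- gs] :> c00 R.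
  by rewrite /weighted_sum scalerA ejs prod_rcons_m natrM invfM mulrC.
(* With the shorter vector [js0] the first group is itself in W (a single functional if [js0] is
   empty); the last entry of [js] adds a factor 1/m_j <= 1/100. *)
have small : pairing (weighted_sum m js [seq G.1 | G <- fs1]) x <= 1 / 100.
  have le1 : pairing (weighted_sum m js0 [seq G.1 | G <- fs1]) x <= 1.
    rewrite -x1; case: js0 ejs fsp f1P {wE} => [ejs fsp sz1|j1 js1 ejs fsp [lam1 f1p]].
      case: fs1 sz1 efs {f10 f12} => // F [|//] _ efs.
      rewrite /weighted_sum /= big_nil invr1 scale1r big_seq1.
      by apply: (pairing_le hX); apply: fsW; rewrite efs mem_head.
    apply: (pairing_le hX (F := (_, j1 :: js1))); apply: (inW_step _ _ f1p).
      split=> // k kj; apply: jsP.2; rewrite ejs mem_rcons inE kj orbT//.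
    by move=> G Gf; apply: fsW; rewrite efs mem_cat Gf.
  rewrite wE pairingZl; have m100 : (100 : R) <= (m j)%:R by rewrite ler_nat (m_ge100 hmn).
  have : (m j)%:R^-1 <= 100^-1 :> R by rewrite lef_pV2 ?posrE//; lra.
  have : 0 <= (m j)%:R^-1 :> R by rewrite invr_ge0.
  by nra.
have f2big : 9 / 10 <= pairing (weighted_sum m js [seq G.1 | G <- fs2]) x.
  suff : pairing f x = pairing (weighted_sum m js [seq G.1 | G <- fs1]) x +
      pairing (weighted_sum m js [seq G.1 | G <- fs2]) x by lra.
  rewrite fE /weighted_sum efs map_cat big_cat/= scalerDr.
  by rewrite pairingC pairingDr !(pairingC x).
have f20 : fs2 != [::].
  by apply: contraTneq f2big => ->; rewrite /weighted_sum big_nil scaler0 pairing0l -ltNge; lra.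
exists fs2; split=> //.
- by move=> G Gf; split; [apply: fsW|apply: wr]; rewrite efs mem_cat Gf orbT.
- by rewrite ejs map_rcons; apply: (pw_packed_suffix (fs1 := fs1)) => //; rewrite -efs.
case: fs1 f10 efs f12 {f1P small} => // F fs1 _ efs f12 G Gf.
have Ff : F \in fs by rewrite efs mem_head.
have mF : (minsupp x <= maxsupp F.1)%N.
  have F0 := (pw_packed_fast fsp).1 _ Ff.
  exact: leq_trans (within_range_supp F0 (wr _ Ff)).1 (minsupp_maxsupp _).
have /andP[/andP[_ wG] cG] := f12 F G (mem_head _ _) Gf.
by split; [apply: le_trans wG; exact: leq_pow2 | apply: le_trans cG _; exact: half_expW].
Qed.

(** The asymptotic l_1 mechanism: on these [h] an (m_j, n_j)-operation stays inside W. The vector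
    weight of the result is left open, since it may be [[:: j]] or a longer vector ending in [j]. *)
Definition lower_functionals (x : nat -> c00 R) (s : nat -> nat) : Prop :=
  exists h : nat -> c00 R,
    (forall k, within_range (x (s k)) (h k) /\ 9 / 10 <= pairing (h k) (x (s k))) /\
    forall j (t : seq nat), (0 < j)%N -> sorted ltn t ->
      schreier (n j) [seq minsupp (x (s k)) | k <- t] ->
      exists js, inW ((m j)%:R^-1 *: \sum_(k <- t) h k, js).

Section Cases.
Variables (x : nat -> c00 R) (F : nat -> wfun) (U : set_system nat).
Hypotheses (xb : block_seq x) (x1 : forall k, N (x k) = 1).
Hypothesis FP : forall k, [/\ inW (F k), within_range (x k) (F k).1 &
  99 / 100 < pairing (F k).1 (x k)].
Hypotheses (ultraU : UltraFilter U) (freeU : forall k, U [set i | (k <= i)%N]).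

Lemma spread_block (s : nat -> nat) (t : seq nat) N (h : nat -> c00 R) :
  (forall k, (s k < s k.+1)%N) -> sorted ltn t ->
  schreier N [seq minsupp (x (s k)) | k <- t] ->
  (forall k, h k != 0 /\ within_range (x (s k)) (h k)) ->
  schreier N [seq minsupp (h k) | k <- t].
Proof.
move=> sS st St hP; apply: (schreier_spread St (subseq_refl _)).
- by have := schreier_neq0 St; case: (t).
- rewrite sorted_map; apply: sub_sorted st => k l kl /=.
  have [hk0 /(within_range_supp hk0)[_ hk]] := hP k.
  have [hl0 /(within_range_supp hl0)[hl _]] := hP l.
  apply: leq_trans hl; apply: leq_ltn_trans (block_seq_precedes xb (lt_subsequence sS kl)).
  exact: leq_trans (minsupp_maxsupp _) hk.
by move=> k _; have [hk0 /(within_range_supp hk0)[]] := hP k.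
Qed.

Lemma F_neq0 k : (F k).1 != 0.
Proof.
have [_ _] := FP k; apply: contraTneq => ->; rewrite pairing0l -leNgt; lra.
Qed.

(** Weights tending to infinity and nodes converging along the ultrafilter allow a subsequence on
    which the norming functionals are packed at one level, with vector weight [[:: j]]. *)
Lemma lower_unbounded :
  (forall B : nat, U [set i | ((B%:R : R)%:E <= weight m (F i))%E]) ->
  exists2 s : nat -> nat, (forall k, (s k < s k.+1)%N) & lower_functionals x s.
Proof.
move=> wB; have [lam lamP] := ultra_cluster ultraU R (fun i => weight_node (F i)).
have [a|s sP] := @exists_subsequence (fun a i =>
    ((2 ^ maxsupp (x a))%N%:R%:E <= weight m (F i))%E /\
    dist R (weight_node (F i)) lam <= 2^-1 ^+ maxsupp (x a)).
  have [i ai [wi di]] := ultra_unbounded ultraU freeU a.+1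
    (@filterI _ U _ _ _ (wB (2 ^ maxsupp (x a))%N) (lamP (maxsupp (x a)))).
  by exists i.
have sS k : (s k < s k.+1)%N by have [] := sP k.
have mF k : (maxsupp (F k).1 <= maxsupp (x k))%N.
  by have [_ /(within_range_supp (F_neq0 k))[]] := FP k.
have mx k l : (k <= l)%N -> (maxsupp (x k) <= maxsupp (x l))%N.
  rewrite leq_eqVlt => /predU1P[->//|/(block_seq_precedes xb) kl].
  exact: leq_trans (ltnW kl) (minsupp_maxsupp _).
have sle k l : (k <= l)%N -> (s k <= s l)%N.
  by rewrite leq_eqVlt => /predU1P[->//|/(lt_subsequence sS)/ltnW].
have sF k l : (k < l)%N -> ((2 ^ maxsupp (F (s k)).1)%N%:R%:E <= weight m (F (s l)))%E /\
    dist R (weight_node (F (s l))) lam <= 2^-1 ^+ maxsupp (F (s k)).1.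
  case: l => // l; rewrite ltnS => kl; have [_ [wl dl]] := sP l.
  have le : (maxsupp (F (s k)).1 <= maxsupp (x (s l)))%N.
    exact: leq_trans (mF _) (mx _ _ (sle _ _ kl)).
  by split; [apply: le_trans wl; exact: leq_pow2 | apply: le_trans dl _; exact: half_expW].
exists s => //; exists (fun k => (F (s k)).1); split.
  by move=> k; have [_ ? ?] := FP (s k); split=> //; lra.
move=> j t j0 st St; exists [:: j].
have -> : (m j)%:R^-1 *: \sum_(k <- t) (F (s k)).1 =
    weighted_sum m [:: j] [seq G.1 | G <- [seq F (s k) | k <- t]].
  by rewrite /weighted_sum big_seq1 !big_map.
apply: (@inW_step _ _ _ _ _ lam); first by split=> // k; rewrite inE => /eqP ->.
  by move=> _ /mapP[k _ ->]; have [] := FP (s k).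
apply: pw_packed_one.
- split; first by move=> _ /mapP[k _ ->]; exact: F_neq0.
  rewrite pairwise_map; move: st; rewrite (sorted_pairwise ltn_trans).
  apply: sub_pairwise => k l kl /=; rewrite /fast (sF k l kl).1 andbT.
  have [_ /(within_range_supp (F_neq0 _))[h1 _] _] := FP (s l).
  apply: leq_trans h1; apply: leq_ltn_trans (mF _) _.
  exact/block_seq_precedes/lt_subsequence.
- rewrite -map_comp; apply: spread_block St _ => // k.
  by split; [exact: F_neq0 | have [] := FP (s k)].
rewrite pairwise_map; move: st; rewrite (sorted_pairwise ltn_trans).
by apply: sub_pairwise => k l /sF[].
Qed.

(** Functionals of W_1 with common vector [js] add up to a functional of W_1 with vector
    [rcons js j], by convolution of Schreier families. *)
Lemma lower_W1 js :
  U [set i | exists is_, [/\ index_vector js, schreier (\sum_(j <- js) n j) is_ &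
    (F i).1 = weighted_sum m js [seq unit_vec R k | k <- is_]]] ->
  exists2 s : nat -> nat, (forall k, (s k < s k.+1)%N) & lower_functionals x s.
Proof.
move=> UA; have [a|s sP] := @exists_subsequence (fun _ i =>
    exists is_, [/\ index_vector js, schreier (\sum_(j <- js) n j) is_ &
    (F i).1 = weighted_sum m js [seq unit_vec R k | k <- is_]]).
  by have [i ai Ai] := ultra_unbounded ultraU freeU a.+1 UA; exists i.
have sS k : (s k < s k.+1)%N by have [] := sP k.
have sS1 k : (s k.+1 < s k.+2)%N by [].
have [I IP] := choice (fun k => (sP k).2).
exists (s \o succn) => //; exists (fun k => (F (s k.+1)).1); split.
  by move=> k; have [_ ? ?] := FP (s k.+1); split=> //=; lra.
move=> j t j0 st St; exists (rcons js j).
have jsP : index_vector js by have [] := IP 0%N.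
have I0 k i : i \in I k -> (0 < i)%N.
  by move=> ik; have [_ S _] := IP k; exact: (schreier_gt0 S ik).
have FI k i : i \in I k -> (F (s k.+1)).1 i != 0.
  move=> iI; have [_ S ->] := IP k; rewrite c00_Z c00_sum big_map.
  rewrite mulf_neq0 ?invr_neq0 ?pnatr_eq0 -?lt0n ?(weight_gt0 hmn)//.
  rewrite gt_eqF// (big_rem i)//= (I0 _ _ iI) eqxx ltr_wpDr//.
  by apply: sumr_ge0 => l _; rewrite ler0n.
have hI k : head 0%N (I k) = minsupp (F (s k.+1)).1.
  have [_ S FE] := IP k; apply/esym; have I1 := schreier_neq0 S.
  have hh : head 0%N (I k) \in I k by case: (I k) I1 => // ? ? _; exact: mem_head.
  apply: minsupp_eq; first exact: FI.
  move=> l lh; rewrite FE c00_Z c00_sum big_map [X in _ * X]big_seq [X in _ * X]big1 ?mulr0// => i iI.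
  rewrite unit_vecE ?(I0 _ _ iI)//; case: eqVneq => // e; move: lh; rewrite e ltnNge.
  have := schreier_sorted S; case: (I k) iI => //= i0 u; rewrite inE => /predU1P[->|iu].
    by rewrite leqnn.
  by rewrite (path_sortedE ltn_trans) => /andP[/allP/(_ _ iu)/ltnW ->].
have -> : (m j)%:R^-1 *: \sum_(k <- t) (F (s k.+1)).1 =
    weighted_sum m (rcons js j) [seq unit_vec R i | i <- flatten [seq I k | k <- t]].
  rewrite /weighted_sum big_map big_flatten big_map prod_rcons_m natrM invfM mulrC.
  rewrite -scalerA; congr (_ *: _); rewrite scaler_sumr; apply: eq_bigr => k _.
  by have [_ _ ->] := IP k; rewrite /weighted_sum big_map.
apply: inW_W1; first exact: index_vector_rcons.
rewrite -cats1 big_cat big_seq1; apply: schreier_flatten.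
- by move=> _ /mapP[k _ ->]; have [] := IP k.
- elim: t st {St} => //= k t IH kt.
  rewrite (sorted_pairwise ltn_trans) pairwise_cat -!(sorted_pairwise ltn_trans).
  rewrite IH ?(path_sorted kt)// andbT (schreier_sorted (n := \sum_(j <- js) n j)) ?andbT.
    apply/allrelP => i l iI /flattenP[_ /mapP[k' k't ->] lI].
    have kk' : (k < k')%N by move: kt; rewrite (path_sortedE ltn_trans) => /andP[/allP/(_ _ k't)].
    have [_ wk _] := FP (s k.+1); have [_ wk' _] := FP (s k'.+1).
    have /andP[_ i1] := wk _ (FI _ _ iI); have /andP[i2 _] := wk' _ (FI _ _ lI).
    apply: leq_trans i2; apply: leq_ltn_trans i1 _.
    by apply/(block_seq_precedes xb)/(lt_subsequence sS).
  by have [] := IP k.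
rewrite -map_comp; rewrite (_ : map _ _ = [seq minsupp (F (s k.+1)).1 | k <- t]); last first.
  by apply: eq_map => k; exact: hI.
apply: (spread_block (s := s \o succn)) St _ => // k.
by split; [exact: F_neq0 | have [] := FP (s k.+1)].
Qed.

(** After [drop_first_group], the members over x_k have weights and closeness to their centre
    governed by the minimum of supp x_k, hence by all earlier supports. Once the centres converge,
    each x_k supplies one group of a family packed with vector [rcons js j]. *)
Lemma lower_step js :
  U [set i | exists fs lam, [/\ index_vector js, forall G, G \in fs -> inW G,
        pw_packed m [seq n j | j <- js] lam fs &
        (F i).1 = weighted_sum m js [seq G.1 | G <- fs]]] ->
  U [set i | (F i).2 = js] ->
  exists2 s : nat -> nat, (forall k, (s k < s k.+1)%N) & lower_functionals x s.
Proof.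
move=> UA Ujs.
pose good i (p : seq wfun * cnode) := [/\ forall G, G \in p.1 -> inW G /\ within_range (x i) G.1,
    pw_packed m [seq n j | j <- js] p.2 p.1,
    forall G, G \in p.1 -> ((2 ^ minsupp (x i))%N%:R%:E <= weight m G)%E /\
      dist R (weight_node G) p.2 <= 2^-1 ^+ minsupp (x i)
  & 9 / 10 <= pairing (weighted_sum m js [seq G.1 | G <- p.1]) (x i)].
have UB : U [set i | exists p, good i p].
  apply: (@filterS2 _ U _ _ _ _ _ UA Ujs) => i [fs [lam [jsP fsW fsp FE]]] eji.
  have [FW Fx Fl] := FP i.
  rewrite -eji in FE fsp jsP.
  have [gs] := drop_first_group FW (x1 i) jsP fsW fsp FE Fx Fl.
  by rewrite eji => gsP; exists (gs, lam).
have [p pP] : exists p : nat -> seq wfun * cnode, forall i, (exists q, good i q) -> good i (p i).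
  have [|p pP] := @choice _ _ (fun i q => (exists q', good i q') -> good i q).
    move=> i; have [[q gq]|nq] := pselect (exists q, good i q); first by exists q.
    by exists ([::], Node [::]).
  by exists p.
have {}UB : U [set i | good i (p i)] by apply: filterS UB => i /pP.
have [lam lamP] := ultra_cluster ultraU R (fun i => (p i).2).
have [a|s sP] := @exists_subsequence (fun a i => good i (p i) /\
    dist R (p i).2 lam <= 2^-1 ^+ maxsupp (x a)).
  have [i ai [gi di]] := ultra_unbounded ultraU freeU a.+1
    (@filterI _ U _ _ _ UB (lamP (maxsupp (x a)))).
  by exists i.
have sS k : (s k < s k.+1)%N by have [] := sP k.
have sS1 k : (s k.+1 < s k.+2)%N by [].
have gP k : good (s k.+1) (p (s k.+1)) by have [_ []] := sP k.
have gd k l : (k < l)%N -> dist R (p (s l)).2 lam <= 2^-1 ^+ maxsupp (x (s k)).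
  case: l => // l; rewrite ltnS => kl; have [_ [_ dl]] := sP l; apply: le_trans dl _.
  apply: half_expW; move: kl; rewrite leq_eqVlt => /predU1P[->//|/(lt_subsequence sS)].
  move=> /(block_seq_precedes xb)/ltnW kl; exact: leq_trans kl (minsupp_maxsupp _).
pose h k := weighted_sum m js [seq G.1 | G <- (p (s k.+1)).1].
have jsP : index_vector js.
  by have [i [fs [lam' []]]] := @filter_ex _ U _ _ UA.
have gin k G : G \in (p (s k.+1)).1 -> [/\ G.1 != 0,
    (minsupp (x (s k.+1)) <= minsupp G.1)%N & (maxsupp G.1 <= maxsupp (x (s k.+1)))%N].
  move=> Gp; have [gW gp _ _] := gP k; have G0 := (pw_packed_fast gp).1 _ Gp.
  by have [] := within_range_supp G0 (gW _ Gp).2.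
exists (s \o succn) => //; exists h; split.
  move=> k /=; have [gW gp _ gx] := gP k; split=> // i; rewrite c00_Z c00_sum big_map.
  have [[G Gp Gi] _|no] := pselect (exists2 G, G \in (p (s k.+1)).1 & G.1 i != 0).
    exact: (gW _ Gp).2.
  rewrite [X in _ * X]big_seq [X in _ * X]big1 ?mulr0 ?eqxx// => G Gp.
  by apply/eqP/negPn/negP => Gi; apply: no; exists G.
move=> j t j0 st St; exists (rcons js j).
pose gss := [seq p (s k.+1) | k <- t].
have -> : (m j)%:R^-1 *: \sum_(k <- t) h k =
    weighted_sum m (rcons js j) [seq G.1 | G <- flatten (unzip1 gss)].
  rewrite /weighted_sum big_map big_flatten !big_map prod_rcons_m natrM invfM mulrC.
  rewrite -scalerA; congr (_ *: _); rewrite scaler_sumr; apply: eq_bigr => k _.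
  by rewrite /h /weighted_sum big_map.
have gssP g : g \in gss -> exists2 k, k \in t & g = p (s k.+1) by move=> /mapP.
apply: (@inW_step _ _ _ _ _ lam); first exact: index_vector_rcons.
  move=> G /flattenP[_ /mapP[g /gssP[k _ ->] ->] Gp].
  by have [gW _ _ _] := gP k; have [] := gW _ Gp.
rewrite map_rcons.
have cross k l A B : (k < l)%N -> A \in (p (s k.+1)).1 -> B \in (p (s l.+1)).1 ->
    (maxsupp A.1 <= maxsupp (x (s k.+1)) < minsupp (x (s l.+1)))%N.
  move=> kl Ap Bp; have [_ _ ->] := gin _ _ Ap.
  by apply/(block_seq_precedes xb)/(lt_subsequence sS).
apply: pw_packed_more.
- by case: jsP; case: (js).
- split.
    by move=> G /flattenP[_ /mapP[g /gssP[k _ ->] ->] Gp]; have [] := gin _ _ Gp.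
  rewrite /gss /unzip1 -map_comp; elim: t st {St gss gssP} => //= k t IH kt.
  rewrite pairwise_cat IH ?(path_sorted kt)// andbT.
  have [_ gp _ _] := gP k; rewrite (pw_packed_fast gp).2 andbT.
  apply/allrelP => A B Ap /flattenP[_ /mapP[l lt ->] Bp].
  have kl : (k < l)%N by move: kt; rewrite (path_sortedE ltn_trans) => /andP[/allP/(_ _ lt)].
  have /andP[c1 c2] := cross _ _ _ _ kl Ap Bp; have [_ b1 _] := gin _ _ Bp.
  rewrite /fast /precedes (leq_ltn_trans c1 (leq_trans c2 b1))/=.
  have [_ _ gw _] := gP l; have [wB _] := gw _ Bp; apply: le_trans wB.
  exact/leq_pow2/ltnW/(leq_ltn_trans c1).
- by move=> g /gssP[k _ ->]; have [_ /pw_packed_neq0] := gP k.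
- rewrite /gss -map_comp.
  apply: (spread_block (s := s \o succn) (h := fun k => (head F0 (p (s k.+1)).1).1)) St _ => // k /=.
  have [gW gp _ _] := gP k.
  have hp : head F0 (p (s k.+1)).1 \in (p (s k.+1)).1.
    by have := pw_packed_neq0 gp; case: (p _).1 => // ? ? _; exact: mem_head.
  by split; [have [] := gin _ _ hp | exact: (gW _ hp).2].
- by move=> g /gssP[k _ ->]; have [] := gP k.
rewrite /gss pairwise_map; move: st; rewrite (sorted_pairwise ltn_trans).
apply: sub_pairwise => k l kl /=; apply/allP => A Ap; apply/andP; split.
  apply/allP => B Bp; have /andP[c1 c2] := cross _ _ _ _ kl Ap Bp.
  have [_ _ gw _] := gP l; have [_ dB] := gw _ Bp; apply: le_trans dB _.
  exact/half_expW/ltnW/(leq_ltn_trans c1).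
have [_ _ mA] := gin _ _ Ap; apply: le_trans (gd k.+1 l.+1 kl) _.
exact: half_expW.
Qed.

(** If the weights do not tend to infinity along [U] they are bounded on a set of [U]. Only finitely
    many vectors have a bounded product, so one [js] occurs on a set of [U]. *)
Lemma exists_lower_functionals_ultra :
  exists2 s : nat -> nat, (forall k, (s k < s k.+1)%N) & lower_functionals x s.
Proof.
have [wB|/existsNP[B nB]] :=
  pselect (forall B : nat, U [set i | ((B%:R : R)%:E <= weight m (F i))%E]).
  exact: lower_unbounded.
have [//|UB] := in_ultra_setVsetC [set i | ((B%:R : R)%:E <= weight m (F i))%E] ultraU.
have iv i : (F i).2 != [::] -> index_vector (F i).2.
  by have [/inW_cases[->|[is_ []]|[fs [lam []]]]] := FP i.
(* All lists of length and entries at most [B]: the length is below 100^l and each entry j is at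
   most m_j, and both are bounded by the weight. *)
pose L : seq (seq nat) := flatten [seq [seq [seq nat_of_ord k | k <- tval w] |
  w <- enum {: l.-tuple 'I_B.+1}] | l <- seq.iota 0 B.+1].
have UL : U [set i | (F i).2 \in L].
  apply: filterS UB => i /= /negP; rewrite -ltNge /weight => wi.
  have js0 : (F i).2 != [::] by apply: contraTneq wi => ->; rewrite -leNgt leey.
  have {wi}wi : (\prod_(j <- (F i).2) m j < B)%N.
    by move: wi; case: (F i).2 js0 => // j js _; rewrite lte_fin ltr_nat.
  have sz : (size (F i).2 < B)%N.
    apply: leq_ltn_trans wi; apply: leq_trans (weight_ge_exp hmn (iv _ js0)).
    exact/ltnW/ltn_expl.
  have jB j : j \in (F i).2 -> (j < B.+1)%N.
    move=> ji; rewrite ltnS; apply: leq_trans (m_ge_id hmn ((iv _ js0).2 _ ji)) _.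
    exact: leq_trans (weight_ge_m hmn (iv _ js0) ji) (ltnW wi).
  apply/flattenP.
  exists [seq [seq nat_of_ord k | k <- tval w] | w <- enum {: (size (F i).2).-tuple 'I_B.+1}].
    by apply: (map_f (fun l => [seq [seq nat_of_ord k | k <- tval w] |
        w <- enum {: l.-tuple 'I_B.+1}])); rewrite mem_iota leq0n add0n ltnS (ltnW sz).
  have szw : size [seq (inord j : 'I_B.+1) | j <- (F i).2] == size (F i).2 by rewrite size_map.
  apply/mapP; exists (Tuple szw); first by rewrite mem_enum.
  rewrite /= -map_comp -[LHS]map_id; apply/eq_in_map => j ji /=.
  by rewrite inordK// jB.
have [js _ Ujs] := ultra_pigeonhole ultraU UL.
have js0 : js <> [::].
  move=> e; rewrite e in Ujs; have [i [/= e' nw]] := @filter_ex _ U _ _ (filterI Ujs UB).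
  by apply: nw; rewrite /weight e' leey.
have [|U1|U2] := @ultra_or U ultraU [set i | exists is_, [/\ index_vector js,
    schreier (\sum_(j <- js) n j) is_ &
    (F i).1 = weighted_sum m js [seq unit_vec R k | k <- is_]]]
  [set i | exists fs lam, [/\ index_vector js, forall G, G \in fs -> inW G,
        pw_packed m [seq n j | j <- js] lam fs &
        (F i).1 = weighted_sum m js [seq G.1 | G <- fs]]].
- apply: filterS Ujs => i /= ei; have [/inW_cases[e|?|?] _ _] := FP i.
  + by case: js0; rewrite -ei e.
  + by left; rewrite -ei.
  by right; rewrite -ei.
- exact: lower_W1 U1.
exact: lower_step U2 Ujs.
Qed.

End Cases.

Lemma exists_lower_functionals (x : nat -> c00 R) :
  block_seq x -> (forall k, N (x k) = 1) ->
  exists2 s : nat -> nat, (forall k, (s k < s k.+1)%N) & lower_functionals x s.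
Proof.
move=> xb x1; have [F FP] := choice (fun k => norming_functional (x1 k)).
have [U [ultraU freeU]] := exists_free_ultrafilter.
exact: (exists_lower_functionals_ultra xb x1 FP ultraU freeU).
Qed.

Definition lower_estimate (t : nat) (B : R) (x : nat -> c00 R) : Prop :=
  forall (s : seq nat) (c : nat -> R), sorted ltn s ->
    schreier t [seq minsupp (x k) | k <- s] -> (forall k, 0 <= c k) ->
    \sum_(k <- s) c k <= B * N (\sum_(k <- s) c k *: x k).

(** Testing with m_j^{-1} sum h_k gives the constant (10/9) m_j, rounded up to 2 m_j. A single
    subsequence serves every [j]. *)
Lemma exists_lower_estimate (x : nat -> c00 R) :
  block_seq x -> (forall k, N (x k) = 1) ->
  exists2 s : nat -> nat, (forall k, (s k < s k.+1)%N) &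
    forall j, (0 < j)%N -> lower_estimate (n j) (2 * (m j)%:R) (x \o s).
Proof.
move=> xb x1; have [s sS [h [hx hW]]] := exists_lower_functionals xb x1.
exists s => // j j0 t c st St c0.
have [js FW] := hW j t j0 st St.
have m0 : 0 < (m j)%:R :> R by rewrite ltr0n (m_gt0 hmn).
have := pairing_le hX (\sum_(k <- t) c k *: (x \o s) k) FW.
rewrite /= pairingZl pairing_sumr => le.
have ge : 9 / 10 * \sum_(k <- t) c k <=
    \sum_(k <- t) pairing (\sum_(l <- t) h l) (c k *: x (s k)).
  rewrite mulr_sumr big_seq [leRHS]big_seq; apply: ler_sum => k kt.
  rewrite pairingZr pairing_suml (bigD1_seq k)//=; last first.
    exact: sorted_uniq ltn_trans ltnn _ st.
  rewrite big1 ?addr0; last first.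
    move=> l lk; apply: pairing_disjoint => i /((hx l).1)/andP[i1 i2].
    have [kl|lk'|e] := ltngtP k l; last by rewrite e eqxx in lk.
      apply: eq0_gt_maxsupp; apply: leq_trans i1.
      exact/(block_seq_precedes xb)/(lt_subsequence sS).
    apply: eq0_lt_minsupp; apply: leq_ltn_trans i2 _.
    exact/(block_seq_precedes xb)/(lt_subsequence sS).
  by rewrite mulrC; apply: ler_wpM2l => //; exact: (hx k).2.
have S0 : 0 <= \sum_(k <- t) c k by apply: sumr_ge0.
move: le; rewrite mulrC ler_pdivrMr// => le.
by nra.
Qed.

End LowerFunctionals.

(** * Special convex combinations *)

Section SpecialConvex.
Variables (R : realType) (a b : nat -> nat).
Hypothesis abP : forall k, [/\ (0 < a k)%N, (a k <= b k)%N & (b k < a k.+1)%N].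
Implicit Types (n k K : nat) (s t : seq nat) (c : nat -> R).

Lemma interlaced_lt k l : (k < l)%N -> (b k < a l)%N.
Proof.
case: l => // l; rewrite ltnS => /subnK <-; elim: (l - k)%N => [|d IH].
  by have [] := abP k.
by rewrite addSn; apply: ltn_trans IH _; have [_ h1 h2] := abP (d + k).+1; exact: leq_ltn_trans h2.
Qed.

Lemma interlaced_le_id k : (k < a k)%N.
Proof.
elim: k => [|k IH]; first by have [] := abP 0%N.
have [_ h1 h2] := abP k; apply: leq_ltn_trans h2; exact: leq_trans h1.
Qed.

Lemma interlaced_b_le k l : (k <= l)%N -> (b k <= b l)%N.
Proof.
rewrite leq_eqVlt => /predU1P[->//|/interlaced_lt kl].
by have [_ h _] := abP l; exact: ltnW (leq_trans kl h).
Qed.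

Definition positive_on s c : Prop :=
  forall k, if k \in s then is_true (0 < c k) else c k = 0.

(** The usual (n, eps) special convex combinations. Admissibility is tested at the left ends [a] and
    smallness at the right ends [b]; by spreading, each is the more demanding choice. *)
Definition special_convex n (eps : R) s c : Prop :=
  [/\ sorted ltn s, schreier n [seq a k | k <- s],
      positive_on s c, \sum_(k <- s) c k = 1
    & forall n' t, (n' < n)%N -> sorted ltn t -> schreier n' [seq b k | k <- t] ->
        \sum_(k <- t) c k <= eps].

Lemma sum_le_total s t c : sorted ltn s -> sorted ltn t ->
  positive_on s c ->
  0 <= \sum_(k <- t) c k <= \sum_(k <- s) c k.
Proof.
move=> ss st cs; have c0 k : 0 <= c k by have := cs k; case: ifP => [_ /ltW|_ ->].
rewrite sumr_ge0 //=.
rewrite (bigID (mem s))/= [X in _ + X]big1 ?addr0; last first.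
  by move=> k ks; have := cs k; rewrite (negbTE ks).
rewrite -big_filter [leRHS](bigID (mem t))/= -[X in _ <= X + _]big_filter.
rewrite (_ : \sum_(k <- [seq k <- t | k \in s]) c k = \sum_(k <- [seq k <- s | k \in t]) c k).
  by rewrite lerDl sumr_ge0.
apply: perm_big; apply: uniq_perm; rewrite ?filter_uniq// ?(sorted_uniq ltn_trans ltnn)//.
by move=> k; rewrite !mem_filter andbC.
Qed.

(* An S_{n+1} set starting before index e meets the part of the average beyond
   e in at most [b e] sets of S_n. *)
Lemma special_convex_late n (eps : R) e s c t : 0 <= eps ->
  special_convex n (eps / (b e)%:R) s c -> (forall k, k \in s -> (e < k)%N) ->
  sorted ltn t -> schreier n [seq b k | k <- t] -> (head 0 t <= e)%N ->
  \sum_(k <- t) c k <= eps.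
Proof.
move=> eps0 [ss Ss cs _ cn] es st St ht; case: n Ss cn St => [|n] Ss cn St.
  case: St => i i0; case: t st ht => [//|k [|//]] _ /= ke _.
  rewrite big_seq1; have := cs k; case: ifP => [/es|_ ->//].
  by rewrite ltnNge ke.
have be0 : 0 < (b e)%:R :> R.
  by have [h1 h2 _] := abP e; rewrite ltr0n (leq_trans h1).
move: St => /schreierS[Fs [Fs0 eF sF szF FsP]].
pose ts := reshape (shape Fs) t.
have ets : Fs = [seq map b u | u <- ts] by rewrite map_reshape eF flattenK.
have et : t = flatten ts by rewrite reshapeKr// -size_flatten -eF size_map.
rewrite {1}et big_flatten /=.
have le u : u \in ts -> \sum_(k <- u) c k <= eps / (b e)%:R.
  move=> uts; apply: (cn n) => //; last by apply: FsP; rewrite ets map_f.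
  by apply: (subseq_sorted ltn_trans) st; rewrite et; exact: subseq_flatten_mem.
apply: le_trans (_ : \sum_(u <- ts) (eps / (b e)%:R) <= _).
  by rewrite big_seq [leRHS]big_seq; apply: ler_sum.
rewrite big_const_seq count_predT iter_addr_0 -[X in X <= _]mulr_natr mulrAC ler_pdivrMr//.
rewrite ler_wpM2l// ler_nat (_ : size ts = size Fs); last by rewrite ets size_map.
apply: leq_trans szF _.
have hF : head [::] Fs <> [::].
  by case: (Fs) Fs0 FsP => //= F Fs' _ /(_ F (mem_head _ _)) /schreier_neq0 /eqP.
rewrite -head_flatten// -eF; case: (t) ht eF => //= k t' ke _.
exact: interlaced_b_le.
Qed.

(** Repeated averages: at level n+1, the mean of [d] successive level-n combinations, each so fine
    that a set of S_n begun before it gathers almost nothing on it. *)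
Lemma exists_special_convex n (eps : R) K : 0 < eps ->
  exists s c, special_convex n eps s c /\ forall k, k \in s -> (K <= k)%N.
Proof.
elim: n eps K => [|n IH] eps K eps0.
  exists [:: K], (fun k => (k == K)%:R); split; last by move=> k; rewrite inE => /eqP ->.
  split=> //; last by rewrite big_seq1 eqxx.
    by exists (a K) => //; have [] := abP K.
  by move=> k; rewrite inE; case: eqP => // _; rewrite ltr01.
pose d := (Num.bound (2 / eps)).+1.
have dP : 2 / eps < d%:R.
  apply: lt_le_trans (archi_boundP _) _; first by rewrite divr_ge0// ltW.
  by rewrite ler_nat.
pose e0 := eps / 2; have e00 : 0 < e0 by rewrite divr_gt0.
(* Starting beyond [d] makes the union of [d] sets of S_n a set of S_{n+1}. *)
pose K0 := maxn K d.
(* The sum is built before division by [d]. A set of S_n gets mass at most 1 + d e0, which becomes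
   1/d + eps/2 <= eps. *)
have [ss [c [szs [sss ssP] [cP csum] [cl cn]]]] : exists ss c, [/\ (size ss = d)%N,
    sorted ltn (flatten ss) /\ (forall s, s \in ss -> schreier n [seq a k | k <- s] /\
      forall k, k \in s -> (K0 <= k)%N),
    positive_on (flatten ss) c /\
      \sum_(k <- flatten ss) c k = d%:R &
    (forall n' t, (n' < n)%N -> sorted ltn t -> schreier n' [seq b k | k <- t] ->
       \sum_(k <- t) c k <= d%:R * e0) /\
    (forall t, sorted ltn t -> schreier n [seq b k | k <- t] ->
       \sum_(k <- t) c k <= 1 + d%:R * e0)].
  elim: d {dP K0} (K0) => [|d IHd] K0.
    exists [::], (fun=> 0); split=> //; first by split=> //=; rewrite big_nil.
    by split=> [n' t _ _ _|t _ _]; rewrite big1// mul0r ?addr0.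
  have [ss [c [szs [sss ssP] [cP csum] [cl cn]]]] := IHd K0.
  (* The next combination starts after [e] with precision e0 / b e, to offset the at most [b e]
     pieces of a set begun no later than [e]. *)
  pose e := maxn K0 (last 0 (flatten ss)).
  have be0 : 0 < (b e)%:R :> R.
    by have [h1 h2 _] := abP e; rewrite ltr0n (leq_trans h1).
  have ese k : k \in flatten ss -> (k <= e)%N.
    rewrite /e; case/lastP: (flatten ss) sss => // u l.
    rewrite (sorted_pairwise ltn_trans) pairwise_rcons last_rcons => /andP[/allP ul _].
    rewrite mem_rcons inE leq_max => /predU1P[->|/ul/ltnW ->]; rewrite ?leqnn orbT//.
  have e10 : 0 < e0 / (b e)%:R by rewrite divr_gt0.
  have [s [c1 [[s1 Ss cs1 sum1 cn1] sK]]] := IH _ e.+1 e10.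
  have be1 : 1 <= (b e)%:R :> R by rewrite ler1n -(ltr0n R).
  have le_e0 : e0 / (b e)%:R <= e0 by rewrite ler_pdivrMr// ler_peMr// ltW.
  have dis k : k \in s -> k \in flatten ss -> False.
    by move=> /sK ks /ese; rewrite leqNgt ks.
  have mem k : k \in flatten (rcons ss s) = (k \in flatten ss) || (k \in s).
    by rewrite flatten_rcons mem_cat.
  exists (rcons ss s), (fun k => c k + c1 k); split.
  - by rewrite size_rcons szs.
  - split.
      rewrite flatten_rcons (sorted_pairwise ltn_trans) pairwise_cat.
      rewrite -!(sorted_pairwise ltn_trans) sss s1 !andbT.
      by apply/allrelP => k l /ese ke /sK; apply: leq_ltn_trans.
    move=> u; rewrite mem_rcons inE => /predU1P[->|/ssP//]; split=> // k /sK.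
    by apply: leq_trans; rewrite ltnW// ltnS /e leq_maxl.
  - split.
      move=> k; rewrite mem; have := cP k; have := cs1 k.
      case: (boolP (k \in flatten ss)) => [kf|_]; case: (boolP (k \in s)) => [ks|_] //=.
      + by have := dis _ ks kf.
      + by move=> ->; rewrite addr0.
      + by move=> h ->; rewrite add0r.
      by move=> -> ->; rewrite addr0.
    rewrite flatten_rcons big_cat/= !big_split/= csum sum1 -natr1.
    rewrite (_ : \sum_(i <- flatten ss) c1 i = 0) ?addr0; last first.
      rewrite big_seq big1// => k kf; have := cs1 k; case: ifP => // ks.
      by have := dis _ ks kf.
    rewrite (_ : \sum_(i <- s) c i = 0) ?add0r//.
    rewrite big_seq big1// => k ks; have := cP k; case: ifP => // kf.
    by have := dis _ ks kf.
  split=> [n' t n'n st St|t st St]; rewrite big_split/= -natr1 mulrDl mul1r.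
    by apply: lerD; [exact: cl St|apply: le_trans le_e0; exact: cn1 St].
  (* Either [t] begins early and gains at most [e0] on the new combination, or it misses all earlier
     ones and gains at most 1 in total. *)
  have [he|he] := leqP (head 0%N t) e.
    rewrite addrA; apply: lerD; first exact: cn.
    apply: (@special_convex_late n e0 e s c1) => //; exact: ltW.
  rewrite big_seq big1 ?add0r; last first.
    move=> k kt; have := cP k; case: ifP => [/ese ke _|_ ->//].
    case: t st kt he {St} => //= l t; rewrite (path_sortedE ltn_trans) => /andP[/allP lt _].
    rewrite inE => /predU1P[<-|/lt kl] le; first by rewrite ltnNge ke in le.
    by have := leq_trans (ltn_trans le kl) ke; rewrite ltnn.
  have /andP[_] := sum_le_total s1 st cs1; rewrite sum1 => /le_trans; apply.
  by rewrite lerDl addr_ge0 ?mulr_ge0// ltW.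
have d0 : 0 < d%:R :> R by rewrite ltr0n.
exists (flatten ss), (fun k => c k / d%:R); split; last first.
  move=> k /flattenP[s /ssP[_ h] /h]; apply: leq_trans; exact: leq_maxl.
have sumE t : \sum_(k <- t) c k / d%:R = (\sum_(k <- t) c k) / d%:R by rewrite mulr_suml.
split=> //.
- apply/schreierS; exists [seq map a s | s <- ss]; split.
  + by case: (ss) szs.
  + by rewrite map_flatten.
  + rewrite sorted_map; apply: sub_sorted sss => k l /= /interlaced_lt; apply: leq_trans.
    by have [] := abP k.
  + rewrite size_map szs; case: (ss) szs ssP => //= s ss' _ /(_ s (mem_head _ _))[].
    case: s => [/schreier_neq0//|k s] _ /(_ k (mem_head _ _)) /= kK.
    apply: leq_trans (ltnW (interlaced_le_id k)); apply: leq_trans kK; exact: leq_maxr.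
  by move=> _ /mapP[s /ssP[h _] ->].
- move=> k; have := cP k; case: ifP => _ ck; first by rewrite divr_gt0.
  by rewrite ck mul0r.
- by rewrite sumE csum divff// gt_eqF.
move=> n' t; rewrite ltnS sumE ler_pdivrMr// leq_eqVlt => /predU1P[->|n'n] st St.
  apply: le_trans (cn _ st St) _; rewrite /e0.
  have : 1 <= eps * d%:R / 2.
    by move: dP; rewrite ltr_pdivrMr// => dP; lra.
  lra.
apply: le_trans (cl _ _ n'n st St) _; rewrite /e0 mulrC ler_pM2r//.
lra.
Qed.

End SpecialConvex.

(** * Functionals of small weight on special convex combinations *)

Section Estimate.
Variables (R : realType) (m n : nat -> nat).
Hypothesis hmn : parameters R m n.
Variables (X : completeNormedModType R) (iota : {linear c00 R -> X}).
Hypothesis hX : is_XD m n iota.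
Local Notation wfun := (wfun R).
Local Notation inW := (@inW R m n).
Local Notation N x := (`|iota x|).
Implicit Types (F G : wfun) (fs : seq wfun) (js : seq nat).

Definition touches (x f : c00 R) : bool :=
  (minsupp f <= maxsupp x)%N && (minsupp x <= maxsupp f)%N.

Lemma pairing_touches x f : ~~ touches x f -> pairing f x = 0.
Proof.
move=> t; apply: pairing_disjoint => i fi; apply: contraNeq t => xi.
rewrite /touches (leq_trans (minsupp_le fi) (maxsupp_ge xi)).
exact: leq_trans (minsupp_le xi) (maxsupp_ge fi).
Qed.

Lemma block_interlaced (x : nat -> c00 R) : block_seq x -> forall k,
  [/\ (0 < minsupp (x k))%N, (minsupp (x k) <= maxsupp (x k))%N
    & (maxsupp (x k) < minsupp (x k.+1))%N].
Proof.
move=> xb k; split; [exact/minsupp_gt0/block_seq_neq0 | exact: minsupp_maxsupp |].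
exact: block_seq_precedes.
Qed.

(** Transfers admissibility from functionals to the vectors assigned to them: one functional is kept
    per index, and its minimum is moved right to the end of its vector. *)
Lemma schreier_index N fs (g : wfun -> nat) (b : nat -> nat) :
  schreier N [seq minsupp F.1 | F <- fs] -> {homo b : k l / (k < l)%N} ->
  pairwise (fun F G => g F <= g G)%N fs ->
  (forall F, F \in fs -> (minsupp F.1 <= b (g F))%N) ->
  sorted ltn (undup (map g fs)) /\ schreier N [seq b k | k <- undup (map g fs)].
Proof.
move=> S bS gS gb.
have su : sorted ltn (undup (map g fs)).
  rewrite ltn_sorted_uniq_leq undup_uniq/=.
  apply: (subseq_sorted leq_trans (undup_subseq _)); rewrite sorted_map.
  exact: pairwise_sorted.
split=> //; have [msk smsk emsk] := subseqP (undup_subseq (map g fs)).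
rewrite -map_mask in emsk; have fm := mask_subseq msk fs.
rewrite emsk -map_comp; apply: (schreier_spread S fm) => /=.
- have : undup (map g fs) != [::].
    by case: (fs) (schreier_neq0 S) => // F u _; apply/eqP => /undup_nil.
  by rewrite emsk; case: (mask _ _).
- rewrite map_comp -emsk sorted_map; apply: sub_sorted su => k l; exact: bS.
by move=> F /(mem_subseq fm); exact: gb.
Qed.

(* Outside the set J of indices that are touched first by some member F of fs,
   or equal to kappa F, only one member of fs acts, and its action is small. *)
Lemma special_convex_estimate (x : nat -> c00 R) (N0 : nat) (eps tau B : R) s c js fs
    (kappa : wfun -> nat) :
  block_seq x -> (forall k, N (x k) <= B) -> 0 <= tau ->
  special_convex (fun k => minsupp (x k)) (fun k => maxsupp (x k)) N0 eps s c ->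
  decomposition m n js fs -> (forall F, F \in fs -> inW F) ->
  inW (weighted_sum m js [seq F.1 | F <- fs], js) ->
  (\sum_(j <- js) n j < N0)%N ->
  (forall F k, F \in fs -> k != kappa F -> `|pairing F.1 (x k)| <= tau) ->
  `|pairing (weighted_sum m js [seq F.1 | F <- fs]) (\sum_(k <- s) c k *: x k)|
    <= tau / (\prod_(j <- js) m j)%N%:R + 2 * B * eps.
Proof.
move=> xb xB tau0 [ss Ss cs cs1 cn] [jsP fsf Sfs _] fsW fW jsN hk.
set f := weighted_sum _ _ _; set w := (\prod_(j <- js) m j)%N%:R : R.
have w0 : 0 < w by rewrite ltr0n (weight_gt0 hmn).
have c0 k : 0 <= c k by have := cs k; case: ifP => [_ /ltW|_ ->].
have B0 : 0 <= B by apply: le_trans (xB 0%N).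
pose b k := maxsupp (x k).
have bS : {homo b : k l / (k < l)%N}.
  move=> k l kl; apply: leq_trans (block_seq_precedes xb kl) (minsupp_maxsupp _).
have bid k : (k < b k)%N.
  have [_ h _] := block_interlaced xb k.
  by apply: leq_trans h; exact: (interlaced_le_id (block_interlaced xb)).
have exg F : exists k, (minsupp F.1 <= b k)%N.
  by exists (minsupp F.1); exact: ltnW (bid _).
(* The first vector that [F] can act on: all earlier ones end before [F] begins. *)
pose g F := ex_minn (exg F).
have gP F : (minsupp F.1 <= b (g F))%N by rewrite /g; case: ex_minnP.
have gmin F k : (minsupp F.1 <= b k)%N -> (g F <= k)%N.
  by rewrite /g; case: ex_minnP => i _; apply.
pose fs' := [seq F <- fs | touches (x (kappa F)) F.1].
pose J1 := undup (map g fs); pose J2 := undup (map kappa fs').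
have fsf' : pairwise (fast m) fs' by exact: subseq_pairwise (filter_subseq _ _) fsf.2.
(* [J1] inherits the admissibility of [fs], of a level below [N0], at the right ends of the vectors;
   so its mass is small. The same holds for [J2] below. *)
have sJ1 : \sum_(k <- J1) c k <= eps.
  have [||st St] := schreier_index Sfs bS (g := g); last exact: cn St.
    2: by move=> F _; exact: gP.
  apply: sub_pairwise fsf.2 => F G /andP[FG _]; apply: gmin.
  apply: leq_trans (gP G); apply: ltnW; apply: leq_ltn_trans FG.
  exact: minsupp_maxsupp.
have eps0 : 0 <= eps by apply: le_trans sJ1; exact: sumr_ge0.
have sJ2 : \sum_(k <- J2) c k <= eps.
  have [e|fs'0] := eqVneq fs' [::]; first by rewrite /J2 e big_nil.
  have S' : schreier (\sum_(j <- js) n j) [seq minsupp F.1 | F <- fs'].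
    apply: (schreier_subseq Sfs); first exact: map_subseq (filter_subseq _ _).
    by case: (fs') fs'0.
  have [||st St] := schreier_index S' bS (g := kappa).
  - have : all (fun F => touches (x (kappa F)) F.1) fs' by exact: filter_all.
    move: fsf'; elim: (fs') => //= F u IH /andP[/allP Fu pu] /andP[tF tu].
    rewrite IH// andbT; apply/allP => G Gu; rewrite leqNgt; apply/negP => lt.
    have /andP[tG _] := allP tu _ Gu; have /andP[_ tF'] := tF.
    have /andP[FG _] := Fu _ Gu; have := block_seq_precedes xb lt.
    rewrite /precedes ltnNge; move/negP; apply; apply: leq_trans tF' _.
    by apply: leq_trans tG; exact: ltnW.
  - by move=> F; rewrite mem_filter => /andP[/andP[]].
  exact: cn St.
have small k : k \notin J1 -> k \notin J2 -> `|pairing f (x k)| <= tau / w.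
  move=> k1 k2; rewrite /f /weighted_sum pairingZl pairing_suml big_map normrM.
  rewrite -/w [X in X * _]ger0_norm ?invr_ge0 ?(ltW w0)// mulrC.
  apply: ler_wpM2r; first by rewrite invr_ge0 ltW.
  have [[F Ff Fk]|no] := pselect (exists2 F, F \in fs & touches (x k) F.1); last first.
    rewrite big_seq big1 ?normr0// => F Ff; apply: pairing_touches.
    by apply/negP => Fk; apply: no; exists F.
  have gF G : G \in fs -> touches (x k) G.1 -> (g G < k)%N.
    move=> Gf /andP[Gk _]; rewrite ltn_neqAle gmin// andbT.
    by apply: contraNneq k1 => <-; rewrite mem_undup map_f.
  rewrite (bigD1_seq F)//=; last first.
    apply: (pairwise_uniq _ fsf.2) => G.
    by rewrite /fast /precedes ltnNge minsupp_maxsupp.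
  rewrite big_seq_cond big1 ?addr0.
    apply: hk => //; apply: contraNneq k2 => e; rewrite mem_undup e map_f//.
    by rewrite mem_filter -e Fk.
  (* Off [J1], a functional touching x_k begins no later than the end of an earlier vector. Two
     successive functionals cannot both do so, as the first would end before x_k. *)
  have only A C : A \in fs -> C \in fs -> touches (x k) A.1 -> touches (x k) C.1 ->
      precedes A.1 C.1 -> False.
    move=> Af Cf Ak Ck AC; have lt := gF C Cf Ck.
    have /andP[_ xA] := Ak; have := block_seq_precedes xb lt.
    rewrite /precedes ltnNge => /negP; apply; apply: leq_trans xA _.
    by apply: leq_trans (gP C); exact: ltnW.
  move=> G /andP[Gf GF]; apply: pairing_touches; apply/negP => Gk.
  have [lt|lt|e] := ltngtP (index F fs) (index G fs).
  - have := pairwiseP F fsf.2 _ _ _ _ lt; rewrite !inE !index_mem !nth_index//.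
    by move=> /(_ Ff Gf)/andP[FG _]; exact: (only F G).
  - have := pairwiseP F fsf.2 _ _ _ _ lt; rewrite !inE !index_mem !nth_index//.
    by move=> /(_ Gf Ff)/andP[GF' _]; exact: (only G F).
  by move: GF; rewrite -(nth_index F Gf) -e nth_index// eqxx.
rewrite pairing_sumr; apply: le_trans (ler_norm_sum _ _ _) _.
apply: le_trans (_ : \sum_(k <- s) (c k * (tau / w) + (if k \in J1 then c k * B else 0)
    + (if k \in J2 then c k * B else 0)) <= _).
  apply: ler_sum => k _; rewrite pairingZr normrM (ger0_norm (c0 k)).
  have tw : 0 <= tau / w by rewrite divr_ge0// ltW.
  have le : c k * `|pairing f (x k)| <= c k * B.
    apply: ler_wpM2l => //; apply: le_trans (xB k).
    exact: (normr_pairing_le hX (x k) fW).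
  have ct : 0 <= c k * (tau / w) by rewrite mulr_ge0.
  have cB : 0 <= c k * B by rewrite mulr_ge0.
  case: (boolP (k \in J1)) => k1.
    apply: le_trans le _; case: ifP => _; lra.
  case: (boolP (k \in J2)) => k2; first by rewrite addr0; lra.
  by rewrite !addr0; apply: ler_wpM2l => //; exact: small.
rewrite !big_split/= -mulr_suml cs1 mul1r -addrA lerD2l.
have part J : uniq J -> \sum_(k <- J) c k <= eps ->
    \sum_(k <- s) (if k \in J then c k * B else 0) <= B * eps.
  move=> uJ sJ; rewrite -big_mkcond/= -mulr_suml mulrC ler_wpM2l//.
  apply: le_trans sJ; rewrite -big_filter.
  rewrite (perm_big [seq k <- J | k \in s])/=; last first.
    apply: uniq_perm; rewrite ?filter_uniq// ?(sorted_uniq ltn_trans ltnn)//.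
    by move=> k; rewrite !mem_filter andbC.
  by rewrite big_filter [leRHS](bigID (mem s))/= lerDl sumr_ge0.
have := part J1 (undup_uniq _) sJ1; have := part J2 (undup_uniq _) sJ2.
lra.
Qed.

End Estimate.

(** * James' argument: averages in block subspaces *)

Section Averages.
Variables (R : realType) (m n : nat -> nat).
Hypothesis hmn : parameters R m n.
Variables (X : completeNormedModType R) (iota : {linear c00 R -> X}).
Hypothesis hX : is_XD m n iota.
Local Notation wfun := (wfun R).
Local Notation inW := (@inW R m n).
Local Notation N x := (`|iota x|).
Implicit Types (x z : nat -> c00 R) (F G : wfun) (fs : seq wfun) (js : seq nat).

Definition tail_span z (K : nat) (y : c00 R) : Prop :=
  exists (M : nat) (a : nat -> R),
    (forall i, ~~ (K <= i < M)%N -> a i = 0) /\ y = \sum_(i < M) a i *: z i.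

Lemma tail_span_widen z K M M' (a : nat -> R) : (M <= M')%N ->
  (forall i, ~~ (K <= i < M)%N -> a i = 0) ->
  \sum_(i < M') a i *: z i = \sum_(i < M) a i *: z i.
Proof.
move=> MM a0; rewrite -!(big_mkord xpredT (fun i => a i *: z i)).
rewrite (big_cat_nat _ (n := M))//= [X in _ + X]big_nat [X in _ + X]big1 ?addr0//.
by move=> i /andP[Mi _]; rewrite a0 ?scale0r// negb_and -leqNgt Mi orbT.
Qed.

Lemma tail_span0 z K : tail_span z K 0.
Proof. by exists 0%N, (fun=> 0); rewrite big_ord0. Qed.

Lemma tail_spanD z K u v : tail_span z K u -> tail_span z K v -> tail_span z K (u + v).
Proof.
move=> [M [a [a0 ->]]] [L [b [b0 ->]]].
exists (maxn M L), (fun i => a i + b i); split.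
  move=> i h; rewrite a0 ?b0 ?addr0//; apply: contra h => /andP[-> h]/=; apply: leq_trans h _.
    exact: leq_maxr.
  exact: leq_maxl.
rewrite -(tail_span_widen z (leq_maxl M L) a0) -(tail_span_widen z (leq_maxr M L) b0).
by rewrite -big_split; apply: eq_bigr => i _; rewrite scalerDl.
Qed.

Lemma tail_spanZ z K c u : tail_span z K u -> tail_span z K (c *: u).
Proof.
move=> [M [a [a0 ->]]]; exists M, (fun i => c * a i); split.
  by move=> i /a0 ->; rewrite mulr0.
by rewrite scaler_sumr; apply: eq_bigr => i _; rewrite scalerA.
Qed.

Lemma tail_span_sum z K (I : eqType) (r : seq I) (F : I -> c00 R) :
  (forall i, i \in r -> tail_span z K (F i)) -> tail_span z K (\sum_(i <- r) F i).
Proof.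
move=> FP; rewrite big_seq; elim/big_ind: _ => //; first exact: tail_span0.
by move=> u v; exact: tail_spanD.
Qed.

Lemma tail_spanW z K K' u : (K' <= K)%N -> tail_span z K u -> tail_span z K' u.
Proof.
move=> KK [M [a [a0 ->]]]; exists M, a; split=> // i h; apply: a0.
by apply: contra h => /andP[h ->]; rewrite (leq_trans KK h).
Qed.

Lemma tail_span_mem z k : tail_span z k (z k).
Proof.
exists k.+1, (fun i => (i == k)%:R); split.
  by move=> i; case: eqVneq => // ->; rewrite leqnn ltnSn.
rewrite big_ord_recr/= eqxx scale1r big1 ?add0r// => i _.
by rewrite (ltn_eqF (ltn_ord i)) scale0r.
Qed.

Lemma tail_span_trans z x K u : (forall k, tail_span z k (x k)) ->
  tail_span x K u -> tail_span z K u.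
Proof.
move=> xz [M [a [a0 ->]]].
rewrite -(big_mkord xpredT (fun i => a i *: x i)).
apply: tail_span_sum => i _.
have [Ki|iK] := leqP K i; first exact/tail_spanZ/(tail_spanW Ki).
by rewrite a0 ?scale0r ?negb_and -?ltnNge ?iK//; exact: tail_span0.
Qed.

Lemma tail_span_minsupp z K u : block_seq z -> tail_span z K u -> u != 0 ->
  (minsupp (z K) <= minsupp u)%N.
Proof.
move=> zb [M [a [a0 ->]]] /minsupp_neq0; set i := minsupp _.
apply: contraNleq => iK; apply/eqP; rewrite c00_sum big1// => k _; rewrite c00_Z.
have [Kk|kK] := leqP K k; last by rewrite a0 ?mul0r// negb_and -ltnNge kK.
rewrite (@eq0_lt_minsupp R (z k) i) ?mulr0//; apply: leq_trans iK _.
move: Kk; rewrite leq_eqVlt => /predU1P[<-//|/(block_seq_precedes zb)/ltnW].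
exact: leq_trans (minsupp_maxsupp _).
Qed.

Lemma block_minsupp_gt z k : block_seq z -> (k < minsupp (z k))%N.
Proof. by move=> zb; exact: (interlaced_le_id (block_interlaced zb)). Qed.

Lemma inW_decomposition F : inW F ->
  (exists i, F.2 = [::] /\ forall y : c00 R, `|pairing F.1 y| = `|y i|) \/ exists fs,
  [/\ decomposition m n F.2 fs, forall G, G \in fs -> inW G &
     F.1 = weighted_sum m F.2 [seq G.1 | G <- fs]].
Proof.
move: F; apply: inW_ind => [i i0|i i0|js fs d fsW].
- by left; exists i; split=> // x; rewrite pairing_unit_vec.
- by left; exists i; split=> // x; rewrite pairingNl normrN pairing_unit_vec.
by right; exists fs; split=> // G /fsW[].
Qed.

(** The weight is at least 100^l, so l is at most 2 log(m_j) / log(100); the sum is then at most l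
    n_{j-1}, and the growth condition on (n_j) applies with a factor 2 to spare. *)
Lemma sum_n_lt js j : index_vector js -> (forall i, i \in js -> (i < j)%N) ->
  (\prod_(i <- js) m i < m j ^ 2)%N -> (\sum_(i <- js) n i < n j)%N.
Proof.
move=> jsP; case: j => [|j] jsj wj.
  by case: jsP; case: js jsj {wj} => // i js /(_ i (mem_head _ _)).
have j0 : (0 < j)%N.
  case: jsP jsj => + jsP; case: js jsP {wj} => // i js jsP _ jsj.
  exact: leq_trans (jsP i (mem_head _ _)) (jsj i (mem_head _ _)).
have [_ _ _ _ hn] := hmn; have {hn} := hn j j0.
have le : (\sum_(i <- js) n i <= size js * n j)%N.
  rewrite -sum1_size big_distrl/= big_seq [leqRHS]big_seq; apply: leq_sum => i ijs.
  by rewrite mul1n; apply: (n_le hmn); [exact: jsP.2 | rewrite -ltnS; exact: jsj].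
have m1 : 0 < (m j.+1)%:R :> R by rewrite ltr0n (m_gt0 hmn).
have l100 : 0 < ln (100 : R) by rewrite ln_gt0// ltr1n.
have lm : 0 < ln (m j.+1)%:R :> R by rewrite ln_gt0// ltr1n (leq_trans _ (m_ge100 hmn (ltn0Sn j))).
have l2 : (size js)%:R * ln (100 : R) < 2 * ln (m j.+1)%:R.
  rewrite mulr_natl -lnXn// [ltRHS]mulr_natl -lnXn// ltr_ln ?posrE ?exprn_gt0//.
  by rewrite -!natrX ltr_nat; apply: leq_ltn_trans (weight_ge_exp hmn jsP) wj.
move=> hn; rewrite -(ltr_nat R); apply: le_lt_trans hn.
apply: (@le_trans _ _ ((size js)%:R * (n j)%:R)); first by rewrite -natrM ler_nat.
have : (size js)%:R <= 2 / ln 100 * ln (m j.+1)%:R :> R.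
  by rewrite mulrAC ler_pdivlMr// ltW.
have nj : 0 <= (n j)%:R :> R by [].
move=> /(ler_wpM2r nj) /le_trans; apply.
rewrite mulrAC; apply: ler_wpM2r; first exact: ltW.
apply: ler_wpM2r => //; apply: ler_wpM2r; first by rewrite invr_ge0 ltW.
lra.
Qed.

Lemma big_support (V : nmodType) (L s : seq nat) (f : nat -> V) :
  uniq L -> uniq s -> {subset s <= L} -> (forall l, l \notin s -> f l = 0) ->
  \sum_(l <- L) f l = \sum_(l <- s) f l.
Proof.
move=> uL us sL f0; rewrite (bigID (mem s))/= [X in _ + X]big1 ?addr0//.
rewrite -big_filter; apply: perm_big; apply: uniq_perm => //; first exact: filter_uniq.
by move=> l; rewrite mem_filter; case: (boolP (l \in s)) => // /sL.
Qed.

Definition is_average (j : nat) (y : c00 R) : Prop :=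
  N y = 1 /\ forall F, inW F -> (\prod_(i <- F.2) m i < m j)%N ->
    `|pairing F.1 y| <= 30 / (\prod_(i <- F.2) m i)%N%:R.

Local Notation sc x := (special_convex (fun k => minsupp (x k)) (fun k => maxsupp (x k))).

(** For w < m_j the combination is estimated by 1/w + 2/m_j <= 3/w, and normalizing costs at most
    10; hence the 30. *)
Lemma convex_average x j s c : block_seq x -> (forall k, N (x k) = 1) -> (0 < j)%N ->
  sc x (n j) (m j)%:R^-1 s c -> 1 / 10 <= N (\sum_(k <- s) c k *: x k) ->
  is_average j ((N (\sum_(k <- s) c k *: x k))^-1 *: \sum_(k <- s) c k *: x k).
Proof.
move=> xb x1 j0 S; set u := \sum_(k <- s) _ => u1.
have u0 : 0 < N u by lra.
have nu : N ((N u)^-1 *: u) = 1.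
  by rewrite linearZ normrZ gtr0_norm ?invr_gt0// mulVf// gt_eqF.
split=> // F FW; case: (inW_decomposition FW) => [[i [-> _]]|[fs [fsd fsW FE]]].
  rewrite big_nil divr1 => _; have := normr_pairing_le hX ((N u)^-1 *: u) FW.
  by rewrite nu; lra.
set w := (\prod_(i <- F.2) m i)%N => wj.
have [jsP _ _ _] := fsd.
have w0 : 0 < w%:R :> R by rewrite ltr0n (weight_gt0 hmn).
have jsj i : i \in F.2 -> (i < j)%N.
  move=> iF; rewrite ltnNge; apply/negP => /(m_le hmn j0).
  by rewrite leqNgt (leq_ltn_trans (weight_ge_m hmn jsP iF) wj).
have wj2 : (w < m j ^ 2)%N by apply: leq_trans wj _; rewrite leq_pmulr// (m_gt0 hmn).
have FW' : inW (weighted_sum m F.2 [seq G.1 | G <- fs], F.2).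
  by rewrite -FE -surjective_pairing.
have x1' k : N (x k) <= 1 by rewrite x1.
(* The trivial bound [tau] = 1 holds at all vectors, so any [kappa] will do. *)
have := special_convex_estimate hmn hX xb x1' ler01 S fsd fsW FW'
  (sum_n_lt jsP jsj wj2) (kappa := fun=> 0%N).
rewrite -FE -/u -/w => /(_ _)E.
have {E} : `|pairing F.1 u| <= 1 / w%:R + 2 * 1 * (m j)%:R^-1.
  by apply: E => G k Gf _; rewrite -(x1 k); exact: (normr_pairing_le hX _ (fsW G Gf)).
rewrite pairingZr normrM (gtr0_norm (x := (N u)^-1)) ?invr_gt0// => le.
have wm : (m j)%:R^-1 <= w%:R^-1 :> R.
  have mj0 : 0 < (m j)%:R :> R by rewrite ltr0n (m_gt0 hmn).
  by rewrite lef_pV2 ?posrE// ler_nat ltnW.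
rewrite mulrC ler_pdivrMr//; apply: le_trans le _.
have iw : 0 < w%:R^-1 :> R by rewrite invr_gt0.
by nra.
Qed.

Lemma special_convex_neq0 x N0 eps s c k : block_seq x -> sc x N0 eps s c -> k \in s ->
  forall i, x k i != 0 -> (\sum_(k <- s) c k *: x k) i != 0.
Proof.
move=> xb [ss _ cs _ _] ks i xi.
rewrite c00_sum (bigD1_seq k)//=; last exact: sorted_uniq ltn_trans ltnn _ ss.
rewrite big1 ?addr0.
  by rewrite mulf_neq0//; have := cs k; rewrite ks => /lt0r_neq0.
move=> l lk; change (c l * x l i = 0); have [kl|kl|e] := ltngtP k l; last by rewrite e eqxx in lk.
  by rewrite (precedes_eq0 (block_seq_precedes xb kl) xi) mulr0.
by rewrite (precedes_eq0r (block_seq_precedes xb kl) xi) mulr0.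
Qed.

(* James' argument: either some average has norm at least 1/10, or normalizing
   the averages improves the lower estimate by the factor 10. *)
Lemma average_or_improve x j t B K : block_seq x -> (forall k, N (x k) = 1) -> (0 < j)%N ->
  lower_estimate iota (n j + t) B x ->
  (exists y, tail_span x K y /\ is_average j y) \/
  exists x', [/\ block_seq x', forall k, N (x' k) = 1, forall k, tail_span x k (x' k) &
    lower_estimate iota t (B / 10) x'].
Proof.
move=> xb x1 j0 lx.
have m0 : 0 < (m j)%:R^-1 :> R by rewrite invr_gt0 ltr0n (m_gt0 hmn).
pose avg (sc : seq nat * (nat -> R)) := \sum_(k <- sc.1) sc.2 k *: x k.
pose good L (p : seq nat * (nat -> R)) := sc x (n j) (m j)%:R^-1 p.1 p.2 /\
  forall k, k \in p.1 -> (L <= k)%N.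
have span L p : good L p -> tail_span x L (avg p).
  move=> [_ pL]; apply: tail_span_sum => k /pL Lk.
  exact/tail_spanZ/(tail_spanW Lk)/tail_span_mem.
have [[p [gp p1]]|no] := pselect (exists p, good K p /\ 1 / 10 <= N (avg p)).
  left; exists ((N (avg p))^-1 *: avg p); split; first exact/tail_spanZ/span.
  by apply: convex_average => //; exact: gp.1.
right; have [p pP] : exists p : nat -> seq nat * (nat -> R), forall L, good (maxn K L) (p L).
  have [|p pP] := @choice _ _ (fun L p => good (maxn K L) p); last by exists p.
  move=> L; have [s [c sP]] := exists_special_convex (block_interlaced xb) (n j) (maxn K L) m0.
  by exists (s, c).
have goodL L : good L (p L) by have [? h] := pP L; split=> // k /h; rewrite geq_max => /andP[].
have small L : N (avg (p L)) < 1 / 10.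
  rewrite ltNge; apply/negP => p1; apply: no; exists (p L); split=> //.
  by have [? h] := pP L; split=> // k /h; rewrite geq_max => /andP[].
have p0 L : (p L).1 != [::].
  by have [[_ S _ _ _] _] := pP L; have := schreier_neq0 S; case: (p L).1.
have hp L : head 0%N (p L).1 \in (p L).1.
  by have := p0 L; case: (p L).1 => // ? ? _; exact: mem_head.
have supp L k i : k \in (p L).1 -> x k i != 0 -> avg (p L) i != 0.
  by move=> kp; exact: (special_convex_neq0 xb (goodL L).1 kp).
have xk k : x k != 0 := block_seq_neq0 k xb.
have pos L : 0 < N (avg (p L)).
  apply: (norm_gt0 hX); apply: contraTneq (minsupp_neq0 (xk (head 0%N (p L).1))) => e.
  by apply/negP => /(supp L _ _ (hp L)); rewrite e eqxx.
pose y L := (N (avg (p L)))^-1 *: avg (p L).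
have yi L k i : k \in (p L).1 -> x k i != 0 -> y L i != 0.
  by move=> kp /(supp _ _ _ kp) h; rewrite c00_Z mulf_neq0// invr_neq0// gt_eqF.
have y0 L : y L != 0.
  apply: contraTneq (minsupp_neq0 (xk (head 0%N (p L).1))) => e.
  by apply/negP => /(yi L _ _ (hp L)); rewrite e eqxx.
have [a|r rP] := @exists_subsequence (fun a i => (maxsupp (y a) < i)%N /\
    forall k, k \in (p a).1 -> (k < i)%N).
  exists (maxn a (maxn (maxsupp (y a)) (\max_(k <- (p a).1) k))).+1.
    by rewrite ltnS leq_maxl.
  split; first by rewrite ltnS leq_max leq_maxl orbT.
  move=> k kp; rewrite ltnS leq_max (leq_trans _ (leq_maxr _ _)) ?orbT//.
  by rewrite (big_rem k)//= leq_maxl.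
have rS k : (r k < r k.+1)%N by have [] := rP k.
have ry k : tail_span x (r k) (y (r k)) by exact/tail_spanZ/span.
have rid k : (k <= r k)%N.
  by elim: k => // k IH; exact: leq_ltn_trans IH (rS k).
exists (y \o r); split.
- move=> k; split=> //=; apply: leq_trans (tail_span_minsupp xb (ry k.+1) (y0 _)).
  by have [_ [h _]] := rP k; exact: ltn_trans h (block_minsupp_gt _ xb).
- by move=> k; rewrite /= linearZ normrZ gtr0_norm ?invr_gt0// mulVf// gt_eqF.
- by move=> k; exact: (tail_spanW (rid k)).
move=> T c sT ST c0 /=.
pose s k := (p (r k)).1; pose L := flatten [seq s k | k <- T].
(* Coefficients of the given combination when the averages are expanded in the [x l]. Their support
   is a convolution set of level n_j + t, so the hypothesis on [x] applies. *)
pose d l := \sum_(k <- T) c k / N (avg (p (r k))) * (p (r k)).2 l.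
have ssort k : sorted ltn (s k) by have [[]] := goodL (r k).
have cross k l a b : (k < l)%N -> a \in s k -> b \in s l -> (a < b)%N.
  move=> kl ak bl; have [_ [_ /(_ _ ak) h]] := rP k.
  have [_ /(_ _ bl)] := goodL (r l); apply: leq_trans; apply: leq_trans h _.
  by move: kl; rewrite leq_eqVlt => /predU1P[->//|/(lt_subsequence rS)/ltnW].
have sL : sorted ltn L.
  rewrite /L; elim: T sT {ST L d} => //= k T IH kT.
  rewrite (sorted_pairwise ltn_trans) pairwise_cat -!(sorted_pairwise ltn_trans).
  rewrite IH ?(path_sorted kT)// ssort !andbT.
  apply/allrelP => a b ak /flattenP[_ /mapP[l lT ->]]; apply: cross ak.
  by move: kT; rewrite (path_sortedE ltn_trans) => /andP[/allP/(_ _ lT)].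
have sub k : k \in T -> {subset s k <= L}.
  by move=> kT l ls; apply/flattenP; exists (s k) => //; exact: map_f.
have uL := sorted_uniq ltn_trans ltnn sL.
have us k := sorted_uniq ltn_trans ltnn (ssort k).
have off k l : l \notin s k -> (p (r k)).2 l = 0.
  by have [[_ _ cs _ _] _] := goodL (r k); move=> ls; have := cs l; rewrite (negbTE ls).
have sumd : \sum_(l <- L) d l = \sum_(k <- T) c k / N (avg (p (r k))).
  rewrite exchange_big big_seq [RHS]big_seq; apply: eq_bigr => k kT.
  rewrite -mulr_sumr (big_support uL (us k) (sub k kT)); last exact: off.
  by have [[_ _ _ -> _] _] := goodL (r k); rewrite mulr1.
have vecd : \sum_(l <- L) d l *: x l = \sum_(k <- T) c k *: y (r k).
  under eq_bigr do rewrite scaler_suml.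
  rewrite exchange_big big_seq [RHS]big_seq; apply: eq_bigr => k kT /=.
  under eq_bigr do rewrite -scalerA.
  rewrite -scaler_sumr (big_support uL (us k) (sub k kT)); last first.
    by move=> l /off ->; rewrite scale0r.
  by rewrite scalerA.
have d0 l : 0 <= d l.
  apply: sumr_ge0 => k _; rewrite mulr_ge0// ?divr_ge0//.
  by have [[_ _ cs _ _] _] := goodL (r k); have := cs l; case: ifP => [_ /ltW|_ ->].
have SL : schreier (n j + t) [seq minsupp (x l) | l <- L].
  rewrite map_flatten -map_comp; apply: schreier_flatten.
  - by move=> _ /mapP[k _ ->]; have [[]] := goodL (r k).
  - rewrite map_comp -map_flatten sorted_map; apply: sub_sorted sL => k l kl /=.
    exact: leq_ltn_trans (minsupp_maxsupp _) (block_seq_precedes xb kl).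
  rewrite -map_comp.
  have eh k : head 0%N [seq minsupp (x l) | l <- s k] = minsupp (x (head 0%N (s k))).
    by have := p0 (r k); rewrite -/(s k); case: (s k).
  rewrite (eq_map (g := fun k => minsupp (x (head 0%N (s k))))); last exact: eh.
  apply: (schreier_spread ST (subseq_refl _)).
  - by have := schreier_neq0 ST; case: (T).
  - rewrite sorted_map; apply: sub_sorted sT => k l kl /=.
    have := cross _ _ _ _ kl (hp (r k)) (hp (r l)) => /(block_seq_precedes xb).
    exact: leq_ltn_trans (minsupp_maxsupp _).
  by move=> k _; apply/minsupp_le/(yi _ _ _ (hp (r k)))/minsupp_neq0.
have := lx L d sL SL d0; rewrite sumd vecd => le.
have : 10 * \sum_(k <- T) c k <= \sum_(k <- T) c k / N (avg (p (r k))).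
  rewrite mulr_sumr; apply: ler_sum => k _; rewrite mulrC; apply: ler_wpM2l => //.
  rewrite -[10]invrK lef_pV2 ?posrE ?invr_gt0//.
  by have := small (r k); rewrite div1r => /ltW.
by move=> h; have := le_trans h le; lra.
Qed.

Lemma schreier_singleton t i : (0 < i)%N -> schreier t [:: i].
Proof.
move=> i0; elim: t => [|t IH]; first by exists i.
by apply/schreierS; exists [:: [:: i]]; split=> // G; rewrite inE => /eqP ->.
Qed.

(** The start is the lower estimate at level n_{j+1} with constant 2 m_{j+1}. If no average
    appeared, i improvements would use i n_j <= n_{j+1} levels and leave a constant below 1. *)
Lemma exists_average z j K : block_seq z -> (forall k, N (z k) = 1) -> (0 < j)%N ->
  exists y, tail_span z K y /\ is_average j y.
Proof.
move=> zb z1 j0.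
have iter : forall i t B x, block_seq x -> (forall k, N (x k) = 1) ->
    (forall k, tail_span z k (x k)) ->
    lower_estimate iota (i * n j + t) B x -> B / 10 ^+ i < 1 ->
    exists y, tail_span z K y /\ is_average j y.
  elim=> [|i IH] t B x xb x1 xz lx B1.
    (* Singletons are admissible at every level, so a constant below 1 contradicts the norm of one
       vector. *)
    exfalso; have := lx [:: 0%N] (fun=> 1) isT.
    rewrite !big_seq1 scale1r x1 mulr1 => h.
    have := h (schreier_singleton _ (minsupp_gt0 (block_seq_neq0 0 xb))) (fun=> ler01).
    by move=> B1'; move: B1; rewrite expr0 divr1 ltNge B1'.
  rewrite mulSn -addnA in lx.
  have [[y [ys ya]]|[x' [xb' x1' xs' lx']]] := average_or_improve K xb x1 j0 lx.
    by exists y; split=> //; exact: tail_span_trans xz ys.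
  apply: (IH t (B / 10) x') => //; first by move=> k; exact: tail_span_trans xz _.
  by rewrite -mulrA -invfM -exprS.
have [s sS sP] := exists_lower_estimate hmn hX zb z1.
have sid k : (k <= s k)%N.
  by elim: k => // k IH; exact: leq_ltn_trans IH (sS k).
have m0 : 0 < (m j.+1)%:R :> R by rewrite ltr0n (m_gt0 hmn).
have m100 : 100 <= (m j.+1)%:R :> R by rewrite ler_nat (m_ge100 hmn).
have exi : exists i, (2 * m j.+1 < 10 ^ i)%N by exists (2 * m j.+1)%N; exact: ltn_expl.
case: (ex_minnP exi) => i iP imin.
have in_le : (i * n j <= n j.+1)%N.
  case: i iP imin => [|i] iP imin; first by rewrite mul0n.
  have le : (10 ^ i <= 2 * m j.+1)%N by rewrite leqNgt; apply/negP => /imin; rewrite ltnn.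
  have [_ _ _ _ hn] := hmn; have {hn}hn := hn j j0.
  rewrite -(ler_nat R) natrM; apply: ltW; apply: le_lt_trans hn.
  have l10 : 0 < ln (10 : R) by rewrite ln_gt0// ltr1n.
  have e100 : ln (100 : R) = ln 10 * 2.
    by rewrite mulr_natr -lnXn//; congr ln; rewrite -natrX.
  (* Minimality gives 10^i <= 2 m_{j+1}, and 20 m <= m^2 for m >= 100. Since log(100) = 2 log(10),
     this is where the constant 4 / log(100) of the parameters is needed. *)
  have le2 : i.+1%:R * ln (10 : R) <= 2 * ln (m j.+1)%:R.
    rewrite mulr_natl -lnXn// [leRHS]mulr_natl -lnXn// ler_ln ?posrE ?exprn_gt0//.
    rewrite exprS; move: le; rewrite -(ler_nat R) natrX natrM => le.
    by rewrite expr2; nra.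
  have le3 : i.+1%:R <= 4 / ln 100 * ln (m j.+1)%:R :> R.
    by rewrite e100 mulrAC ler_pdivlMr ?mulr_gt0// mulrA; lra.
  rewrite [leRHS]mulrAC; exact: ler_wpM2r.
apply: (iter i (n j.+1 - i * n j)%N (2 * (m j.+1)%:R) (z \o s)).
- exact: block_seq_subseq.
- by move=> k; exact: z1.
- by move=> k; exact: (tail_spanW (sid k) (tail_span_mem _ _)).
- by rewrite subnKC//; exact: sP.
by rewrite ltr_pdivrMr ?exprn_gt0// mul1r -natrX -natrM ltr_nat.
Qed.

End Averages.

(** * Rapidly increasing sequences and exact vectors *)

Section ExactVectors.
Variables (R : realType) (m n : nat -> nat).
Hypothesis hmn : parameters R m n.
Variables (X : completeNormedModType R) (iota : {linear c00 R -> X}).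
Hypothesis hX : is_XD m n iota.
Local Notation wfun := (wfun R).
Local Notation inW := (@inW R m n).
Local Notation N x := (`|iota x|).
Implicit Types (x z : nat -> c00 R) (F G : wfun) (fs : seq wfun) (js : seq nat).

(* Only functionals whose largest weight is m_j, or that have a component of
   small weight, are not small at an exact vector. *)
Definition exact_vector (j : nat) (y : c00 R) : Prop :=
  [/\ N y = 1, forall i, `|y i| <= 70 / (m j)%:R
    & forall js fs, decomposition m n js fs -> (forall F, F \in fs -> inW F) ->
        inW (weighted_sum m js [seq F.1 | F <- fs], js) ->
        (\max_(i <- js) i)%N != j ->
        (forall F, F \in fs -> ((2 ^ minsupp y)%N%:R%:E <= weight m F)%E) ->
        `|pairing (weighted_sum m js [seq F.1 | F <- fs]) y| <= 70 / (m j)%:R].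

Local Notation sc x := (special_convex (fun k => minsupp (x k)) (fun k => maxsupp (x k))).

(* Rapidly increasing sequences of averages: L bounds the weights for which the
   average estimate holds. *)
Definition ris (j : nat) (L : nat -> nat) x : Prop :=
  [/\ block_seq x, forall k, N (x k) = 1,
      forall k F, inW F -> (\prod_(i <- F.2) m i < L k)%N ->
        `|pairing F.1 (x k)| <= 30 / (\prod_(i <- F.2) m i)%N%:R,
      {homo L : k l / (k <= l)%N}
    & forall k, ((maxsupp (x k)).+1 * m j ^ 2 <= L k.+1)%N].

(** [y i] is an average for the index [J i], and m_{J i} >= J i > i m_j^2. Choosing the next i
    beyond the preceding support gives the growth, which the further thinning for the lower estimate
    preserves. *)
Lemma exists_ris z j K : block_seq z -> (forall k, N (z k) = 1) -> (0 < j)%N ->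
  exists L x, [/\ ris j L x, forall k, tail_span z K (x k) &
    lower_estimate iota (n j) (2 * (m j)%:R) x].
Proof.
move=> zb z1 j0; pose J i := (i * m j ^ 2).+1.
have JS : {homo J : k l / (k <= l)%N} by move=> k l kl; rewrite ltnS leq_mul.
have [y yP] := choice (fun i => exists_average hmn hX (maxn K i) zb z1 (ltn0Sn (i * m j ^ 2))).
have y0 i : y i != 0.
  apply: contra_eq_neq (proj1 (yP i).2) => ->.
  by rewrite linear0 normr0 eq_sym oner_neq0.
have yK i : tail_span z K (y i) by exact: tail_spanW (leq_maxl _ _) (yP i).1.
have yi i : tail_span z i (y i) by exact: tail_spanW (leq_maxr _ _) (yP i).1.
have [a|r rP] := @exists_subsequence (fun a i => (maxsupp (y a) < i)%N).
  by exists (maxn a (maxsupp (y a))).+1; rewrite ltnS ?leq_maxl ?leq_maxr.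
have rS k : (r k < r k.+1)%N by have [] := rP k.
have yb : block_seq (y \o r).
  move=> k; split=> //=; apply: leq_trans (tail_span_minsupp zb (yi (r k.+1)) (y0 _)).
  by have [_ h] := rP k; exact: ltn_trans h (block_minsupp_gt _ zb).
have yn k : N ((y \o r) k) = 1 by exact: (proj1 (yP (r k)).2).
have [s sS sP] := exists_lower_estimate hmn hX yb yn.
have rm k l : (k <= l)%N -> (r k <= r l)%N.
  by rewrite leq_eqVlt => /predU1P[->//|/(lt_subsequence rS)/ltnW].
have sm k l : (k <= l)%N -> (s k <= s l)%N.
  by rewrite leq_eqVlt => /predU1P[->//|/(lt_subsequence sS)/ltnW].
exists (fun k => m (J (r (s k)))), ((y \o r) \o s); split.
- split.
  + exact: block_seq_subseq.
  + by move=> k; exact: yn.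
  + by move=> k F FW wF; exact: (proj2 (yP (r (s k))).2).
  + by move=> k l kl; apply: (m_le hmn) => //; apply/JS/rm/sm.
  move=> k; apply: leq_trans (m_ge_id hmn (ltn0Sn _)); apply: leqW; rewrite leq_mul2r.
  have [_ h] := rP (s k); apply/orP; right; apply: leq_trans h _; exact: rm.
- by move=> k; exact: yK.
exact: sP.
Qed.

(** The exceptional index is the first k with w < L (k+1). Before it, w dominates the support of x_k
    and [pairing_le_weight] applies; after it, w is small enough for the estimate of averages. *)
Lemma ris_pairing j L x F (B : nat) : (0 < j)%N -> ris j L x -> inW F -> (0 < B)%N ->
  ((B%:R : R)%:E <= weight m F)%E ->
  exists k0, forall k, k != k0 -> `|pairing F.1 (x k)| <= 30 / B%:R + ((m j)%:R ^+ 2)^-1.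
Proof.
move=> j0 [xb x1 xL LS Lx] FW B0 BF.
have m0 : 0 < (m j)%:R :> R by rewrite ltr0n (m_gt0 hmn).
have im0 : 0 <= ((m j)%:R ^+ 2)^-1 :> R by rewrite invr_ge0 exprn_ge0// ltW.
have B0' : 0 < B%:R :> R by rewrite ltr0n.
have iB : 0 <= 30 / B%:R :> R by rewrite divr_ge0// ltW.
case: (inW_decomposition FW) => [[i [_ Fi]]|[fs [[jsP _ _ _] _ _]]].
  have zero k : x k i = 0 -> `|pairing F.1 (x k)| <= 30 / B%:R + ((m j)%:R ^+ 2)^-1.
    by move=> xi; rewrite Fi xi normr0 addr_ge0.
  have [[k0 xk0]|no] := pselect (exists k0, x k0 i != 0); last first.
    exists 0%N => k _; apply: zero; apply/eqP/negPn/negP => xk; by apply: no; exists k.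
  exists k0 => k kk0; apply: zero; have [lt|lt|e] := ltngtP k k0.
  - exact: precedes_eq0r (block_seq_precedes xb lt) xk0.
  - exact: precedes_eq0 (block_seq_precedes xb lt) xk0.
  by rewrite e eqxx in kk0.
set w := (\prod_(i <- F.2) m i)%N in xL *.
have w0 : (0 < w)%N := weight_gt0 hmn jsP.
have w0' : 0 < w%:R :> R by rewrite ltr0n.
have Bw : (B <= w)%N.
  move: BF; rewrite /weight /w; case: (F.2) jsP => [[]//|i js _].
  by rewrite lee_fin ler_nat.
have Lid k : (k < L k.+1)%N.
  apply: leq_trans (Lx k); rewrite -[X in (X < _)%N]muln1 ltn_mul// ?ltnS.
    by rewrite (leq_trans (ltnW (block_minsupp_gt k xb)))// minsupp_maxsupp.
  have m1 := m_ge100 hmn j0; rewrite -{1}(exp1n 2) ltn_exp2r//; exact: leq_trans m1.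
have exk : exists k, (w < L k.+1)%N by exists w.
exists (ex_minn exk); case: ex_minnP => k0 wk0 kmin k; rewrite neq_ltn => /orP[kk0|kk0].
  have wL : (L k.+1 <= w)%N by rewrite leqNgt; apply/negP => /kmin; rewrite leqNgt kk0.
  have := pairing_le_weight hX (x k) FW; rewrite x1 mulr1 -/w => le.
  apply: le_trans le _; apply: le_trans (_ : ((m j)%:R ^+ 2)^-1 <= _).
    rewrite ler_pdivrMr// ler_pdivlMl ?exprn_gt0//.
    by rewrite -natrX -natrM ler_nat mulnC; apply: leq_trans (Lx k) wL.
  by rewrite lerDr.
apply: le_trans (xL k F FW _) _.
  by apply: leq_trans wk0 _; exact: LS.
apply: le_trans (_ : 30 / B%:R <= _); last by rewrite lerDl.
by rewrite ler_wpM2l// lef_pV2 ?posrE// ler_nat.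
Qed.

(** A normalized (n_j, m_j^{-2}) special convex combination of a rapidly increasing sequence. Its
    norm before normalization is at least 1/(2 m_j), whereas the functionals in question act by
    O(m_j^{-2}). *)
Lemma exists_exact_vector z j K : block_seq z -> (forall k, N (z k) = 1) -> (0 < j)%N ->
  exists y, tail_span z K y /\ exact_vector j y.
Proof.
move=> zb z1 j0.
(* Ensures 30 / 2^(minsupp y) <= m_j^{-2}, needed for the members of large weight. *)
pose K0 := maxn K (30 * m j ^ 2).
have [L [x [xR xK lx]]] := exists_ris K0 zb z1 j0.
have [xb x1 _ _ _] := xR.
have x1' k : N (x k) <= 1 by rewrite x1.
pose M : R := (m j)%:R.
have M100 : 100 <= M by rewrite ler_nat (m_ge100 hmn).
have M0 : 0 < M by lra.
have iM : 0 < M^-1 by rewrite invr_gt0.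
pose eps := (M ^+ 2)^-1.
have eps0 : 0 < eps by rewrite invr_gt0 exprn_gt0.
have epsE : M * eps = M^-1 by rewrite /eps expr2 invfM mulrA divff ?mul1r// gt_eqF.
have [s [c [S _]]] := exists_special_convex (block_interlaced xb) (n j) 0 eps0.
have [ss Ss cs cs1 cn] := S.
have c0 k : 0 <= c k by have := cs k; case: ifP => [_ /ltW|_ ->].
have ceps k : c k <= eps.
  have := cn 0%N [:: k] (n_gt0 hmn j0) isT; rewrite big_seq1; apply.
  apply: schreier_singleton; have [h1 h2 _] := block_interlaced xb k.
  exact: leq_trans h2.
pose u := \sum_(k <- s) c k *: x k.
have Nu : 1 <= 2 * M * N u by have := lx s c ss Ss c0; rewrite cs1.
have Nu0 : 0 < N u by rewrite ltNge; apply/negP => h; nra.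
have iNu : (N u)^-1 <= 2 * M by rewrite -[leLHS]mul1r ler_pdivrMr.
have iNu0 : 0 < (N u)^-1 by rewrite invr_gt0.
pose y := (N u)^-1 *: u.
have u0 : u != 0 by apply: contraTneq Nu0 => ->; rewrite linear0 normr0 ltxx.
have y0 : y != 0 by rewrite scaler_eq0 negb_or u0 andbT gt_eqF.
have yK0 : tail_span z K0 y.
  by apply: tail_spanZ; apply: tail_span_sum => k _; apply: tail_spanZ.
have ymin : (30 * m j ^ 2 <= 2 ^ minsupp y)%N.
  apply: leq_trans (leq_maxr K _) _; apply: leq_trans (ltnW (block_minsupp_gt K0 zb)) _.
  apply: leq_trans (tail_span_minsupp zb yK0 y0) _; exact: ltnW (ltn_expl _ _).
exists y; split; first exact: tail_spanW (leq_maxl _ _) yK0.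
(* Normalizing costs at most 2 m_j, and 2 m_j times 35 m_j^{-2} is 70 / m_j. The uses below have d =
   1, 32 and 4. *)
have bound r d : 0 <= r -> r <= d * eps -> d <= 35 -> (N u)^-1 * r <= 70 / M.
  move=> r0 rd d35.
  have h1 : (N u)^-1 * r <= 2 * M * r by exact: ler_wpM2r.
  have h2 : 2 * M * r <= 2 * M * (35 * eps).
    apply: ler_wpM2l; first lra.
    by apply: le_trans rd _; apply: ler_wpM2r => //; exact: ltW.
  have h3 : 2 * M * (35 * eps) = 70 / M by rewrite mulrACA epsE; congr (_ * _); lra.
  lra.
split.
- by rewrite /y linearZ normrZ gtr0_norm// mulVf// gt_eqF.
- move=> i; change (`|(N u)^-1 * u i| <= 70 / M); rewrite normrM (gtr0_norm iNu0).
  apply: (bound _ 1) => //; last lra.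
  rewrite mul1r /u c00_sum.
  have [[k ks xi]|no] := pselect (exists2 k, k \in s & x k i != 0); last first.
    rewrite big_seq big1 ?normr0 1?ltW// => k ks; change (c k * x k i = 0).
    rewrite [x k i](_ : _ = 0) ?mulr0//.
    by apply/eqP/negPn/negP => xi; apply: no; exists k.
  rewrite (bigD1_seq k)//=; last exact: sorted_uniq ltn_trans ltnn _ ss.
  rewrite big1 ?addr0.
    change (`|c k * x k i| <= eps); rewrite normrM (ger0_norm (c0 k)).
    apply: le_trans (ceps k); rewrite ler_piMr//.
    by rewrite -(x1 k); exact: (norm_coef hX).
  move=> l lk; change (c l * x l i = 0).
  have [kl|kl|e] := ltngtP k l; last by rewrite e eqxx in lk.
    by rewrite (precedes_eq0 (block_seq_precedes xb kl) xi) mulr0.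
  by rewrite (precedes_eq0r (block_seq_precedes xb kl) xi) mulr0.
move=> js fs fsd fsW fW maxj fsw; set f := weighted_sum _ _ _.
rewrite pairingZr normrM (gtr0_norm iNu0).
have [jsP _ _ _] := fsd.
have w0 : (0 < \prod_(i <- js) m i)%N := weight_gt0 hmn jsP.
have w100 : 100 <= (\prod_(i <- js) m i)%N%:R :> R by rewrite ler_nat (weight_ge100 hmn).
(* A weight of at least m_j^2 allows one exceptional vector, whose coefficient is at most [eps].
   Below m_j^2 all entries of [js] are below j, so the admissibility level is below n_j. *)
have [wbig|wsmall] := leqP (m j ^ 2) (\prod_(i <- js) m i)%N.
  have wt : (((m j ^ 2)%N%:R : R)%:E <= weight m (f, js))%E.
    by case: (js) jsP wbig => [[]//|i js' _]; rewrite lee_fin ler_nat.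
  have mj2 : (0 < m j ^ 2)%N by rewrite expn_gt0 (m_gt0 hmn).
  have [k0 k0P] := ris_pairing j0 xR fW mj2 wt.
  apply: (bound _ 32) => //; last lra.
  rewrite /u pairing_sumr; apply: le_trans (ler_norm_sum _ _ _) _.
  apply: le_trans (_ : \sum_(k <- s) (c k * (31 * eps) + (if k == k0 then c k else 0)) <= _).
    apply: ler_sum => k _; rewrite pairingZr normrM (ger0_norm (c0 k)).
    have e31 : 0 <= c k * (31 * eps) by rewrite mulr_ge0// mulr_ge0// ltW.
    case: eqP => [_|/eqP kk0].
      apply: ler_wpDl => //; rewrite ler_piMr// -(x1 k); exact: (normr_pairing_le hX _ fW).
    rewrite addr0; apply: ler_wpM2l => //; apply: le_trans (k0P k kk0) _.
    by rewrite natrX -/M -/eps; lra.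
  rewrite big_split/= -mulr_suml cs1 mul1r.
  have : \sum_(k <- s) (if k == k0 then c k else 0) <= eps.
    have [ks|ks] := boolP (k0 \in s).
      rewrite (bigD1_seq k0)//= ?eqxx; last exact: sorted_uniq ltn_trans ltnn _ ss.
      by rewrite big1 ?addr0// => k /negbTE ->.
    rewrite big_seq big1 ?ltW// => k ks'; case: eqP => // e; by rewrite -e ks' in ks.
  lra.
(* An entry above j would give weight at least m_{j+1} >= m_j^2; the entry j itself would then be
   the maximum. *)
have jsj i : i \in js -> (i < j)%N.
  have le_j k : k \in js -> (k <= j)%N.
    move=> kjs; rewrite leqNgt; apply/negP => jk.
    have [_ _ _ hm _] := hmn.
    have : (m j ^ 2 <= \prod_(i <- js) m i)%N.
      apply: leq_trans (weight_ge_m hmn jsP kjs); apply: leq_trans (m_le hmn _ jk) => //.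
      by apply: leq_trans (hm j j0); rewrite leq_pmull// expn_gt0 j0.
    by rewrite leqNgt wsmall.
  move=> ijs; apply: leq_ltn_trans (_ : _ <= \max_(i <- js) i)%N _.
    by rewrite (big_rem i)//= leq_maxl.
  rewrite ltn_neqAle maxj/=; apply/bigmax_leqP_seq => k kjs _; exact: le_j.
have exk F : exists k0, F \in fs -> forall k, k != k0 ->
    `|pairing F.1 (x k)| <= 30 / (2 ^ minsupp y)%N%:R + (M ^+ 2)^-1.
  have [Ff|nF] := boolP (F \in fs); last by exists 0%N.
  have [k0 k0P] := ris_pairing j0 xR (fsW F Ff) (expn_gt0 2 _) (fsw F Ff).
  by exists k0 => _; exact: k0P.
have [kappa kP] := choice exk.
have tau0 : 0 <= 2 * eps by rewrite mulr_ge0// ltW.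
have small : 30 / (2 ^ minsupp y)%N%:R + (M ^+ 2)^-1 <= 2 * eps :> R.
  rewrite -/eps [leRHS]mulr_natl mulr2n lerD2r.
  rewrite ler_pdivrMr ?ltr0n ?expn_gt0// mulrC ler_pdivlMr ?exprn_gt0//.
  by rewrite /M -natrX -natrM ler_nat.
have E := special_convex_estimate hmn hX xb x1' tau0 S fsd fsW fW
  (sum_n_lt hmn jsP jsj wsmall) (kappa := kappa).
apply: (bound _ 4); [exact: normr_ge0 | | by rewrite ler_nat].
apply: le_trans (E _) _.
  by move=> F k Ff kk; apply: le_trans (kP F Ff k kk) small.
have h : 2 * eps / (\prod_(i <- js) m i)%N%:R <= 2 * eps.
  rewrite ler_pdivrMr ?ltr0n// ler_peMr//.
  by rewrite ler1n.
apply: le_trans (lerD h (lexx _)) _.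
by rewrite mulr1 -mulrDl -natrD.
Qed.

Lemma has_split (T : eqType) (a : pred T) (s : seq T) : has a s ->
  exists s1 t s2, [/\ s = s1 ++ t :: s2, forall u, u \in s1 -> ~~ a u & a t].
Proof.
elim: s => //= t s IH; case: (boolP (a t)) => [at_ _|nt /= /IH[s1 [u [s2 [-> h au]]]]].
  by exists [::], t, s.
exists (t :: s1), u, s2; split=> // v; rewrite inE => /predU1P[->//|]; exact: h.
Qed.

(** Restricting to the coordinates from the beginning of [fs2] on removes exactly [fs1], so the tail
    is again in W. *)
Lemma decomposition_suffix js fs1 fs2 :
  decomposition m n js (fs1 ++ fs2) ->
  inW (weighted_sum m js [seq F.1 | F <- fs1 ++ fs2], js) -> fs2 != [::] :> seq wfun ->
  decomposition m n js fs2 /\ inW (weighted_sum m js [seq F.1 | F <- fs2], js).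
Proof.
move=> [jsP fsf S cl] fW f2; have sub : subseq fs2 (fs1 ++ fs2) by exact: suffix_subseq.
have ff2 := fast_block_subseq sub fsf.
split.
  split=> //.
    by apply: (schreier_subseq S); [exact: map_subseq | case: (fs2) f2].
  move=> F /(mem_subseq sub)/cl[cs [sz csP]]; exists cs; split=> // G /(mem_subseq sub).
  exact: csP.
have h2 : head (0, [::]) fs2 \in fs2 by case: (fs2) f2 => // ? ? _; exact: mem_head.
set H := head _ _ in h2.
have [/allrelP f12 _ _] : [/\ allrel (fast m) fs1 fs2, pairwise (fast m) fs1
    & pairwise (fast m) fs2] by apply/and3P; rewrite -pairwise_cat; case: fsf.
pose P : pred nat := fun i => (minsupp H.1 <= i)%N.
have e : restr P (weighted_sum m js [seq F.1 | F <- fs1 ++ fs2]) =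
    weighted_sum m js [seq F.1 | F <- fs2].
  rewrite weighted_sum_restr /frestr filter_cat map_cat (_ : [seq F <- fs1 | _] = [::]) /=; last first.
    apply/eqP; rewrite -[_ == _]negbK -has_filter; apply/hasPn => F Ff.
    rewrite negbK; apply/eqP/restr_eq0 => i Pi; apply: eq0_gt_maxsupp.
    by apply: leq_trans Pi; have /andP[] := f12 _ _ Ff h2.
  have id2 F : F \in fs2 -> restr P F.1 = F.1.
    move=> Ff; apply: restr_id => i /minsupp_le; apply: leq_trans.
    exact: fast_block_head ff2 Ff.
  rewrite (_ : [seq F <- fs2 | _] = fs2); last first.
    by apply/all_filterP/allP => F Ff; rewrite id2// ff2.1.
  congr weighted_sum; rewrite -map_comp; apply/eq_in_map => F Ff /=.
  exact: id2.
have H0 := minsupp_neq0 (ff2.1 _ h2).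
rewrite -e; apply: (@inW_restr _ _ _ P (_, js)) => //=; rewrite e.
apply: contra_neq (_ : weighted_sum m js [seq F.1 | F <- fs2] (minsupp H.1) != 0).
  by move=> ->.
rewrite (weighted_sum_coef js ff2 h2 H0) mulf_neq0// invr_neq0// pnatr_eq0 -lt0n.
by rewrite (weight_gt0 hmn).
Qed.

(* Members of the decomposition after the first one acting on y have weight at
   least [2 ^ minsupp y], so that exactness applies to them. *)
Lemma first_active_estimate j y js fs : exact_vector j y -> decomposition m n js fs ->
  (forall F, F \in fs -> inW F) -> inW (weighted_sum m js [seq F.1 | F <- fs], js) ->
  (\max_(i <- js) i)%N != j ->
  exists2 G, G \in fs & `|pairing (weighted_sum m js [seq F.1 | F <- fs]) y| <=
    `|pairing G.1 y| / (\prod_(i <- js) m i)%N%:R + 70 / (m j)%:R.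
Proof.
move=> [_ _ yex] fsd fsW fW jsj; have [jsP fsf Sfs _] := fsd.
have w0 : 0 <= (\prod_(i <- js) m i)%N%:R^-1 :> R by rewrite invr_ge0.
have m0 : 0 <= 70 / (m j)%:R :> R by rewrite divr_ge0.
have zero F : ~~ (minsupp y <= maxsupp F.1)%N -> pairing F.1 y = 0.
  by rewrite -ltnNge => Fy; apply: pairing_disjoint => i /(precedes_eq0 Fy).
have [|no] := boolP (has (fun F => minsupp y <= maxsupp F.1)%N fs); last first.
  have /schreier_neq0 : schreier (\sum_(j <- js) n j) [seq minsupp F.1 | F <- fs] by [].
  case: fs no {fsd fsW fW fsf Sfs} => // G fs no _; exists G; first exact: mem_head.
  rewrite pairingZl pairing_suml big_map [X in _ * X]big_seq [X in _ * X]big1 ?mulr0 ?normr0.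
    by rewrite addr_ge0// mulr_ge0.
  by move=> F Ff; apply: zero; apply: contra no => h; apply/hasP; exists F.
move=> /has_split[fs1 [G [fs2 [efs fs1P Gy]]]].
have Gf : G \in fs by rewrite efs mem_cat mem_head orbT.
exists G => //.
have e : pairing (weighted_sum m js [seq F.1 | F <- fs]) y =
    (\prod_(i <- js) m i)%N%:R^-1 * pairing G.1 y +
    pairing (weighted_sum m js [seq F.1 | F <- fs2]) y.
  rewrite !pairingZl !pairing_suml !big_map efs big_cat big_cons/= mulrDr -mulrDr.
  rewrite [X in X + _]big_seq [X in X + _]big1 ?add0r ?mulrDr//.
  by move=> F /fs1P; exact: zero.
rewrite e; apply: le_trans (ler_normD _ _) _; apply: lerD.
  by rewrite normrM ger0_norm// mulrC.
have [->|f2] := eqVneq fs2 [::].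
  by rewrite /weighted_sum big_nil scaler0 pairing0l normr0.
have efs' : fs = (fs1 ++ [:: G]) ++ fs2 by rewrite -catA.
rewrite efs' in fsd fW; have [d2 W2] := decomposition_suffix fsd fW f2.
apply: yex => //; first by move=> F Ff; apply: fsW; rewrite efs' mem_cat Ff orbT.
move=> F Ff; have /andP[_ wF] : fast m G F.
  have [_] := fsf; rewrite efs' pairwise_cat => /andP[/allrelP h _]; apply: h => //.
  by rewrite mem_cat mem_head orbT.
by apply: le_trans wF; exact: leq_pow2.
Qed.

(** The first active member acts by at most 1, and division by the weight turns this into at most
    1/B. *)
Lemma inexact_estimate j y F (B : nat) : exact_vector j y -> inW F ->
  (\max_(i <- F.2) i)%N != j -> (0 < B)%N -> ((B%:R : R)%:E <= weight m F)%E ->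
  `|pairing F.1 y| <= B%:R^-1 + 70 / (m j)%:R.
Proof.
move=> yex FW Fj B0 BF; have [y1 yi _] := yex.
have B0' : 0 <= B%:R^-1 :> R by rewrite invr_ge0.
case: (inW_decomposition FW) => [[i [_ ->]]|[fs [fsd fsW FE]]].
  exact: ler_wpDl (yi i).
have [jsP _ _ _] := fsd.
have [|G Gf le] := first_active_estimate yex fsd fsW _ Fj.
  by rewrite -FE -surjective_pairing.
rewrite FE; apply: le_trans le _; rewrite lerD2r.
have w0 : 0 < (\prod_(i <- F.2) m i)%N%:R :> R by rewrite ltr0n (weight_gt0 hmn).
rewrite ler_pdivrMr//; apply: le_trans (_ : 1 <= _).
  by rewrite -y1; exact: (normr_pairing_le hX _ (fsW G Gf)).
rewrite ler_pdivlMl ?ltr0n// mulr1 ler_nat.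
move: BF; rewrite /weight; case: (F.2) jsP => [[]//|i js _].
by rewrite lee_fin ler_nat.
Qed.

End ExactVectors.

(** * The enumeration of the tree *)

Section EnumNode.
Implicit Types (k K : nat) (s : node).

Definition nodes_below K : seq node := flatten [seq level h | h <- iota 0 K].

Lemma mem_level h s : (s \in level h) = (size s == h).
Proof.
elim: h s => [|h IH] s; first by rewrite inE size_eq0.
apply/allpairsP/eqP => [[[b t] /= [_ + ->]]|]; first by rewrite IH => /eqP <-.
case: s => // b t [st]; exists (b, t); split=> //=; last by rewrite IH st.
by case: b.
Qed.

Lemma level_uniq h : uniq (level h).
Proof.
elim: h => // h IH; apply: allpairs_uniq => //.
by move=> [b s] [c t] _ _ [-> ->].
Qed.

Lemma level_neq0 h : (0 < size (level h))%N.
Proof.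
have : nseq h true \in level h by rewrite mem_level size_nseq.
by case: (level h).
Qed.

Lemma nodes_belowS K : nodes_below K.+1 = nodes_below K ++ level K.
Proof. by rewrite /nodes_below -{1}addn1 iotaD map_cat flatten_cat /= cats0. Qed.

Lemma mem_nodes_below K s : (s \in nodes_below K) = (size s < K)%N.
Proof.
elim: K => [|K IH]; first by rewrite in_nil.
by rewrite nodes_belowS mem_cat IH mem_level ltnS orbC -leq_eqVlt.
Qed.

Lemma nodes_below_uniq K : uniq (nodes_below K).
Proof.
elim: K => // K IH; rewrite nodes_belowS cat_uniq IH level_uniq andbT/=.
by apply/hasPn => s; rewrite mem_level mem_nodes_below => /eqP ->; rewrite ltnn.
Qed.

Lemma size_nodes_below K : (K <= size (nodes_below K))%N.
Proof.
elim: K => // K IH; rewrite nodes_belowS size_cat -addn1.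
by apply: leq_add => //; exact: level_neq0.
Qed.

Lemma nth_nodes_below K d k : (k < size (nodes_below K))%N ->
  nth [::] (nodes_below (d + K)) k = nth [::] (nodes_below K) k.
Proof.
elim: d => // d IH kK; rewrite addSn nodes_belowS nth_cat IH// ifT//.
apply: leq_trans kK _; elim: d {IH} => // d IH.
by rewrite addSn nodes_belowS size_cat (leq_trans IH)// leq_addr.
Qed.

Lemma enum_nodeE K k : (k < size (nodes_below K))%N ->
  enum_node k = nth [::] (nodes_below K) k.
Proof.
move=> kK; rewrite -[LHS]/(nth [::] (nodes_below k.+1) k).
by rewrite -(@nth_nodes_below _ K) ?size_nodes_below// addnC nth_nodes_below.
Qed.

Lemma enum_node_inj : injective enum_node.
Proof.
move=> k l; pose K := (maxn k l).+1.
have [kK lK] : (k < size (nodes_below K))%N /\ (l < size (nodes_below K))%N.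
  by split; apply: leq_trans (size_nodes_below _); rewrite ltnS ?leq_maxl ?leq_maxr.
rewrite !(@enum_nodeE K)// => /eqP.
by rewrite nth_uniq ?nodes_below_uniq// => /eqP.
Qed.

Lemma enum_node_surj s : exists k, enum_node k = s.
Proof.
have sK : s \in nodes_below (size s).+1 by rewrite mem_nodes_below.
exists (index s (nodes_below (size s).+1)).
by rewrite (@enum_nodeE (size s).+1) ?index_mem// nth_index.
Qed.

Lemma size_enum_node k : (size (enum_node k) <= k)%N.
Proof.
rewrite -ltnS -mem_nodes_below; apply: mem_nth; exact: size_nodes_below.
Qed.

End EnumNode.

(** * The c_0 upper estimate *)

Section UpperEstimate.
Variables (R : realType) (m n : nat -> nat).
Hypothesis hmn : parameters R m n.
Variables (X : completeNormedModType R) (iota : {linear c00 R -> X}).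
Hypothesis hX : is_XD m n iota.
Local Notation wfun := (wfun R).
Local Notation inW := (@inW R m n).
Local Notation N x := (`|iota x|).
Implicit Types (F G : wfun) (fs : seq wfun) (js : seq nat).

Lemma leq_exp100 l : (100 * l <= 100 ^ l)%N.
Proof.
case: l => // l; rewrite expnS leq_mul2l /=.
exact: ltn_expl.
Qed.

(* By induction on the norming set. In f = (f_1 + ... + f_d) / w, the first f_q
   acting on the vectors is handled by the induction hypothesis. At most one
   vector is matched by the weight of f itself, and, the nodes of the later
   components being clustered around l points, at most l vectors are matched by
   the weight of one of these components; l / w <= 1/100. *)
Lemma upper_estimate (I : finType) (y : I -> c00 R) (J : I -> nat) (p : nat) (a : I -> R) :
  (forall i, (0 < J i)%N /\ exact_vector m n iota (J i) (y i)) ->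
  (forall i, p <= minsupp (y i))%N ->
  (forall i i' c, dist R (Node (enum_node (J i))) c <= 2^-1 ^+ p ->
    dist R (Node (enum_node (J i'))) c <= 2^-1 ^+ p -> i = i') ->
  (forall i i' k, i != i' -> y i k != 0 -> y i' k = 0) ->
  \sum_i 70 / (m (J i))%:R <= 10^-1 :> R -> (10 * #|I| <= 2 ^ p)%N ->
  (forall i, `|a i| <= 1) ->
  N (\sum_i a i *: y i) <= 2.
Proof.
move=> yJ yp sep disj sumJ cardI a1; set x := \sum_i _.
have y1 i : N (y i) = 1 by have [_ []] := yJ i.
have Jinj i i' : J i = J i' -> i = i'.
  move=> e; apply: (sep i i' (Node (enum_node (J i)))); rewrite ?e /dist asboolT//;
    exact: exprn_ge0.
have sum_le (f : c00 R) (b : I -> R) : (forall i, `|pairing f (y i)| <= b i) ->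
    `|pairing f x| <= \sum_i b i.
  move=> fb; rewrite pairing_sumr; apply: le_trans (ler_norm_sum _ _ _) _.
  apply: ler_sum => i _; rewrite pairingZr normrM; apply: le_trans (fb i).
  by rewrite ler_piMl.
have m0 i : 0 <= 70 / (m (J i))%:R :> R by rewrite divr_ge0.
have coef i : `|x i| <= 1.
  have [[k ki]|no] := pselect (exists k, y k i != 0); last first.
    rewrite c00_sum big1 ?normr0// => k _; change (a k * y k i = 0).
    by rewrite [y k i](_ : _ = 0) ?mulr0//; apply/eqP/negPn/negP => ki; apply: no; exists k.
  rewrite c00_sum (bigD1 k)//= big1 ?addr0.
    change (`|a k * y k i| <= 1); rewrite normrM mulr_ile1//.
    by rewrite -(y1 k); exact: (norm_coef hX).
  by move=> l lk; change (a l * y l i = 0); rewrite (disj k l i)// ?mulr0// eq_sym.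
apply: (norm_le hX) => F FW; apply: le_trans (ler_norm _) _.
suff : inW F -> `|pairing F.1 x| <= 2 by apply.
move: F FW; apply: inW_ind => [i i0 _|i i0 _|js fs fsd fsP fW].
- by rewrite pairing_unit_vec//; apply: le_trans (coef i) _; rewrite ler1n.
- by rewrite pairingNl normrN pairing_unit_vec//; apply: le_trans (coef i) _; rewrite ler1n.
have fsW F : F \in fs -> inW F by move=> /fsP[].
have [jsP fsf _ cl] := fsd.
set w := (\prod_(i <- js) m i)%N%:R : R.
have w100 : 100 <= w by rewrite ler_nat (weight_ge100 hmn).
have w0 : 0 < w by apply: lt_le_trans w100.
have iw : w^-1 <= 100^-1 by rewrite lef_pV2 ?posrE.
have iw0 : 0 < w^-1 by rewrite invr_gt0.
have zero F : ~~ (p <= maxsupp F.1)%N -> pairing F.1 x = 0.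
  rewrite -ltnNge => Fp; rewrite pairing_sumr big1// => i _; rewrite pairingZr.
  rewrite (@pairing_disjoint R F.1 (y i)) ?mulr0// => k Fk.
  apply: eq0_lt_minsupp; apply: leq_trans (yp i); apply: leq_ltn_trans Fp.
  exact: maxsupp_ge.
have [|no] := boolP (has (fun F => p <= maxsupp F.1)%N fs); last first.
  rewrite pairingZl pairing_suml big_map [X in _ * X]big_seq [X in _ * X]big1 ?mulr0 ?normr0//.
  by move=> F Ff; apply: zero; apply: contra no => h; apply/hasP; exists F.
move=> /has_split[fs1 [S [fs2 [efs fs1P Sp]]]].
have Sf : S \in fs by rewrite efs mem_cat mem_head orbT.
have e : pairing (weighted_sum m js [seq F.1 | F <- fs]) x =
    w^-1 * pairing S.1 x + pairing (weighted_sum m js [seq F.1 | F <- fs2]) x.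
  rewrite !pairingZl !pairing_suml !big_map efs big_cat big_cons/= -/w -mulrDr.
  by congr (_ * _); rewrite big_seq big1 ?add0r// => F /fs1P; exact: zero.
(* The induction hypothesis 2, divided by w >= 100. Together with 3/2 for the rest it stays below 2,
   which closes the induction. *)
have S2 : `|w^-1 * pairing S.1 x| <= 1 / 50.
  have := (fsP S Sf).2 (fsW S Sf); rewrite normrM (gtr0_norm iw0) => h.
  have := ler_pM (ltW iw0) (normr_ge0 _) iw h; lra.
suff T2 : `|pairing (weighted_sum m js [seq F.1 | F <- fs2]) x| <= 3 / 2.
  rewrite e; apply: le_trans (ler_normD _ _) _; apply: le_trans (lerD S2 T2) _; lra.
have [->|f2] := eqVneq fs2 [::].
  by rewrite /weighted_sum big_nil scaler0 pairing0l normr0; lra.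
have efs' : fs = (fs1 ++ [:: S]) ++ fs2 by rewrite -catA.
rewrite efs' in fsd fW; have [d2 W2] := decomposition_suffix hmn fsd fW f2.
have fs2W F : F \in fs2 -> inW F by move=> Ff; apply: fsW; rewrite efs' mem_cat Ff orbT.
have SF F : F \in fs2 -> fast m S F.
  move=> Ff; have [_] := fsf; rewrite efs' pairwise_cat => /andP[/allrelP h _]; apply: h => //.
  by rewrite mem_cat mem_head orbT.
have wF F : F \in fs2 -> (((2 ^ p)%N%:R : R)%:E <= weight m F)%E.
  by move=> /SF/andP[_]; apply: le_trans; exact: leq_pow2.
pose A := [pred i : I | has (fun G => (\max_(k <- G.2) k)%N == J i) fs2].
have cardA : (#|A| <= size js)%N.
  have [cs [szcs csP]] := cl S Sf; apply: leq_trans szcs.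
  (* Each matched index is 2^-p close to a centre attached to [S], and by [sep] no centre serves two
     indices; so there are at most [size js] of them. *)
  have exc i : exists c, i \in A -> c \in cs /\ dist R (Node (enum_node (J i))) c <= 2^-1 ^+ p.
    have [|nA] := boolP (i \in A); last by exists (Node [::]).
    move=> /hasP[G Gf /eqP eG].
    have [|//|c cc cG] := csP G; first by rewrite efs' mem_cat Gf orbT.
      by have /andP[] := SF G Gf.
    exists c => _; split=> //; move: cG; rewrite /close_node /weight_node eG => /le_trans; apply.
    exact: half_expW.
  have [g gP] := choice exc.
  rewrite cardE -(size_map g); apply: uniq_leq_size.
    rewrite map_inj_in_uniq ?enum_uniq// => i i'; rewrite !mem_enum => iA iA' eg.
    by apply: (sep i i' (g i)); [exact: (gP i iA).2 | rewrite eg; exact: (gP i' iA').2].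
  by move=> c /mapP[i]; rewrite mem_enum => iA ->; exact: (gP i iA).1.
have Aw : \sum_i (i \in A)%:R / w <= 1 / 100 :> R.
  have eA : (\sum_i (i \in A) = #|A|)%N.
    by rewrite -sum1_card [RHS]big_mkcond; apply: eq_bigr => i _; case: (i \in A).
  rewrite -mulr_suml -natr_sum eA ler_pdivrMr//.
  have : (#|A|)%:R * 100 <= w.
    rewrite -natrM ler_nat mulnC; apply: leq_trans (weight_ge_exp hmn jsP).
    by apply: leq_trans (leq_exp100 _); rewrite leq_mul2l.
  by move=> le; rewrite mulrC; lra.
have one : \sum_i ((\max_(k <- js) k)%N == J i)%:R <= 1 :> R.
  have [[i ji]|no] := pselect (exists i, (\max_(k <- js) k)%N = J i); last first.
    by rewrite big1// => i _; case: eqP => // ji; case: no; exists i.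
  rewrite (bigD1 i)//= ji eqxx big1 ?addr0// => i' /negP ii'.
  by case: eqP => // /Jinj e'; case: ii'; rewrite e'.
have powI : \sum_(i : I) (2 ^ p)%N%:R^-1 <= 1 / 10 :> R.
  rewrite sumr_const -[X in X <= _]mulr_natl ler_pdivrMr ?ltr0n ?expn_gt0//.
  by move: cardI; rewrite -(ler_nat R) natrM; lra.
(* The five sums are at most 1, 1/100, 1/10, 1/10 and 1/10: match with [js], matches with members,
   weight of the members, and exactness used at two depths. *)
apply: le_trans (sum_le _ (fun i => ((\max_(k <- js) k)%N == J i)%:R + (i \in A)%:R / w +
    (2 ^ p)%N%:R^-1 + 70 / (m (J i))%:R + 70 / (m (J i))%:R) _) _; last first.
  by rewrite !big_split/=; lra.
move=> i; have [Ji0 yi] := yJ i.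
have p0 : 0 <= (2 ^ p)%N%:R^-1 :> R by rewrite invr_ge0.
have Ai0 : 0 <= (i \in A)%:R / w by rewrite divr_ge0// ltW.
have mi := m0 i.
have [_|jsj] := eqVneq (\max_(k <- js) k)%N (J i).
  have := normr_pairing_le hX (y i) W2; rewrite y1 /=; lra.
have [G Gf le] := first_active_estimate hmn yi d2 fs2W W2 jsj.
apply: le_trans le _; rewrite -/w add0r lerD2r.
have [iA|iA] := boolP (i \in A).
  have : `|pairing G.1 (y i)| <= 1 by rewrite -(y1 i); exact: (normr_pairing_le hX _ (fs2W G Gf)).
  move=> /(ler_wpM2r (ltW iw0)) h; apply: le_trans h _.
  by rewrite -addrA lerDl; apply: addr_ge0.
have Gj : (\max_(k <- G.2) k)%N != J i.
  by apply: contra iA => h; apply/hasP; exists G.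
have := inexact_estimate hmn hX yi (fs2W G Gf) Gj (expn_gt0 2 p) (wF G Gf).
rewrite mul0r add0r => h; apply: le_trans h.
by rewrite ler_pdivrMr// ler_peMr//; lra.
Qed.

End UpperEstimate.

(** * The tree of vectors in a block subspace *)

Section TreeVectors.
Variables (R : realType) (m n : nat -> nat).
Hypothesis hmn : parameters R m n.
Variables (X : completeNormedModType R) (iota : {linear c00 R -> X}).
Hypothesis hX : is_XD m n iota.
Local Notation N x := (`|iota x|).

Lemma dist_initial (s : node) (x c : cnode) :
  dist R x c < 2^-1 ^+ size s -> initial s x -> initial s c.
Proof.
move=> d sx; have [<-//|xc] := pselect (x = c).
have [t [ts tx tc]] := dist_lt xc d; move: ts; rewrite half_exp_lt => /ltnW st.
have -> : s = take (size s) t; last exact: initial_take.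
by apply: (@initial_uniq _ _ x) => //; [rewrite size_takel | exact: initial_take].
Qed.

(** The height of a node is at most its index, so a long extension has a large index. *)
Lemma exists_far_extension k B : exists j, (B < j)%N /\ prefix (enum_node k) (enum_node j).
Proof.
have [j ej] := enum_node_surj (enum_node k ++ nseq B.+1 true).
exists j; rewrite ej prefix_prefix; split=> //; apply: leq_trans (size_enum_node j).
by rewrite ej size_cat size_nseq leq_addl.
Qed.

Definition tree_bounds (y : node -> c00 R) : Prop :=
  forall (h : nat) (mu : h.-tuple bool -> node) (a : h.-tuple bool -> R),
    (forall lam : h.-tuple bool, prefix lam (mu lam)) ->
    \big[Num.max/0]_(lam : h.-tuple bool) `|a lam|
      <= N (\sum_(lam : h.-tuple bool) a lam *: y (mu lam))
      <= 3 * \big[Num.max/0]_(lam : h.-tuple bool) `|a lam|.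

(** Exact vectors whose weights sit at nodes extending [lam]. Membership in the tail from [size lam]
    is recorded for the later perturbation into closed subspaces. *)
Lemma exists_tree_vectors (z : nat -> c00 R) : block_seq z -> (forall k, N (z k) = 1) ->
  exists y : node -> c00 R,
    [/\ forall lam, tail_span z (size lam) (y lam) /\ N (y lam) = 1,
        block_seq (fun k => y (enum_node k)) & tree_bounds y].
Proof.
move=> zb z1.
(* With m_{J k} > 700 * 2^k, the 2^h terms 70 / m_J of a family above level h add up to at most
   1/10. *)
have [J JP] := choice (fun k => exists_far_extension k (700 * 2 ^ k)).
have J0 k : (0 < J k)%N by have [h _] := JP k; exact: leq_trans h.
have [V VP] := choice (fun kK : nat * nat =>
  exists_exact_vector hmn hX kK.2 zb z1 (J0 kK.1)).
(* The start 4 puts supports beyond p = h + 4, and 2^p >= 10 * 2^h is what [upper_estimate] asks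
   for. *)
pose r := fix r k := if k is k'.+1 then maxn (r k').+1 (maxsupp (V (k', r k'))).+1 else 4%N.
have rk k : (k + 4 <= r k)%N.
  elim: k => // k IH; rewrite addSn /= -/r leq_max ltnS.
  by rewrite IH.
pose Y k := V (k, r k).
have YS k : tail_span z (r k) (Y k) := (VP (k, r k)).1.
have YE k : exact_vector m n iota (J k) (Y k) := (VP (k, r k)).2.
have Y1 k : N (Y k) = 1 by have [] := YE k.
have Y0 k : Y k != 0.
  by apply: contra_eq_neq (Y1 k) => ->; rewrite linear0 normr0 eq_sym oner_neq0.
have Ymin k : (r k < minsupp (Y k))%N.
  apply: leq_trans (block_minsupp_gt (r k) zb) _.
  exact: tail_span_minsupp zb (YS k) (Y0 k).
have Yb : block_seq Y.
  move=> k; split=> //; apply: leq_trans (Ymin k.+1); apply: leqW.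
  by rewrite /= -/r leq_max orbC ltnSn.
have [idx idxP] := choice enum_node_surj.
have idxK k : idx (enum_node k) = k by apply: enum_node_inj; exact: idxP.
have idx_size s : (size s <= idx s)%N by rewrite -{1}(idxP s); exact: size_enum_node.
exists (Y \o idx); split.
- move=> lam; split; last exact: Y1.
  apply: tail_spanW (YS _); apply: leq_trans (idx_size _) _.
  exact: leq_trans (leq_addr _ _) (rk _).
- by move=> k /=; rewrite !idxK; exact: Yb.
move=> h mu a muP /=.
have musz lam : (h <= size (mu lam))%N.
  by have := size_prefix (muP lam); rewrite size_tuple.
have muinj : injective mu.
  move=> s t e; apply/val_inj/(@initial_uniq _ _ (Node (mu s))); rewrite ?size_tuple//=.
  by rewrite e; exact: muP.
have disj s t k : s != t -> Y (idx (mu s)) k != 0 -> Y (idx (mu t)) k = 0.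
  move=> st Yk; have [lt|lt|e] := ltngtP (idx (mu s)) (idx (mu t)).
  - exact: precedes_eq0 (block_seq_precedes Yb lt) Yk.
  - exact: precedes_eq0r (block_seq_precedes Yb lt) Yk.
  by move: st; rewrite (muinj s t) ?eqxx// -(idxP (mu s)) e idxP.
set M := \big[Num.max/0]_(lam : h.-tuple bool) `|a lam|.
have aM lam : `|a lam| <= M by exact: (le_bigmax_cond _ (fun lam => `|a lam|)).
have M0 : 0 <= M.
  by rewrite /M; elim/big_ind: _ => // u v u0 v0; rewrite le_max u0.
apply/andP; split.
  apply: bigmax_le => // lam _.
  (* Restriction to the support of one vector isolates its coefficient. *)
  pose P : pred nat := fun i => Y (idx (mu lam)) i != 0.
  apply: le_trans (norm_restr hX P _).
  rewrite restr_sum (bigD1 lam)//= big1 ?addr0; last first.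
    move=> s sl; rewrite restrZ (_ : restr P _ = 0) ?scaler0//.
    by apply: restr_eq0 => i Pi; apply: disj Pi; rewrite eq_sym.
  by rewrite restrZ restr_id// linearZ normrZ Y1 mulr1.
have [M00|Mn0] := eqVneq M 0.
  rewrite big1 ?linear0 ?normr0 ?M00 ?mulr0// => lam _.
  by have := aM lam; rewrite M00 normr_le0 => /eqP ->; rewrite scale0r.
have Mgt : 0 < M by rewrite lt_def Mn0.
have -> : \sum_(lam : h.-tuple bool) a lam *: Y (idx (mu lam)) =
    M *: \sum_(lam : h.-tuple bool) (a lam / M) *: Y (idx (mu lam)).
  by rewrite scaler_sumr; apply: eq_bigr => lam _; rewrite scalerA mulrC divfK.
rewrite linearZ normrZ ger0_norm// mulrC ler_pM2r//; apply: le_trans (_ : 2 <= _); last first.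
  by rewrite ler_nat.
apply: (@upper_estimate _ _ _ hmn _ _ hX _ _ (fun lam => J (idx (mu lam))) (h + 4)).
- by move=> lam; split.
- move=> lam; apply: leq_trans (ltnW (Ymin _)); apply: leq_trans (rk _).
  by rewrite leq_add2r (leq_trans (musz lam)).
(* Being closer than 2^-h to nodes above [s] and [t], the point [c] has both as initial segments of
   length h. *)
- move=> s t c ds dt; apply: val_inj; apply: (@initial_uniq _ _ c); rewrite ?size_tuple//.
    apply: dist_initial (_ : initial s (Node (enum_node (J (idx (mu s)))))).
      by apply: le_lt_trans ds _; rewrite half_exp_lt size_tuple -[X in (X < _)%N]addn0 ltn_add2l.
    by have [_] := JP (idx (mu s)); rewrite idxP; apply: prefix_trans; exact: muP.
  apply: dist_initial (_ : initial t (Node (enum_node (J (idx (mu t)))))).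
    by apply: le_lt_trans dt _; rewrite half_exp_lt size_tuple -[X in (X < _)%N]addn0 ltn_add2l.
  by have [_] := JP (idx (mu t)); rewrite idxP; apply: prefix_trans; exact: muP.
- exact: disj.
- apply: le_trans (_ : \sum_(lam : h.-tuple bool) (10 * 2 ^ h)%N%:R^-1 <= _).
    apply: ler_sum => lam _; set k := idx (mu lam).
    have mk : (700 * 2 ^ h <= m (J k))%N.
      apply: leq_trans (m_ge_id hmn (J0 k)); have [jk _] := JP k; apply: leq_trans (ltnW jk).
      by rewrite leq_mul2l leq_exp2l// (leq_trans (musz lam)).
    have pos : 0 < (10 * 2 ^ h)%N%:R :> R by rewrite ltr0n muln_gt0 expn_gt0.
    rewrite ler_pdivrMr ?ltr0n ?(m_gt0 hmn)// ler_pdivlMl//.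
    by rewrite -natrM ler_nat mulnAC; apply: leq_trans mk.
  rewrite sumr_const card_tuple card_bool -[X in X <= _]mulr_natl natrM invfM.
  by rewrite mulrCA divff ?mulr1// pnatr_eq0 -lt0n expn_gt0.
- by rewrite card_tuple card_bool expnD mulnC leq_mul2l orbT.
by move=> lam; rewrite normrM normfV (ger0_norm M0) ler_pdivrMr// mul1r.
Qed.

Lemma lin_span_tail (z : nat -> c00 R) K u :
  tail_span z K u -> lin_span (range (iota \o z)) (iota u).
Proof.
move=> [M [a [_ ->]]]; exists M, (fun i : 'I_M => a i), (fun i : 'I_M => iota (z i)).
split; first by move=> i; exists i.
by rewrite linear_sum; apply: eq_bigr => i _; rewrite linearZ.
Qed.

Lemma block_seq_normalize (z : nat -> c00 R) : block_seq z ->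
  block_seq (fun k => (N (z k))^-1 *: z k) /\ forall k, N ((N (z k))^-1 *: z k) = 1.
Proof.
move=> zb; have zk k : 0 < N (z k) by apply: (norm_gt0 hX); exact: block_seq_neq0.
have zk0 k : (N (z k))^-1 != 0 by rewrite invr_eq0 gt_eqF.
have n1 k : N ((N (z k))^-1 *: z k) = 1.
  by rewrite linearZ normrZ gtr0_norm ?invr_gt0// mulVf// gt_eqF.
have n0 k : (N (z k))^-1 *: z k != 0.
  by apply: contra_eq_neq (n1 k) => ->; rewrite linear0 normr0 eq_sym oner_neq0.
split=> // k; split=> //.
by rewrite maxsuppZ// minsuppZ//; exact: block_seq_precedes.
Qed.

Lemma block_subspace_tree (Y : set X) : block_subspace iota Y ->
  exists y : node -> c00 R,
    [/\ forall lam, Y (iota (y lam)) /\ N (y lam) = 1,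
        block_seq (fun k => y (enum_node k)) & tree_bounds y].
Proof.
move=> [z zb ->]; have [zb' z1'] := block_seq_normalize zb.
have [y [ys yb yu]] := exists_tree_vectors zb' z1'.
exists y; split=> // lam; have [yz y1] := ys lam; split=> //.
apply: subset_closure; apply: (@lin_span_tail z 0).
have {}yz := tail_spanW (leq0n (size lam)) yz.
by apply: tail_span_trans yz => k; exact/tail_spanZ/tail_span_mem.
Qed.

End TreeVectors.

(** * Block approximations inside closed subspaces *)

Section GlidingHump.
Variables (R : realType) (m n : nat -> nat).
Variables (X : completeNormedModType R) (iota : {linear c00 R -> X}).
Hypothesis hX : is_XD m n iota.
Local Notation N x := (`|iota x|).

Lemma exists_approximation (v : X) (eps : R) : 0 < eps ->
  exists x : c00 R, `|v - iota x| < eps.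
Proof.
move=> eps0; have [_ dns] := hX.
have [w [vw [x _ xw]]] := dns _ (ex_intro _ v (ballxx v eps0)) (ball_open v eps).
have : ball v eps w by exact: vw.
by rewrite -ball_normE => vw'; exists x; rewrite xw.
Qed.

(* The coordinate functionals are 1-Lipschitz, hence extend to X. *)
Lemma coord_extension (v : X) (i : nat) :
  exists t : R, forall x : c00 R, `|t - x i| <= `|v - iota x|.
Proof.
pose S := [set x i - `|v - iota x| | x in [set: c00 R]].
have S0 : (S !=set0)%classic by exists ((0 : c00 R) i - `|v - iota 0|), 0.
have ub (x : c00 R) : ubound S (x i + `|v - iota x|).
  move=> _ [y _ <-].
  have h1 : y i - x i <= N (y - x).
    by apply: le_trans (norm_coef hX (y - x) i); exact: ler_norm.
  have h2 : N (y - x) <= `|v - iota x| + `|v - iota y|.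
    rewrite linearB -[iota y - _](subrKA v) [X in _ <= X]addrC.
    by apply: le_trans (ler_normD _ _) _; rewrite (distrC (iota y)).
  by lra.
exists (sup S) => x; rewrite ler_distl; apply/andP; split.
  apply: sup_ubound; first by exists (x i + `|v - iota x|); exact: ub.
  by exists x.
by apply: sup_le_ub => //; exact: ub.
Qed.

Definition vanishes_upto (P : nat) (x : c00 R) : Prop := forall i, (i <= P)%N -> x i = 0.

(** [t] collects the extended coordinates of [v]. An approximation of [v] is truncated, and its
    first coordinates differ from [t] by no more than the error of approximation. *)
Lemma exists_vanishing_approximation (P : nat) (v : X) :
  exists t : nat -> R, forall eps : R, 0 < eps -> exists2 x : c00 R, vanishes_upto P x &
    `|v - iota (\sum_(i < P.+1) t i *: unit_vec R i) - iota x| < eps.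
Proof.
have [t tP] := choice (coord_extension v).
exists t => eps eps0.
pose C := 1 + \sum_(i < P.+1) N (unit_vec R i).
have C1 : 1 <= C by rewrite lerDl sumr_ge0.
have [x xv] := @exists_approximation v (eps / C) (divr_gt0 eps0 (lt_le_trans ltr01 C1)).
exists (restr (fun i => P < i)%N x); first by move=> i iP; rewrite restrE ltnNge iP.
have e : x = restr (fun i => P < i)%N x + \sum_(i < P.+1) x i *: unit_vec R i.
  apply: c00P => k; rewrite c00_D restrE c00_sum; have [Pk|kP] := ltnP P k.
    rewrite big1 ?addr0// => i _; change (x i * unit_vec R i k = 0).
    have [->|i0] := posnP i; first by rewrite c00_index0 mul0r.
    by rewrite unit_vecE// gtn_eqF ?mulr0// (leq_trans _ Pk)// ltnS -ltnS.
  rewrite add0r (bigD1 (Ordinal (kP : (k < P.+1)%N)))//= big1.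
    rewrite addr0; change (x k = x k * unit_vec R k k).
    have [->|k0] := posnP k; first by rewrite c00_index0 mul0r.
    by rewrite unit_vecE// eqxx mulr1.
  move=> i ik; change (x i * unit_vec R i k = 0).
  have [->|i0] := posnP i; first by rewrite c00_index0 mul0r.
  by rewrite unit_vecE// [k == i]eq_sym (_ : (i : nat) == k = false) ?mulr0//; exact: negbTE.
set u := restr _ x in e *.
have -> : v - iota (\sum_(i < P.+1) t i *: unit_vec R i) - iota u =
    (v - iota x) - iota (\sum_(i < P.+1) (t i - x i) *: unit_vec R i).
  have hx : iota x = iota u + iota (\sum_(i < P.+1) x i *: unit_vec R i) by rewrite -linearD -e.
  have hd : iota (\sum_(i < P.+1) (t i - x i) *: unit_vec R i) =
      iota (\sum_(i < P.+1) t i *: unit_vec R i) - iota (\sum_(i < P.+1) x i *: unit_vec R i).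
    rewrite -linearB -[in RHS]sumrB (eq_bigr (fun i : 'I_P.+1 =>
      t i *: unit_vec R i - x i *: unit_vec R i))// => i _; exact: scalerBl.
  by rewrite hx hd opprB opprD !addrA subrK addrAC.
apply: le_lt_trans (ler_normB _ _) _.
have le : N (\sum_(i < P.+1) (t i - x i) *: unit_vec R i) <=
    `|v - iota x| * \sum_(i < P.+1) N (unit_vec R i).
  rewrite linear_sum mulr_sumr; apply: le_trans (ler_norm_sum _ _ _) _.
  by apply: ler_sum => i _; rewrite linearZ normrZ; exact: ler_wpM2r.
apply: le_lt_trans (lerD (lexx _) le) _.
rewrite -[X in X + _]mulr1 -mulrDr -/C -ltr_pdivlMr//.
exact: lt_le_trans C1.
Qed.

Lemma infinite_dimensional_independent (Z : set X) : infinite_dimensional Z ->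
  forall M, exists v : 'I_M -> X, (forall i, Z (v i)) /\
    forall a : 'I_M -> R, \sum_i a i *: v i = 0 -> forall i, a i = 0.
Proof.
move=> Zinf; elim=> [|M [v [Zv vind]]]; first by exists (fun=> 0); split=> [[]|a _ []].
have [u Zu nu] : exists2 u, Z u & ~ lin_span (range v) u.
  apply: contrapT => h; apply: (Zinf M v Zv) => u Zu.
  by apply: contrapT => nu; apply: h; exists u.
pose w (i : 'I_M.+1) := if unlift ord_max i is Some j then v j else u.
have wmax : w ord_max = u by rewrite /w unlift_none.
have wlift j : w (lift ord_max j) = v j by rewrite /w liftK.
exists w; split; first by move=> i; rewrite /w; case: unlift.
move=> a; rewrite big_ord_recr/= wmax.
have wid i : w (widen_ord (leqnSn M) i) = v i.
  by rewrite -wlift; congr w; apply: val_inj; rewrite /= /bump leqNgt ltn_ord.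
under eq_bigr do rewrite wid.
move=> s0; have au : a ord_max = 0.
  apply: contra_notP nu => /eqP am.
  exists M, (fun i => - (a ord_max)^-1 * a (widen_ord (leqnSn M) i)), v; split.
    by move=> i; exists i.
  have -> : u = - (a ord_max)^-1 *: \sum_i a (widen_ord (leqnSn M) i) *: v i.
    have := congr1 (fun x => (a ord_max)^-1 *: x) s0.
    rewrite scaler0 scalerDr scalerA mulVf// scale1r scaleNr => /eqP.
    by rewrite addrC addr_eq0 => /eqP.
  by rewrite scaler_sumr; apply: eq_bigr => i _; rewrite scalerA.
rewrite au scale0r addr0 in s0.
have h := vind _ s0; move=> i; case: (unliftP ord_max i) => [j ->|->//].
by rewrite -(h j); congr a; apply: val_inj; rewrite /= /bump leqNgt ltn_ord.
Qed.

Lemma closed_subspace_sum (Z : set X) (I : finType) (a : I -> R) (v : I -> X) :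
  closed_subspace Z -> (forall i, Z (v i)) -> Z (\sum_i a i *: v i).
Proof.
move=> [_ Z0 ZD] Zv; elim/big_ind: _ => // [u w Zu Zw|i _].
  by rewrite -[u]scale1r; exact: ZD.
by rewrite -[_ *: _]addr0; exact: ZD.
Qed.

(** Among P+2 independent vectors, P+1 linear conditions leave a nonzero combination whose
    coordinates up to P vanish. *)
Lemma exists_vanishing_member (Z : set X) (P : nat) (eps : R) :
  closed_subspace Z -> infinite_dimensional Z -> 0 < eps ->
  exists (w : X) (x : c00 R), [/\ Z w, vanishes_upto P x, N x = 1 & `|w - iota x| < eps].
Proof.
move=> Zc Zinf eps0.
have [v [Zv vind]] := infinite_dimensional_independent Zinf P.+2.
have [t tP] := choice (fun i => exists_vanishing_approximation P (v i)).
pose A : 'M[R]_(P.+2, P.+1) := \matrix_(i, j) t i j.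
have [a [a0 aA]] : exists a : 'rV[R]_P.+2, a != 0 /\ a *m A = 0.
  have : kermx A != 0.
    by rewrite kermx_eq0 /row_free neq_ltn ltnS rank_leq_col.
  by move=> /rowV0Pn[a /sub_kermxP aA a0]; exists a.
pose w0 := \sum_i a 0 i *: v i.
have Zw0 : Z w0 by exact: closed_subspace_sum.
have w00 : w0 != 0.
  apply: contra_neq a0 => /vind ai; apply/rowP => i; by rewrite ai mxE.
have r0 : 0 < `|w0| by rewrite normr_gt0.
pose C := 1 + \sum_i `|a 0 i|.
have C1 : 1 <= C by rewrite lerDl sumr_ge0.
have C0 : 0 < C by exact: lt_le_trans C1.
(* The first term keeps N y above half of the norm of [w0]; the second keeps the error below [eps]
   after division by N y. *)
pose d := Num.min (`|w0| / 2) (eps * `|w0| / 2).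
have d0 : 0 < d by rewrite lt_min !divr_gt0// mulr_gt0.
have [x xP] := choice (fun i => let: ex_intro2 x h1 h2 := tP i (d / C) (divr_gt0 d0 C0) in
  ex_intro (fun x => vanishes_upto P x /\ `|v i - iota (\sum_(k < P.+1) t i k *: unit_vec R k)
    - iota x| < d / C) x (conj h1 h2)).
pose y := \sum_i a 0 i *: x i.
have yP : vanishes_upto P y.
  move=> k kP; rewrite c00_sum big1// => i _; change (a 0 i * x i k = 0).
  by rewrite ((xP i).1 k kP) mulr0.
have w0y : `|w0 - iota y| < d.
  have -> : w0 - iota y = \sum_i a 0 i *:
      (v i - iota (\sum_(k < P.+1) t i k *: unit_vec R k) - iota (x i)).
    have tz : \sum_i a 0 i *: iota (\sum_(k < P.+1) t i k *: unit_vec R k) = 0.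
      have -> : \sum_i a 0 i *: iota (\sum_(k < P.+1) t i k *: unit_vec R k) =
          iota (\sum_(k < P.+1) (\sum_i a 0 i * t i k) *: unit_vec R k).
        rewrite linear_sum.
        under [RHS]eq_bigr do rewrite scaler_suml linear_sum.
        rewrite exchange_big; apply: eq_bigr => i _.
        rewrite linear_sum scaler_sumr; apply: eq_bigr => k _.
        by rewrite -scalerA [in RHS]linearZ.
      rewrite big1 ?linear0// => k _.
      have /rowP/(_ k) := aA; rewrite !mxE => e.
      rewrite [X in X *: _](_ : _ = 0) ?scale0r// -[RHS]e.
      by apply: eq_bigr => i _; rewrite mxE.
    under [RHS]eq_bigr do rewrite !scalerBr.
    rewrite !sumrB tz subr0 linear_sum; congr (_ - _).
    by apply: eq_bigr => i _; rewrite linearZ.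
  apply: le_lt_trans (ler_norm_sum _ _ _) _.
  apply: le_lt_trans (_ : \sum_i `|a 0 i| * (d / C) < _).
    by apply: ler_sum => i _; rewrite normrZ; apply: ler_wpM2l => //; exact/ltW/(xP i).2.
  rewrite -mulr_suml mulrA ltr_pdivrMr// mulrC ltr_pM2l// /C ltrDr ltr01//.
have dw : d <= `|w0| / 2 by rewrite ge_min lexx.
have de : d <= eps * `|w0| / 2 by rewrite ge_min lexx orbT.
have Ny : `|w0| / 2 < N y.
  have : `|w0| <= `|w0 - iota y| + N y by rewrite -{1}(subrK (iota y) w0) ler_normD.
  lra.
have Ny0 : 0 < N y by apply: lt_trans Ny; rewrite divr_gt0.
exists ((N y)^-1 *: w0), ((N y)^-1 *: y); split.
- have [_ Z0 ZD] := Zc; by rewrite -[_ *: _]addr0; exact: ZD.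
- by move=> k kP; change ((N y)^-1 * y k = 0); rewrite yP// mulr0.
- by rewrite linearZ normrZ gtr0_norm ?invr_gt0// mulVf// gt_eqF.
rewrite linearZ -scalerBr normrZ gtr0_norm ?invr_gt0// mulrC ltr_pdivrMr//.
by nra.
Qed.

(** The gliding hump. The errors 2^-k / 8 sum to at most 2^-K / 4 from index K on, the accuracy used
    in [tail_span_perturb]. *)
Lemma exists_block_approximation (Z : set X) : closed_subspace Z -> infinite_dimensional Z ->
  exists (v : nat -> X) (z : nat -> c00 R), [/\ block_seq z, forall k, N (z k) = 1,
    forall k, Z (v k) & forall k, `|v k - iota (z k)| <= 2^-1 ^+ k / 8].
Proof.
move=> Zc Zinf.
have e0 P : 0 < (2^-1 : R) ^+ P / 8 by rewrite divr_gt0// exprn_gt0.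
have [p pP] : exists p : nat -> X * c00 R, forall P, [/\ Z (p P).1, vanishes_upto P (p P).2,
    N (p P).2 = 1 & `|(p P).1 - iota (p P).2| < 2^-1 ^+ P / 8].
  have [|p pP] := @choice _ _ (fun P q => [/\ Z q.1, vanishes_upto P q.2,
    N q.2 = 1 & `|q.1 - iota q.2| < 2^-1 ^+ P / 8]); last by exists p.
  by move=> P; have [w [x wx]] := exists_vanishing_member P Zc Zinf (e0 P); exists (w, x).
have [a|r rP] := @exists_subsequence (fun a i => (maxsupp (p a).2 <= i)%N).
  by exists (maxn a (maxsupp (p a).2)).+1; rewrite ?ltnS ?leq_maxl// leqW// leq_maxr.
have rS k : (r k < r k.+1)%N by have [] := rP k.
have rid k : (k <= r k)%N by elim: k => // k IH; exact: leq_ltn_trans IH (rS k).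
have x0 P : (p P).2 != 0.
  have [_ _ + _] := pP P; by apply: contra_eq_neq => ->; rewrite linear0 normr0 eq_sym oner_neq0.
exists (fun k => (p (r k)).1), (fun k => (p (r k)).2); split.
- move=> k; split=> //; have [_ h] := rP k; apply: leq_ltn_trans h _.
  have [_ h _ _] := pP (r k.+1); rewrite ltnNge; apply/negP => /h.
  by apply/eqP/minsupp_neq0.
- by move=> k; have [] := pP (r k).
- by move=> k; have [] := pP (r k).
move=> k; have [_ _ _ /ltW h] := pP (r k); apply: le_trans h _.
by rewrite ler_pM2r ?invr_gt0//; exact: half_expW.
Qed.

End GlidingHump.

(** * Dyadic midpoints and lengths of tagged intervals *)

Section Dyadic.
Variable R : realType.
Implicit Types (s lam : node) (t : R).

(** [s] is read as binary digits, most significant first: the maps t -> (b + t)/2 send [0,1] to its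
    halves. *)
Fixpoint dyadic_mid s : R := if s is b :: s' then (b%:R + dyadic_mid s') / 2 else 1 / 2.

Fixpoint dyadic_left s : R := if s is b :: s' then (b%:R + dyadic_left s') / 2 else 0.

Lemma bool_bounds (b : bool) : 0 <= (b%:R : R) <= 1.
Proof. by case: b; rewrite ?lexx ler01. Qed.

Lemma dyadic_mid_bounds s : 0 < dyadic_mid s < 1.
Proof.
elim: s => [|b s /andP[IH0 IH1]] /=; first by apply/andP; split; lra.
by have /andP[b0 b1] := bool_bounds b; apply/andP; split; lra.
Qed.

Lemma dyadic_mid_inj : injective dyadic_mid.
Proof.
elim=> [|b s IH] [|c t] //=.
- by have /andP[t0 t1] := dyadic_mid_bounds t; case: c; rewrite ?mulr1n ?mulr0n => e; exfalso; lra.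
- by have /andP[s0 s1] := dyadic_mid_bounds s; case: b; rewrite ?mulr1n ?mulr0n => e; exfalso; lra.
have /andP[t0 t1] := dyadic_mid_bounds t; have /andP[s0 s1] := dyadic_mid_bounds s.
case: b; case: c; rewrite ?mulr1n ?mulr0n => e.
- by congr cons; apply: IH; lra.
- by exfalso; lra.
- by exfalso; lra.
by congr cons; apply: IH; lra.
Qed.

Lemma dyadic_mid_prefix lam s : prefix lam s ->
  dyadic_left lam <= dyadic_mid s <= dyadic_left lam + 2^-1 ^+ size lam.
Proof.
elim: lam s => [|b lam IH] s.
  by move=> _; have /andP[s0 s1] := dyadic_mid_bounds s; rewrite expr0 add0r !ltW.
case: s => // c s /=; case: eqP => [->|//] /IH /andP[h1 h2].
by rewrite exprS; apply/andP; split; lra.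
Qed.

Lemma dyadic_cover h t : 0 <= t <= 1 -> exists2 lam : node, size lam = h &
  dyadic_left lam <= t <= dyadic_left lam + 2^-1 ^+ h.
Proof.
elim: h t => [|h IH] t /andP[t0 t1].
  by exists [::] => //=; rewrite expr0 add0r t0 t1.
have [t2|t2] := leP t (1 / 2).
  have [|lam <- /andP[h1 h2]] := IH (2 * t); first by apply/andP; split; lra.
  by exists (false :: lam) => //=; rewrite exprS mulr0n; apply/andP; split; lra.
have [|lam <- /andP[h1 h2]] := IH (2 * t - 1); first by apply/andP; split; lra.
by exists (true :: lam) => //=; rewrite exprS mulr1n; apply/andP; split; lra.
Qed.

Lemma tagged_partition_monotone (s : seq R) (xi : nat -> R) i : tagged_partition s xi ->
  (i < size s)%N -> nth 0 (0 :: s) i <= nth 0 s i.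
Proof. by move=> [_ h] /h/andP[]; exact: le_trans. Qed.

(** Intervals tagged in [c, d] lie in [c - delta, d + delta]. Clamping the division points to that
    interval leaves these lengths unchanged and makes the full sum telescope. *)
Lemma sum_tags_between (s : seq R) (xi : nat -> R) (delta c d : R) :
  tagged_partition s xi -> mesh_lt s delta -> c <= d -> 0 < delta ->
  \sum_(i < size s | c <= xi i <= d) (nth 0 s i - nth 0 (0 :: s) i) <= d - c + 2 * delta.
Proof.
move=> sP sd cd d0; have mono i := tagged_partition_monotone (i := i) sP.
pose clamp (t : R) := Num.min (d + delta) (Num.max (c - delta) t).
have clamp_le u v : u <= v -> clamp u <= clamp v.
  by move=> uv; rewrite /clamp le_min !ge_min lexx/= ge_max !le_max lexx uv !orbT.
have clamp_id u : c - delta <= u <= d + delta -> clamp u = u.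
  by move=> /andP[u1 u2]; rewrite /clamp max_r// min_r.
apply: le_trans (_ : \sum_(i < size s)
    (clamp (nth 0 (0 :: s) i.+1) - clamp (nth 0 (0 :: s) i)) <= _).
  rewrite big_mkcond; apply: ler_sum => i _ /=; case: ifP => [/andP[ci id]|_]; last first.
    by rewrite subr_ge0; apply/clamp_le/mono.
  have /andP[x1 x2] := sP.2 i (ltn_ord i); have := sd i (ltn_ord i) => mi.
  by rewrite !clamp_id//; apply/andP; split; lra.
rewrite -(big_mkord xpredT (fun i => clamp (nth 0 (0 :: s) i.+1) - clamp (nth 0 (0 :: s) i))).
rewrite telescope_sumr//.
have u1 : clamp (nth 0 (0 :: s) (size s)) <= d + delta by rewrite /clamp ge_min lexx.
have u2 : c - delta <= clamp (nth 0 (0 :: s) 0).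
  by rewrite /clamp le_min le_max lexx andbT; lra.
by lra.
Qed.

(** Each point is the degenerate interval c = d, which costs 2 delta. *)
Lemma sum_tags_in (s : seq R) (xi : nat -> R) (delta : R) (L : seq R) :
  tagged_partition s xi -> mesh_lt s delta -> 0 < delta ->
  \sum_(i < size s | xi i \in L) (nth 0 s i - nth 0 (0 :: s) i) <= (size L)%:R * (2 * delta).
Proof.
move=> sP sd d0; elim: L => [|p L IH]; first by rewrite big_pred0 ?mul0r.
have := sum_tags_between sP sd (lexx p) d0; rewrite subrr add0r => hp.
rewrite /= -natr1 mulrDl mul1r addrC; apply: le_trans (lerD hp IH).
rewrite [leLHS]big_mkcond [X in _ <= X + _]big_mkcond [X in _ <= _ + X]big_mkcond -big_split.
apply: ler_sum => i _ /=; have := tagged_partition_monotone sP (ltn_ord i) => mi.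
rewrite inE -eq_le [p == _]eq_sym; case: (xi i == p); case: (xi i \in L) => /=; lra.
Qed.

Lemma sum_tags (s : seq R) (xi : nat -> R) (P : pred 'I_(size s)) : tagged_partition s xi ->
  \sum_(i < size s | P i) (nth 0 s i - nth 0 (0 :: s) i) <= 1.
Proof.
move=> sP; apply: le_trans (_ : \sum_(i < size s) (nth 0 (0 :: s) i.+1 - nth 0 (0 :: s) i) <= _).
  rewrite big_mkcond; apply: ler_sum => i _; have := tagged_partition_monotone sP (ltn_ord i).
  by case: ifP => _ /=; rewrite ?lexx// subr_ge0.
rewrite -(big_mkord xpredT (fun i => nth 0 (0 :: s) i.+1 - nth 0 (0 :: s) i)).
rewrite telescope_sumr// subr0 (_ : nth _ _ _ = 1)//.
by have [[_ /eqP <-] _] := sP; rewrite -[last 0 s]/(last 0 (0 :: s)) -nth_last.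
Qed.

End Dyadic.

(** * A Riemann integrable function discontinuous everywhere *)

Section NotLebesgue.
Variables (R : realType) (m n : nat -> nat).
Variables (X : completeNormedModType R) (iota : {linear c00 R -> X}).
Hypothesis hX : is_XD m n iota.
Local Notation N x := (`|iota x|).
Variables (Z : set X) (y : node -> c00 R) (v : node -> X).
Hypotheses (Z0 : Z 0) (Zv : forall lam, Z (v lam)).
Hypotheses (yN : forall lam, N (y lam) = 1) (yu : tree_bounds iota y).
Hypothesis ysep : forall lam mu, lam != mu -> 1 <= N (y lam - y mu).
Hypothesis yv : forall lam, `|v lam - iota (y lam)| <= 2^-1 ^+ size lam / 4.

(* A functional picks the extreme member of each group, so that a convex
   combination within every group is no larger than a choice of one member. *)
Lemma tree_bounds_convex (I : finType) (H : pred I) (c : I -> R) (nu : I -> node) h B :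
  (forall i, 0 <= c i) -> (forall i, H i -> (h <= size (nu i))%N) ->
  (forall lam : h.-tuple bool, \sum_(i | H i && prefix lam (nu i)) c i <= B) ->
  N (\sum_(i | H i) c i *: y (nu i)) <= 3 * B.
Proof.
move=> c0 Hh HB; apply: (norm_le hX) => F FW.
have exmu (lam : h.-tuple bool) : exists mu : node, prefix lam mu /\ forall i, H i ->
    prefix lam (nu i) -> pairing F.1 (y (nu i)) <= pairing F.1 (y mu).
  case: (pickP (fun i => H i && prefix lam (nu i))) => [i0 i0P|no].
    have [i /andP[Hi li] imax] := @Order.TotalTheory.arg_maxP _ _ _ i0
      (fun i => H i && prefix lam (nu i)) (fun i => pairing F.1 (y (nu i))) i0P.
    by exists (nu i); split=> // k Hk lk; apply: imax; rewrite Hk.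
  exists lam; split; first exact: prefix_refl.
  by move=> i Hi li; have := no i; rewrite Hi li.
have [mu muP] := choice exmu.
pose a (lam : h.-tuple bool) := \sum_(i | H i && prefix lam (nu i)) c i.
have a0 lam : 0 <= a lam by exact: sumr_ge0.
(* The default tuple is never reached on [H], where nodes have height at least h. *)
pose g i : h.-tuple bool := insubd (nseq_tuple h false) (take h (nu i)).
have gP i lam : H i -> (g i == lam) = prefix lam (nu i).
  move=> Hi; rewrite prefixE size_tuple -val_eqE /= /g val_insubd.
  by rewrite size_takel ?Hh// eqxx.
rewrite pairing_sumr (partition_big g xpredT)//=.
apply: le_trans (_ : \sum_lam a lam * pairing F.1 (y (mu lam)) <= _).
  apply: ler_sum => lam _; rewrite mulr_suml.
  rewrite (eq_bigl (fun i => H i && prefix lam (nu i))); last first.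
    by move=> i; case: (boolP (H i)) => //= Hi; exact: gP.
  apply: ler_sum => i /andP[Hi li]; rewrite pairingZr; apply: ler_wpM2l => //.
  exact: (muP lam).2.
rewrite (eq_bigr (fun lam => pairing F.1 (a lam *: y (mu lam)))); last first.
  by move=> lam _; rewrite pairingZr.
rewrite -pairing_sumr; apply: le_trans (pairing_le hX _ FW) _.
have /andP[_ up] := yu a (fun lam => (muP lam).1); apply: le_trans up _.
rewrite ler_pM2l//; apply: bigmax_le => [|lam _].
  by apply: le_trans (HB (nseq_tuple h false)); exact: sumr_ge0.
by rewrite ger0_norm//; exact: HB.
Qed.

Lemma exists_node_of :
  exists nd : R -> node, forall t, (exists mu, dyadic_mid R mu = t) -> dyadic_mid R (nd t) = t.
Proof.
have [|nd ndP] := @choice _ _ (fun t s => (exists mu, dyadic_mid R mu = t) -> dyadic_mid R s = t).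
  move=> t; have [[mu mut]|no] := pselect (exists mu, dyadic_mid R mu = t); first by exists mu.
  by exists [::].
by exists nd.
Qed.

Variable nd : R -> node.
Hypothesis ndP : forall t, (exists mu, dyadic_mid R mu = t) -> dyadic_mid R (nd t) = t.

Definition tree_function (t : R) : X :=
  if `[< exists mu, dyadic_mid R mu = t >] then v (nd t) else 0.

Lemma tree_function_mid mu : tree_function (dyadic_mid R mu) = v mu.
Proof.
rewrite /tree_function asboolT; last by exists mu.
by congr v; apply: (@dyadic_mid_inj R); apply: ndP; exists mu.
Qed.

Lemma tree_function_mem t : Z (tree_function t).
Proof. by rewrite /tree_function; case: ifP. Qed.

Lemma norm_v_le2 lam : `|v lam| <= 2.
Proof.
rewrite -[v lam](subrK (iota (y lam))); apply: le_trans (ler_normD _ _) _; rewrite yN.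
have h : (2^-1 : R) ^+ size lam <= 1 by rewrite exprn_ile1// ?invr_ge0// invf_le1// ler1n.
have := yv lam; lra.
Qed.

(** Nodes of height below h are finitely many, so their tags carry little length. Among the others,
    the nodes above a fixed node of height h have their midpoints in one dyadic interval of length
    2^-h, and [tree_bounds_convex] replaces the total length by the largest of these shares. *)
Lemma riemann_sum_small (eps : R) : 0 < eps -> exists2 delta : R, 0 < delta &
  forall s xi, tagged_partition s xi -> mesh_lt s delta ->
    `|riemann_sum tree_function s xi| < eps.
Proof.
move=> eps0; have [h hP] := @half_exp_small R (eps / 8) (divr_gt0 eps0 (ltr0n _ 8)).
pose K : R := (size (nodes_below h))%:R.
have K0 : 0 <= K by [].
have K2 : 0 < 8 * (K + 2) by lra.
(* The total is at most 4 K delta + 6 delta + (13/4) 2^-h, and both halves of [eps] suffice since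
   2^-h < eps/8. *)
pose delta := eps / (8 * (K + 2)); have d0 : 0 < delta by rewrite divr_gt0.
have dE : delta * (8 * (K + 2)) = eps by rewrite /delta divfK// gt_eqF.
exists delta => // s xi sP sd.
pose D (i : 'I_(size s)) := nth 0 s i - nth 0 (0 :: s) i.
have D0 i : 0 <= D i by rewrite subr_ge0; exact: tagged_partition_monotone sP (ltn_ord i).
pose isd i := `[< exists mu, dyadic_mid R mu = xi i >].
pose nu (i : 'I_(size s)) := nd (xi i).
have nuP (i : 'I_(size s)) : isd i -> dyadic_mid R (nu i) = xi i by move=> /asboolP/ndP.
have -> : riemann_sum tree_function s xi = \sum_(i < size s | isd i) D i *: v (nu i).
  rewrite [RHS]big_mkcond; apply: eq_bigr => i _; rewrite /tree_function -/(isd i).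
  by case: ifP => // _; rewrite scaler0.
rewrite (bigID (fun i => size (nu i) < h)%N)/=.
apply: le_lt_trans (ler_normD _ _) _.
have low : `|\sum_(i < size s | isd i && (size (nu i) < h)%N) D i *: v (nu i)| <= 4 * K * delta.
  apply: le_trans (ler_norm_sum _ _ _) _.
  apply: le_trans (_ : \sum_(i < size s | isd i && (size (nu i) < h)%N) D i * 2 <= _).
    apply: ler_sum => i _; rewrite normrZ ger0_norm//; apply: ler_wpM2l => //.
    exact: norm_v_le2.
  rewrite -mulr_suml; have := sum_tags_in [seq dyadic_mid R mu | mu <- nodes_below h] sP sd d0.
  rewrite size_map -/K => le; suff : \sum_(i < size s | isd i && (size (nu i) < h)%N) D i <=
    K * (2 * delta) by lra.
  apply: le_trans le; rewrite [leLHS]big_mkcond [leRHS]big_mkcond; apply: ler_sum => i _.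
  case: ifP => [/andP[di hi]|_]; last by case: ifP => // _; exact: D0.
  by rewrite -(nuP i di) map_f// mem_nodes_below.
pose H (i : 'I_(size s)) := isd i && ~~ (size (nu i) < h)%N.
have Hh i : H i -> (h <= size (nu i))%N by move=> /andP[_]; rewrite -leqNgt.
have high1 : N (\sum_(i < size s | H i) D i *: y (nu i)) <= 3 * (2^-1 ^+ h + 2 * delta).
  apply: (@tree_bounds_convex _ _ _ _ h) => // lam.
  pose c := dyadic_left R lam.
  have cc : c <= c + 2^-1 ^+ h by rewrite lerDl exprn_ge0.
  have := sum_tags_between sP sd cc d0.
  rewrite [c + _ - c]addrAC subrr add0r; apply: le_trans.
  rewrite [leLHS]big_mkcond [leRHS]big_mkcond; apply: ler_sum => i _.
  case: ifP => [/andP[/andP[di _] li]|_]; last by case: ifP => // _; exact: D0.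
  have := dyadic_mid_prefix R li; rewrite size_tuple (nuP i di) -/c => ->.
  exact: lexx.
have high2 : `|\sum_(i < size s | H i) D i *: (v (nu i) - iota (y (nu i)))| <= 2^-1 ^+ h / 4.
  apply: le_trans (ler_norm_sum _ _ _) _.
  apply: le_trans (_ : \sum_(i < size s | H i) D i * (2^-1 ^+ h / 4) <= _).
    apply: ler_sum => i Hi; rewrite normrZ ger0_norm//; apply: ler_wpM2l => //.
    apply: le_trans (yv _) _; rewrite ler_pM2r ?invr_gt0//; apply: half_expW.
    exact: Hh.
  rewrite -mulr_suml ler_piMl// ?divr_ge0 ?exprn_ge0//.
  exact: sum_tags sP.
have high : `|\sum_(i < size s | H i) D i *: v (nu i)| <=
    2^-1 ^+ h / 4 + 3 * (2^-1 ^+ h + 2 * delta).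
  have -> : \sum_(i < size s | H i) D i *: v (nu i) =
      \sum_(i < size s | H i) D i *: (v (nu i) - iota (y (nu i))) +
      iota (\sum_(i < size s | H i) D i *: y (nu i)).
    rewrite linear_sum -big_split; apply: eq_bigr => i _ /=.
    by rewrite linearZ scalerBr subrK.
  by apply: le_trans (ler_normD _ _) _; exact: lerD.
apply: le_lt_trans (lerD low high) _.
have Kd : 0 <= K * delta by rewrite mulr_ge0// ltW.
have dE' : 8 * (K * delta) + 16 * delta = eps by rewrite -dE; ring.
rewrite -mulrA; lra.
Qed.

Lemma tree_function_riemann : riemann_integrable Z tree_function.
Proof.
exists 0 => // eps /riemann_sum_small[delta d0 dP]; exists delta => // s xi sP sd.
by rewrite subr0; exact: dP.
Qed.

(** Every neighbourhood of [t] contains the midpoints of two sibling nodes, where the values stay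
    apart because the vectors [y] do. *)
Lemma tree_function_discontinuous (t : R) : 0 <= t <= 1 ->
  ~ (tree_function @ within `[0, 1] (nbhs t) --> tree_function t).
Proof.
move=> t01 /cvgrPdist_lt/(_ (1 / 8)); rewrite divr_gt0// => /(_ isT).
rewrite /within /= nearE => /nbhs_ballP[r /= r0 rP].
have [h hr] := half_exp_small r0.
have [lam szl /andP[l1 l2]] := dyadic_cover h t01.
have near_t mu : prefix lam mu -> `|tree_function t - v mu| < 1 / 8.
  move=> lm; rewrite -(tree_function_mid mu); apply: rP.
    have /andP[m1 m2] := dyadic_mid_prefix R lm; rewrite szl in m2.
    rewrite -ball_normE /=; apply: le_lt_trans hr.
    by rewrite ler_norml; apply/andP; split; lra.
  have /andP[m1 m2] := dyadic_mid_bounds R mu.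
  by rewrite in_itv/= !ltW.
have p0 : prefix lam (rcons lam false) by rewrite -cats1 prefix_prefix.
have p1 : prefix lam (rcons lam true) by rewrite -cats1 prefix_prefix.
have ne : rcons lam false != rcons lam true by rewrite eqseq_rcons andbF.
have := ysep ne; rewrite linearB => sep.
have h4 mu : `|v mu - iota (y mu)| <= 1 / 4.
  apply: le_trans (yv mu) _; rewrite ler_pM2r ?invr_gt0//.
  by rewrite exprn_ile1// ?invr_ge0// invf_le1// ler1n.
have n0 := near_t _ p0; have n1 := near_t _ p1.
have e0 := h4 (rcons lam false); have e1 := h4 (rcons lam true).
set a := rcons lam false in n0 e0 sep; set b := rcons lam true in n1 e1 sep.
(* The right side is below 1/4 + 1/8 + 1/8 + 1/4 < 1, against the separation of [y]. *)
have : `|iota (y a) - iota (y b)| <= `|v a - iota (y a)| + `|tree_function t - v a| +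
    `|tree_function t - v b| + `|v b - iota (y b)|.
  have -> : iota (y a) - iota (y b) = - (v a - iota (y a)) - (tree_function t - v a) +
      (tree_function t - v b) + (v b - iota (y b)).
    rewrite !opprB -!addrA; congr (_ + _).
    by rewrite addrA addNr add0r addrA addNr add0r addrA addNr add0r.
  apply: le_trans (ler_normD _ _) _; rewrite lerD2r.
  apply: le_trans (ler_normD _ _) _; rewrite lerD2r.
  by apply: le_trans (ler_normB _ _) _; rewrite normrN.
lra.
Qed.

Lemma not_lebesgue_property : ~ lebesgue_property Z.
Proof.
move=> leb; have [A [mA A0 sub]] := leb tree_function
  (fun t _ => tree_function_mem t) tree_function_riemann.
pose I : set R := `[0, 1]%classic.
have : (lebesgue_measure I <= lebesgue_measure A)%E.
  apply: le_measure; rewrite ?inE//; first exact: measurable_itv.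
  move=> t; rewrite /I /= in_itv/= => t01; apply: sub; split=> //.
  exact: tree_function_discontinuous.
rewrite A0 /I lebesgue_measure_itv/= lte_fin ltr01 -EFinB subr0 lee_fin.
by rewrite leNgt ltr01.
Qed.

End NotLebesgue.

(** * Failure of the Lebesgue property in closed subspaces *)

Section ClosedSubspaces.
Variables (R : realType) (m n : nat -> nat).
Hypothesis hmn : parameters R m n.
Variables (X : completeNormedModType R) (iota : {linear c00 R -> X}).
Hypothesis hX : is_XD m n iota.
Local Notation N x := (`|iota x|).

(* Coefficients of a unit vector with respect to a normalized block sequence are
   at most 1, so close block sequences carry close tree vectors. *)
Lemma tail_span_perturb (z : nat -> c00 R) (v : nat -> X) K u :
  block_seq z -> (forall k, N (z k) = 1) ->
  (forall k, `|v k - iota (z k)| <= 2^-1 ^+ k / 8) -> tail_span z K u -> N u = 1 ->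
  exists (M : nat) (a : 'I_M -> R), `|\sum_i a i *: v i - iota u| <= 2^-1 ^+ K / 4.
Proof.
move=> zb z1 vz [M [a [a0 eu]]] u1; exists M, (fun i => a i).
have a1 (i : 'I_M) : `|a i| <= 1.
  rewrite -u1; pose P : pred nat := fun k => z i k != 0.
  apply: le_trans (norm_restr hX P u); rewrite eu restr_sum (bigD1 i)//= big1 ?addr0.
    by rewrite restrZ restr_id// linearZ normrZ z1 mulr1.
  move=> l li; rewrite restrZ (_ : restr P _ = 0) ?scaler0//; apply: restr_eq0 => k Pk.
  have [lt|lt|e] := ltngtP (i : nat) l.
  - exact: precedes_eq0 (block_seq_precedes zb lt) Pk.
  - exact: precedes_eq0r (block_seq_precedes zb lt) Pk.
  by move: li; rewrite -(inj_eq val_inj) /= e eqxx.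
rewrite eu linear_sum -sumrB; apply: le_trans (ler_norm_sum _ _ _) _.
(* The subtracted remainder makes the induction on [L] go through, including the range L <= K where
   the sum is empty. *)
have geom : forall L : nat, \sum_(i < L | (K <= i)%N) (2^-1 : R) ^+ i <= 2 * 2^-1 ^+ K - 2 * 2^-1 ^+ maxn K L.
  elim=> [|L IH]; first by rewrite big_ord0 maxn0 subrr.
  rewrite big_mkcond big_ord_recr/= -big_mkcond/=.
  have [KL|LK] := leqP K L.
    rewrite (maxn_idPr KL) in IH; rewrite (maxn_idPr (leqW KL)) exprS.
    by move: IH; lra.
  rewrite (maxn_idPl (ltnW LK)) in IH; rewrite (maxn_idPl LK) addr0; exact: IH.
apply: le_trans (_ : \sum_(i < M | (K <= i)%N) (2^-1 : R) ^+ i / 8 <= _).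
  rewrite [leRHS]big_mkcond; apply: ler_sum => i _; rewrite linearZ -scalerBr normrZ.
  have [Ki|iK] := leqP K i; last first.
    by rewrite a0 ?normr0 ?mul0r// negb_and -ltnNge iK.
  by apply: le_trans (vz i); rewrite ler_piMl.
rewrite -mulr_suml; have := geom M; have : 0 <= (2^-1 : R) ^+ maxn K M by rewrite exprn_ge0.
by lra.
Qed.

(** The tree is built on blocks near [Z], not in [Z]. Copying coefficients gives members [w lam] of
    [Z] with errors decaying in the height of [lam], so the perturbation vanishes in the Riemann
    sums. *)
Lemma no_lebesgue_property (Z : set X) : closed_subspace Z -> infinite_dimensional Z ->
  ~ lebesgue_property Z.
Proof.
move=> Zc Zinf.
have [v [z [zb z1 Zv vz]]] := exists_block_approximation hX Zc Zinf.
have [y [yz yb yu]] := exists_tree_vectors hmn hX zb z1.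
have exw lam : exists w, Z w /\ `|w - iota (y lam)| <= 2^-1 ^+ size lam / 4.
  have [ys y1] := yz lam; have [M [a aP]] := tail_span_perturb zb z1 vz ys y1.
  exists (\sum_i a i *: v i); split=> //.
  exact: closed_subspace_sum.
have [w wP] := choice exw.
have [nd ndP] := exists_node_of R.
have Z0 : Z 0 by have [] := Zc.
apply: (@not_lebesgue_property R m n X iota hX Z y w Z0 _ _ yu _ _ nd ndP).
- by move=> lam; have [] := wP lam.
- by move=> lam; have [] := yz lam.
(* Separation: projecting a difference to the support of one of two disjoint unit vectors returns
   that vector. *)
- move=> lam mu; have [k <-] := enum_node_surj lam; have [l <-] := enum_node_surj mu.
  move=> kl; have {kl}kl : k != l by apply: contra kl => /eqP ->.
  pose P : pred nat := fun i => y (enum_node k) i != 0.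
  have [_ y1] := yz (enum_node k); rewrite -y1.
  have e : y (enum_node k) = restr P (y (enum_node k) - y (enum_node l)).
    apply: c00P => i; rewrite restrE; case: ifPn => [Pi|/negbNE/eqP//].
    rewrite c00_D c00_N (_ : y (enum_node l) i = 0) ?subr0//.
    have [lt|lt|e] := ltngtP k l; last by rewrite e eqxx in kl.
      exact: precedes_eq0 (block_seq_precedes yb lt) Pi.
    exact: precedes_eq0r (block_seq_precedes yb lt) Pi.
  by rewrite {1}e; exact: (norm_restr hX).
by move=> lam; have [] := wP lam.
Qed.

End ClosedSubspaces.

Theorem theorem6p1 (R : realType) (m n : nat -> nat)
    (hmn : parameters R m n)
    (X : completeNormedModType R) (iota : {linear c00 R -> X})
    (hX : is_XD m n iota) :
  (forall Y : set X, block_subspace iota Y -> infinite_dimensional Y ->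
     exists y : node -> c00 R,
       [/\ forall lam : node, Y (iota (y lam)) /\ `|iota (y lam)| = 1,
           block_seq (fun k => y (enum_node k))
         & forall (N : nat) (mu : N.-tuple bool -> node)
             (a : N.-tuple bool -> R),
           (forall lam : N.-tuple bool, prefix lam (mu lam)) ->
           \big[Num.max/0]_(lam : N.-tuple bool) `|a lam|
             <= `|\sum_(lam : N.-tuple bool) a lam *: iota (y (mu lam))|
             <= 3 * \big[Num.max/0]_(lam : N.-tuple bool) `|a lam| ])
  /\
  (forall Z : set X, closed_subspace Z -> infinite_dimensional Z ->
     ~ lebesgue_property Z).
Proof.
split=> [Y YB _|Z Zc Zinf]; last first.
  exact: (no_lebesgue_property hmn hX Zc Zinf).
have [y [yY yb yu]] := block_subspace_tree hmn hX YB.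
exists y; split=> // h mu a muP; have := yu h mu a muP.
rewrite linear_sum (eq_bigr (fun lam => a lam *: iota (y (mu lam))))// => lam _.
exact: linearZ.
Qed.
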